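(* Assume the following. (a) (Weak $B$-condition) There are a strictly positive self-adjoint $B\in L(H)$ with $A^*B\in L(H)$ and $c_0\ge0$ such that $-A^*B+c_0B\ge0$. (b) $b$ and $\sigma$ are continuous on $H\times\Lambda_0$ and there is $C>0$ such that $\|b(x,a)-b(x',a)\|_H\le C\|x-x'\|_{-1}$, $\|\sigma(x,a)-\sigma(x',a)\|_{L_2(\Xi,H)}\le C\|x-x'\|_{-1}$, $\|b(x,a)\|_H\le C(1+\|x\|_H+\|a\|_\Lambda)$ and $\|\sigma(x,a)\|_{L_2(\Xi,H)}\le C(1+\|x\|_H+\|a\|_\Lambda)$ for all $x,x'\in H$, $a\in\Lambda_0$. (c) $l$ is continuous on $H\times\Lambda_0$ and there is $C>0$ such that $|l(x,a)-l(x',a)|\le C\|x-x'\|_{-1}$, $|l(x,a)|\le C(1+\|x\|_H+\|a\|_\Lambda^2)$ and $|g(x)-g(x')|\le C\|x-x'\|_{-1}$ for all $x,x'\in H$, $a\in\Lambda_0$; moreover, if $\Lambda_0$ is unbounded, $l$ and $g$ are bounded from below. (d) For every $t\in[0,T]$, $V(t,\cdot)$ is semiconvex in $H_{-1}$ and semiconcave in $H_{-1}$. Then $V$ can be extended to a function on $[0,T]\times H_{-1}$ (still denoted by $V$) such that $V(t,\cdot)\in C^{1,1}(H_{-1})$ for every $0\le t\le T$.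
   Context: $H$ and $\Xi$ are real separable Hilbert spaces, $\Lambda$ is a real separable Banach space, $\Lambda_0\subset\Lambda$ is convex, $p>2$ and $0<T<\infty$ are fixed. $L(H)$ denotes bounded linear operators on $H$, $L_2(\Xi,H)$ Hilbert--Schmidt operators. For $C\in L(H)$, $C\ge0$ means $\langle Cx,x\rangle_H\ge0$ for all $x$; a self-adjoint $B$ is strictly positive if $\langle Bx,x\rangle_H>0$ for $x\neq0$; $\|x\|_{-1}^2:=\langle Bx,x\rangle_H$ and $H_{-1}$ is the completion of $H$ in this norm, a Hilbert space with $\langle x,y\rangle_{-1}=\langle B^{1/2}x,B^{1/2}y\rangle_H$. $C^{1,1}(H_{-1})$ is the space of Fréchet differentiable functions $H_{-1}\to\mathbb R$ with Lipschitz continuous derivative. $A:\mathcal D(A)\subset H\to H$ is linear, densely defined and maximal dissipative; it generates a $C_0$-semigroup of contractions $(\mathrm e^{sA})_{s\ge 0}$. The coefficients are $b:H\times\Lambda\to H$, $\sigma:H\times\Lambda\to L_2(\Xi,H)$, $l:H\times\Lambda\to\mathbb R$, $g:H\to\mathbb R$. A function $v:H\to\mathbb R$ is semiconcave in $H_{-1}$ if there is $C>0$ with $\lambda v(x)+(1-\lambda)v(x')-v(\lambda x+(1-\lambda)x')\le C\lambda(1-\lambda)\|x-x'\|_{-1}^2$ for all $\lambda\in[0,1]$, $x,x'\in H$; it is semiconvex in $H_{-1}$ if $-v$ is semiconcave in $H_{-1}$. For $t\in[0,T]$, a reference probability space $(\Omega,\mathscr F,(\mathscr F^t_s)_{s\in[t,T]},\mathbb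 P,(W(s))_{s\in[t,T]})$ is fixed: $(\Omega,\mathscr F,\mathbb P)$ is complete, $W$ is a cylindrical Wiener process in $\Xi$ with $W(t)=0$ $\mathbb P$-a.s., and $\mathscr F^t_s$ is generated by $\{W(\tau):t\le\tau\le s\}$ and the $\mathbb P$-null sets. $\mathcal U_t$ is the set of all $\mathscr F^t_s$-progressively measurable $a(\cdot):[t,T]\times\Omega\to\Lambda_0$ with $\mathbb E\int_t^T\|a(s)\|_\Lambda^p\,\mathrm ds<\infty$. $X(\cdot;t,x,a(\cdot))$ is the mild solution with continuous trajectories of $\mathrm dX(s)=[AX(s)+b(X(s),a(s))]\mathrm ds+\sigma(X(s),a(s))\mathrm dW(s)$, $X(t)=x$, i.e. $X(s)=\mathrm e^{(s-t)A}x+\int_t^s\mathrm e^{(s-r)A}b(X(r),a(r))\mathrm dr+\int_t^s\mathrm e^{(s-r)A}\sigma(X(r),a(r))\mathrm dW(r)$. Further $J(t,x;a(\cdot))=\mathbb E\big[\int_t^T l(X(s),a(s))\mathrm ds+g(X(T))\big]$ with $X(s)=X(s;t,x,a(\cdot))$, and the value function is $V(t,x)=\inf_{a(\cdot)\in\mathcal U_t}J(t,x;a(\cdot))$. *)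

(* Defs.v *)
From HB Require Import structures.
From mathcomp Require Import all_boot all_order all_algebra.
From mathcomp Require Import all_classical all_reals all_analysis.
From mathcomp Require Import measurable_realfun.

Set Implicit Arguments.
Unset Strict Implicit.
Unset Printing Implicit Defensive.

Import Order.TTheory GRing.Theory Num.Theory.
Import numFieldNormedType.Exports.

Local Open Scope classical_set_scope.
Local Open Scope ring_scope.

HB.mixin Record CompleteNormedModule_isHilbert (R : realType) H
    of CompleteNormedModule R H := {
  inner : H -> H -> R ;
  innerC : forall x y, inner x y = inner y x ;
  inner_linearl : forall (c : R) (x y z : H),
    inner (c *: x + y) z = c * inner x z + inner y z ;
  inner_norm : forall x, inner x x = `|x| ^+ 2
}.

#[short(type="hilbertType")]
HB.structure Definition Hilbert (R : realType) :=
  {H of CompleteNormedModule R H & CompleteNormedModule_isHilbert R H}.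

Definition separable (T : topologicalType) : Prop :=
  exists2 D : set T, countable D & dense D.

Definition bounded_operator (R : realType) (U V : normedModType R)
    (f : U -> V) : Prop := linear f /\ continuous f.

Definition orthonormal_basis (R : realType) (Xi : hilbertType R)
    (E : set Xi) : Prop :=
  (forall e f, E e -> E f -> inner e f = (e == f)%:R) /\
  (forall x, (forall e, E e -> inner x e = 0) -> x = 0).

(* The Hilbert-Schmidt norm does not depend on the orthonormal basis E; the
   squared norm is extended-real valued, the norm [hs_norm] is meaningful for
   Hilbert-Schmidt operators. *)
Definition hs_sq (R : realType) (Xi H : hilbertType R) (E : set Xi)
    (f : Xi -> H) : \bar R :=
  (\esum_(e in E) (`|f e| ^+ 2)%:E)%E.

Definition hilbert_schmidt (R : realType) (Xi H : hilbertType R) (E : set Xi)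
    (f : Xi -> H) : Prop :=
  bounded_operator f /\ (hs_sq E f < +oo)%E.

Definition hs_norm (R : realType) (Xi H : hilbertType R) (E : set Xi)
    (f : Xi -> H) : R :=
  Num.sqrt (fine (hs_sq E f)).

(* An unbounded operator is given by its domain D and a total function A of
   which only the values on D matter. *)
Definition linear_operator (R : realType) (H : hilbertType R) (D : set H)
    (A : H -> H) : Prop :=
  D 0 /\ (forall (c : R) x y, D x -> D y ->
    D (c *: x + y) /\ A (c *: x + y) = c *: A x + A y).

Definition dissipative (R : realType) (H : hilbertType R) (D : set H)
    (A : H -> H) : Prop :=
  forall x, D x -> inner (A x) x <= 0.

Definition maximal_dissipative (R : realType) (H : hilbertType R) (D : set H)
    (A : H -> H) : Prop :=
  dissipative D A /\
  (forall (D' : set H) (A' : H -> H),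
     linear_operator D' A' -> dissipative D' A' ->
     D `<=` D' -> (forall x, D x -> A' x = A x) -> D' `<=` D).

Definition contraction_semigroup (R : realType) (H : hilbertType R)
    (S : R -> H -> H) : Prop :=
  [/\ forall s, 0 <= s -> linear (S s),
      forall x, S 0 x = x,
      forall s r x, 0 <= s -> 0 <= r -> S (s + r) x = S s (S r x),
      forall s x, 0 <= s -> `|S s x| <= `|x| &
      forall x, S s x @[s --> 0^'+] --> x].

Definition generator (R : realType) (H : hilbertType R) (D : set H)
    (A : H -> H) (S : R -> H -> H) : Prop :=
  forall x y,
    (D x /\ A x = y) <-> (h^-1 *: (S h x - x) @[h --> 0^'+] --> y).

(* y \in D(A^* ) and A^* y = z *)
Definition adjoint_at (R : realType) (H : hilbertType R) (D : set H)
    (A : H -> H) (y z : H) : Prop :=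
  forall x, D x -> inner (A x) y = inner x z.

Definition strictly_positive (R : realType) (H : hilbertType R)
    (B : H -> H) : Prop :=
  (forall x y, inner (B x) y = inner x (B y)) /\
  (forall x, x != 0 -> 0 < inner (B x) x).

(* AB stands for A^* B. *)
Definition weak_B_condition (R : realType) (H : hilbertType R) (D : set H)
    (A B : H -> H) : Prop :=
  [/\ bounded_operator B, strictly_positive B &
      exists AB : H -> H,
        [/\ bounded_operator AB,
            forall x, adjoint_at D A (B x) (AB x) &
            exists2 c0 : R, 0 <= c0 &
              forall x, 0 <= inner (- AB x + c0 *: B x) x]].

Definition norm_m1 (R : realType) (H : hilbertType R) (B : H -> H) (x : H) : R :=
  Num.sqrt (inner (B x) x).

(* Hm together with iota is a completion of H for the inner product
   <B x, y> = <B^(1/2) x, B^(1/2) y>; it is unique up to isometry. *)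
Definition completion_m1 (R : realType) (H Hm : hilbertType R) (B : H -> H)
    (iota : H -> Hm) : Prop :=
  [/\ linear iota,
      forall x y, inner (iota x) (iota y) = inner (B x) y &
      dense (range iota)].

Definition semiconcave_m1 (R : realType) (H : hilbertType R) (B : H -> H)
    (v : H -> R) : Prop :=
  exists2 C : R, 0 < C &
    forall (lam : R) (x x' : H), 0 <= lam <= 1 ->
      lam * v x + (1 - lam) * v x' - v (lam *: x + (1 - lam) *: x')
      <= C * lam * (1 - lam) * norm_m1 B (x - x') ^+ 2.

Definition semiconvex_m1 (R : realType) (H : hilbertType R) (B : H -> H)
    (v : H -> R) : Prop :=
  semiconcave_m1 B (fun x => - v x).

(* The Lipschitz bound is the operator-norm bound
   |Df(x) - Df(y)| <= L |x - y|, written on vectors. *)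
Definition C11 (R : realType) (K : hilbertType R) (f : K -> R) : Prop :=
  (forall x, differentiable f x) /\
  (exists L : R, forall x y h : K,
     `|'d f x h - 'd f y h| <= L * `|x - y| * `|h|).

Record simple_map (R : realType) (H : hilbertType R) := SimpleMap {
  sm_size : nat ;
  sm_set : 'I_sm_size -> set (measurableTypeR R) ;
  sm_vec : 'I_sm_size -> H ;
  sm_measurable : forall i, measurable (sm_set i)
}.

Definition sm_val (R : realType) (H : hilbertType R) (phi : simple_map H)
    (r : R) : H :=
  \sum_i (\1_(sm_set (s := phi) i) r : R) *: sm_vec i.

Definition sm_integral (R : realType) (H : hilbertType R)
    (D : set (measurableTypeR R)) (phi : simple_map H) : H :=
  \sum_i fine (lebesgue_measure (sm_set (s := phi) i `&` D)) *: sm_vec i.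

Definition is_bochner (R : realType) (H : hilbertType R)
    (D : set (measurableTypeR R)) (f : R -> H) (y : H) : Prop :=
  exists phi : nat -> simple_map H,
    [/\ forall n, measurable_fun D
          (fun r : measurableTypeR R => `|f r - sm_val (phi n) r|),
        (\int[lebesgue_measure]_(r in D) (`|f r - sm_val (phi n) r|)%:E)%E
          @[n --> \oo] --> 0%E &
        sm_integral D (phi n) @[n --> \oo] --> y].

(* A cylindrical Wiener process is represented by its coordinates:
   [ref_W s xi] is the real random variable <W(s), xi>. *)
Record ref_space (R : realType) (Xi : hilbertType R) := RefSpace {
  ref_disp : measure_display ;
  ref_Omega :> measurableType ref_disp ;
  ref_P : probability ref_Omega R ;
  ref_W : R -> Xi -> ref_Omega -> R
}.

Definition filtration (R : realType) (Xi : hilbertType R) (Om : ref_space Xi)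
    (t s : R) : set (set Om) :=
  <<s [set F | exists tau xi (C : set (measurableTypeR R)),
         [/\ t <= tau <= s, measurable C & F = ref_W tau xi @^-1` C]]
      `|` (ref_P Om).-negligible >>.

Definition cylindrical_wiener (R : realType) (Xi : hilbertType R)
    (Om : ref_space Xi) (t T : R) : Prop :=
  [/\ forall s xi, t <= s <= T ->
        measurable_fun [set: Om] (@ref_W _ _ Om s xi : Om -> measurableTypeR R),
      forall xi, {ae ref_P Om, forall w, ref_W t xi w = 0},
      forall s (c : R) xi eta, t <= s <= T ->
        {ae ref_P Om, forall w,
           ref_W s (c *: xi + eta) w = c * ref_W s xi w + ref_W s eta w},
      forall xi, {ae ref_P Om, forall w,
        {within `[t, T], continuous (fun s : R => ref_W s xi w)}} &
      forall r s xi, t <= r -> r < s -> s <= T -> xi != 0 ->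
        forall C : set (measurableTypeR R), measurable C ->
        let incr := [set w : Om | C (ref_W s xi w - ref_W r xi w)] in
        ref_P Om incr = normal_prob 0 (Num.sqrt (s - r) * `|xi|) C /\
        (forall F, filtration t r F ->
           ref_P Om (F `&` incr) = (ref_P Om F * ref_P Om incr)%E)].

Definition reference_space (R : realType) (Xi : hilbertType R)
    (Om : ref_space Xi) (t T : R) : Prop :=
  measure_is_complete (ref_P Om) /\ cylindrical_wiener Om t T.

Definition adapted (R : realType) (Xi : hilbertType R) (Om : ref_space Xi)
    (t T : R) (V : normedModType R) (Y : R -> Om -> V) : Prop :=
  forall s, t <= s <= T -> forall O : set V, open O ->
    filtration t s (Y s @^-1` O).

Definition progressively_measurable (R : realType) (Xi : hilbertType R)
    (Om : ref_space Xi) (t T : R) (V : normedModType R)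
    (Y : R -> Om -> V) : Prop :=
  forall s, t <= s <= T -> forall O : set V, open O ->
    <<s `[t, s] `*` [set: Om],
        [set Q | exists (C : set (measurableTypeR R)) (F : set Om),
           [/\ measurable C, C `<=` `[t, s], filtration t s F & Q = C `*` F]] >>
    ((`[t, s] `*` [set: Om]) `&` [set z | O (Y z.1 z.2)]).

(* The elementary process
     sum_i 1_{]lo_i, hi_i]}(r) 1_{F_i}(w) <xi_i, .> h_i
   with finite-rank operator values. *)
Record elem_process (R : realType) (Xi H : hilbertType R)
    (Om : ref_space Xi) := ElemProcess {
  ep_size : nat ;
  ep_lo : 'I_ep_size -> R ;
  ep_hi : 'I_ep_size -> R ;
  ep_event : 'I_ep_size -> set Om ;
  ep_xi : 'I_ep_size -> Xi ;
  ep_h : 'I_ep_size -> H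
}.

Definition ep_adapted (R : realType) (Xi H : hilbertType R)
    (Om : ref_space Xi) (t s : R) (phi : elem_process H Om) : Prop :=
  forall i : 'I_(ep_size phi),
    [/\ t <= ep_lo i, ep_lo i <= ep_hi i, ep_hi i <= s &
        filtration t (ep_lo i) (ep_event i)].

Definition ep_val (R : realType) (Xi H : hilbertType R) (Om : ref_space Xi)
    (phi : elem_process H Om) (r : R) (w : Om) (xi : Xi) : H :=
  \sum_(i < ep_size phi)
    ((\1_(`]ep_lo i, ep_hi i]) r : R) * (\1_(ep_event i) w : R)
     * inner (ep_xi i) xi) *: ep_h i.

Definition ep_integral (R : realType) (Xi H : hilbertType R)
    (Om : ref_space Xi) (phi : elem_process H Om) (w : Om) : H :=
  \sum_(i < ep_size phi)
    ((\1_(ep_event i) w : R)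
     * (ref_W (ep_hi i) (ep_xi i) w - ref_W (ep_lo i) (ep_xi i) w)) *: ep_h i.

(* I = int_t^s Phi dW, as the L^2(Omega; H)-limit of integrals of elementary
   processes converging to Phi in L^2([t, s] x Omega; L_2(Xi, H)). The
   measurability clauses make the integrals below genuine ones: [\int] of a
   non-measurable function is only a lower integral. *)
Definition is_ito (R : realType) (Xi H : hilbertType R) (E : set Xi)
    (Om : ref_space Xi) (t s : R) (Phi : R -> Om -> Xi -> H)
    (I : Om -> H) : Prop :=
  exists phi : nat -> elem_process H Om,
    [/\ forall n, ep_adapted t s (phi n),
        forall n, measurable_fun (`[t, s] `*` [set: Om])
          ((fun z => hs_sq E (fun xi =>
              Phi z.1 z.2 xi - ep_val (phi n) z.1 z.2 xi))
            : measurableTypeR R * Om -> \bar R),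
        (\int[ref_P Om]_w \int[lebesgue_measure]_(r in `[t, s])
           hs_sq E (fun xi => (Phi r w xi - ep_val (phi n) r w xi)%R))%E
          @[n --> \oo] --> 0%E,
        forall n, measurable_fun [set: Om]
          (fun w : Om => `|I w - ep_integral (phi n) w| : measurableTypeR R) &
        (\int[ref_P Om]_w (`|I w - ep_integral (phi n) w| ^+ 2)%:E)%E
          @[n --> \oo] --> 0%E].

Definition admissible (R : realType) (Xi : hilbertType R) (Om : ref_space Xi)
    (Lam : normedModType R) (Lam0 : set Lam) (p t T : R)
    (a : R -> Om -> Lam) : Prop :=
  [/\ forall s w, t <= s <= T -> Lam0 (a s w),
      progressively_measurable t T a &
      (\int[ref_P Om]_w \int[lebesgue_measure]_(s in `[t, T])
          (`|a s w| `^ p)%:E < +oo)%E].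

(* The square-integrability clause selects the usual class in which mild
   solutions exist and are unique. *)
Definition mild_solution (R : realType) (H Xi : hilbertType R) (E : set Xi)
    (Om : ref_space Xi) (Lam : normedModType R) (S : R -> H -> H)
    (b : H -> Lam -> H) (sigma : H -> Lam -> Xi -> H) (t T : R) (x : H)
    (a : R -> Om -> Lam) (X : R -> Om -> H) : Prop :=
  [/\ adapted t T X,
      forall w, {within `[t, T], continuous (fun s : R => X s w)},
      (\int[ref_P Om]_w \int[lebesgue_measure]_(s in `[t, T])
          (`|X s w| ^+ 2)%:E < +oo)%E &
      forall s, t <= s <= T ->
        exists drift noise : Om -> H,
          [/\ {ae ref_P Om, forall w,
                 is_bochner `[t, s] (fun r => S (s - r) (b (X r w) (a r w)))
                   (drift w)},
              is_ito E t s
                (fun r w xi => S (s - r) (sigma (X r w) (a r w) xi)) noise &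
              {ae ref_P Om, forall w,
                 X s w = S (s - t) x + drift w + noise w}]].

Definition cost (R : realType) (H Xi : hilbertType R) (Om : ref_space Xi)
    (Lam : normedModType R) (l : H -> Lam -> R) (g : H -> R) (t T : R)
    (X : R -> Om -> H) (a : R -> Om -> Lam) : \bar R :=
  ('E_(ref_P Om)[fun w =>
     ((\int[lebesgue_measure]_(s in `[t, T]) l (X s w) (a s w))
      + g (X T w))%R])%E.

(* The infimum is taken in the extended reals, so that no default value is
   ever involved. *)
Definition value (R : realType) (H Xi : hilbertType R) (Om : ref_space Xi)
    (Lam : normedModType R) (Lam0 : set Lam) (l : H -> Lam -> R) (g : H -> R)
    (p t T : R) (X : (R -> Om -> Lam) -> R -> Om -> H) : \bar R :=
  ereal_inf [set cost l g t T (X a) a | a in admissible Lam0 p t T].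

Definition dynamics_assumptions (R : realType) (H Xi : hilbertType R)
    (E : set Xi) (Lam : normedModType R) (Lam0 : set Lam) (B : H -> H)
    (b : H -> Lam -> H) (sigma : H -> Lam -> Xi -> H) : Prop :=
  [/\ {within [set z : H * Lam | Lam0 z.2], continuous (fun z => b z.1 z.2)},
      forall x a, Lam0 a ->
        hs_norm E (fun xi => sigma z.1 z.2 xi - sigma x a xi)
          @[z --> within [set z : H * Lam | Lam0 z.2] (nbhs (x, a))] --> (0 : R) &
      exists2 C : R, 0 < C & forall x x' a, Lam0 a ->
        [/\ `|b x a - b x' a| <= C * norm_m1 B (x - x'),
            hs_norm E (fun xi => sigma x a xi - sigma x' a xi)
              <= C * norm_m1 B (x - x'),
            `|b x a| <= C * (1 + `|x| + `|a|) &
            hs_norm E (sigma x a) <= C * (1 + `|x| + `|a|)]].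

Definition cost_assumptions (R : realType) (H : hilbertType R)
    (Lam : normedModType R) (Lam0 : set Lam) (B : H -> H)
    (l : H -> Lam -> R) (g : H -> R) : Prop :=
  [/\ {within [set z : H * Lam | Lam0 z.2], continuous (fun z => l z.1 z.2)},
      exists2 C : R, 0 < C & forall x x' a, Lam0 a ->
        [/\ `|l x a - l x' a| <= C * norm_m1 B (x - x'),
            `|l x a| <= C * (1 + `|x| + `|a| ^+ 2) &
            `|g x - g x'| <= C * norm_m1 B (x - x')] &
      ~ bounded_set Lam0 ->
        exists m : R, (forall x a, Lam0 a -> m <= l x a) /\
                      (forall x, m <= g x)].

(* Main.v *)
Require Import Defs.
From HB Require Import structures.
From mathcomp Require Import all_boot all_order all_algebra.
From mathcomp Require Import all_classical all_reals all_analysis.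
From mathcomp Require Import measurable_realfun.
From mathcomp Require Import ring lra.

Set Implicit Arguments.
Unset Strict Implicit.
Unset Printing Implicit Defensive.

Import Order.TTheory GRing.Theory Num.Theory.
Import numFieldNormedType.Exports.

Local Open Scope classical_set_scope.
Local Open Scope ring_scope.

(** Two solutions driven by the same control satisfy the difference of the mild
    equations. By the weak B-condition the semigroup is bounded in the negative
    norm, |S(s) x|_{-1} <= e^{c0 s} |x|_{-1}, so the Lipschitz assumptions, the Ito
    isometry and Gronwall's lemma give E |X(s; x) - X(s; y)|_{-1}^2 <= K |x - y|_{-1}^2
    without recourse to Ito's formula. Hence the cost, uniformly in the control, and
    therefore V(t, .) are Lipschitz in the negative norm; V(t, .) is finite because the
    cost is bounded below, either by assumption or, when Lam0 is bounded, by the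
    moment bound for the state. The McShane extension
    y |-> inf_x (v x + L |y - iota x|) of v = V(t, .) to H_{-1} inherits semiconvexity
    and semiconcavity by density. A Lipschitz function f with both properties has
    directional derivatives p_x(h) with |f (x + h) - f x - p_x h| <= C |h|^2, and this
    quadratic remainder makes p_x linear and Lipschitz in x. *)

(** * Hilbert spaces *)

(** Ito's formula can be avoided because the coefficients absorb the loss of norm: differences of
    [b] and [sigma] are bounded in the strong norms of H and of Hilbert-Schmidt operators by the
    negative norm of the states. Under the integrals, contractivity of the semigroup in H and |iota
    y| <= c |y| therefore close the estimate; the negative-norm bound on the semigroup is spent on
    the initial datum. The obstacle is the stochastic integral, since [is_ito] only asserts an
    L^2-approximation by elementary processes. Two noises are compared through the difference of
    their approximations, which is again elementary. Its isometry is an identity between finite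
    double sums, and its density is a Gram sum dominated by the squared Hilbert-Schmidt norm through
    Parseval's identity. Each splitting of a square into three terms costs a factor 3: once for the
    state, once for the noise, once for the integrand. This is the origin of 27 in the constant 3 (T
    - t) + 27 of the mean-square estimates. *)

Section HilbertBasics.
Variables (R : realType) (H : hilbertType R).
Implicit Types (x y z : H) (c : R).

Lemma innerDl x y z : inner (x + y) z = inner x z + inner y z.
Proof. by rewrite -{1}[x]scale1r inner_linearl mul1r. Qed.

Lemma inner0l z : inner 0 z = 0.
Proof. by apply: (addrI (inner 0 z)); rewrite -innerDl !addr0. Qed.

Lemma innerZl c x z : inner (c *: x) z = c * inner x z.
Proof. by rewrite -{1}[c *: x]addr0 inner_linearl inner0l addr0. Qed.

Lemma innerNl x z : inner (- x) z = - inner x z.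
Proof. by rewrite -scaleN1r innerZl mulN1r. Qed.

Lemma innerBl x y z : inner (x - y) z = inner x z - inner y z.
Proof. by rewrite innerDl innerNl. Qed.

Lemma innerDr x y z : inner z (x + y) = inner z x + inner z y.
Proof. by rewrite innerC innerDl !(innerC _ z). Qed.

Lemma inner0r z : inner z 0 = 0.
Proof. by rewrite innerC inner0l. Qed.

Lemma innerZr c x z : inner z (c *: x) = c * inner z x.
Proof. by rewrite innerC innerZl innerC. Qed.

Lemma innerNr x z : inner z (- x) = - inner z x.
Proof. by rewrite innerC innerNl innerC. Qed.

Lemma innerBr x y z : inner z (x - y) = inner z x - inner z y.
Proof. by rewrite innerDr innerNr. Qed.

Lemma inner_suml (I : Type) (r : seq I) (P : pred I) (F : I -> H) z :
  inner (\sum_(i <- r | P i) F i) z = \sum_(i <- r | P i) inner (F i) z.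
Proof.
by apply: (big_morph (fun x => inner x z)) => [x y|]; rewrite ?innerDl ?inner0l.
Qed.

Lemma inner_sumr (I : Type) (r : seq I) (P : pred I) (F : I -> H) z :
  inner z (\sum_(i <- r | P i) F i) = \sum_(i <- r | P i) inner z (F i).
Proof. by rewrite innerC inner_suml; apply: eq_bigr => i _; rewrite innerC. Qed.

Lemma normrD_inner x y :
  `|x + y| ^+ 2 = `|x| ^+ 2 + 2 * inner x y + `|y| ^+ 2.
Proof.
by rewrite -!inner_norm innerDl !innerDr (innerC y x); ring.
Qed.

Lemma cauchy_schwarz x y : `|inner x y| <= `|x| * `|y|.
Proof.
have [->|y0] := eqVneq y 0; first by rewrite inner0r !normr0 mulr0.
have ny : 0 < `|y| ^+ 2 by rewrite exprn_gt0// normr_gt0.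
rewrite -ler_sqr ?nnegrE ?mulr_ge0// real_normK ?num_real// exprMn.
have := sqr_ge0 (`|x - (inner x y / `|y| ^+ 2) *: y|).
rewrite normrD_inner normrN normrZ innerNr innerZr exprMn real_normK ?num_real//.
have sE (a i n : R) : n != 0 ->
    a + 2 * - (i / n * i) + (i / n) ^+ 2 * n = a - i ^+ 2 / n.
  by move=> n0; field.
rewrite sE ?gt_eqF//.
by rewrite subr_ge0 ler_pdivrMr.
Qed.

Lemma sqr_normD_le x y : `|x + y| ^+ 2 <= 2 * `|x| ^+ 2 + 2 * `|y| ^+ 2.
Proof.
have := sqr_ge0 (`|x - y|); rewrite !normrD_inner normrN innerNr; lra.
Qed.

Lemma sqr_normD3_le x y z :
  `|x + y + z| ^+ 2 <= 3 * `|x| ^+ 2 + 3 * `|y| ^+ 2 + 3 * `|z| ^+ 2.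
Proof.
apply: (@le_trans _ _ ((`|x| + `|y| + `|z|) ^+ 2)).
  rewrite ler_sqr ?nnegrE ?addr_ge0// (le_trans (ler_normD _ _))// lerD2r.
  exact: ler_normD.
have := sqr_ge0 (`|x| - `|y|); have := sqr_ge0 (`|y| - `|z|).
have := sqr_ge0 (`|x| - `|z|); nra.
Qed.

End HilbertBasics.

Section LinearOperators.
Variables (R : realType) (U V : normedModType R) (f : U -> V).

Lemma linear_funD : linear f -> forall x y, f (x + y) = f x + f y.
Proof. by move=> lf x y; rewrite -{1}[x]scale1r lf scale1r. Qed.

Lemma linear_fun0 : linear f -> f 0 = 0.
Proof.
by move=> lf; apply: (addrI (f 0)); rewrite -linear_funD// !addr0.
Qed.

Lemma linear_funZ : linear f -> forall c x, f (c *: x) = c *: f x.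
Proof. by move=> lf c x; rewrite -{1}[c *: x]addr0 lf linear_fun0// addr0. Qed.

Lemma linear_funB : linear f -> forall x y, f (x - y) = f x - f y.
Proof.
by move=> lf x y; rewrite -scaleN1r linear_funD// linear_funZ// scaleN1r.
Qed.

Lemma bounded_operator_le : bounded_operator f ->
  exists2 M : R, 0 < M & forall x, `|f x| <= M * `|x|.
Proof.
move=> [lf cf].
pose F := GRing.isLinear.Build R U V *:%R f lf.
pose g : {linear U -> V} := HB.pack f F.
have : bounded_near (g : U -> V) (nbhs (0 : U)).
  by apply: continuous_linear_bounded => x; exact: cf.
move=> /linear_boundedP [M [Mr]].
move=> /(_ (`|M| + 1)) gM; exists (`|M| + 1); first by rewrite ltr_wpDl.
by move=> x; apply: gM; rewrite (le_lt_trans (ler_norm _))// ltrDl.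
Qed.

End LinearOperators.

(** * Regularity of semiconvex and semiconcave functions *)

Section SemiconvexSemiconcave.
Variables (R : realType) (K : hilbertType R) (f : K -> R) (C L : R).
Hypothesis C0 : 0 <= C.
Hypothesis f_semi : forall (lam : R) x x', 0 <= lam <= 1 ->
  `|lam * f x + (1 - lam) * f x' - f (lam *: x + (1 - lam) *: x')|
    <= C * lam * (1 - lam) * `|x - x'| ^+ 2.
Hypothesis f_lip : forall x y, `|f x - f y| <= L * `|x - y|.

Let q x h := f (x + h) - f x.

Let q_scale x h (l : R) : 0 <= l <= 1 ->
  `|q x (l *: h) - l * q x h| <= C * l * (1 - l) * `|h| ^+ 2.
Proof.
move=> l01; have := f_semi (x + h) x l01.
have -> : l *: (x + h) + (1 - l) *: x = x + l *: h.
  by rewrite scalerDr scalerBl scale1r addrAC addrCA subrr addr0.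
rewrite [x + h]addrC addrK distrC; apply: le_trans; rewrite /q [x + h]addrC.
by rewrite le_eqVlt; apply/orP; left; apply/eqP; congr `|_|; ring.
Qed.

(** This is [q_scale] along [l *: h] with weight m / l: the error factor (m / l) (1 - m / l) l^2 / m
    equals l - m. *)
Let q_quot x h (m l : R) : 0 < m -> m <= l ->
  `|q x (m *: h) / m - q x (l *: h) / l| <= C * (l - m) * `|h| ^+ 2.
Proof.
move=> m0 ml; have l0 := lt_le_trans m0 ml.
have ml1 : 0 <= m / l <= 1.
  by apply/andP; split; [rewrite ltW// divr_gt0|rewrite ler_pdivrMr// mul1r].
have := q_scale x (l *: h) ml1.
rewrite scalerA divfK ?gt_eqF// normrZ exprMn (gtr0_norm l0) => qs.
have -> : q x (m *: h) / m - q x (l *: h) / l =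
    (q x (m *: h) - m / l * q x (l *: h)) / m.
  by field; rewrite !gt_eqF.
rewrite normrM normfV (gtr0_norm m0) ler_pdivrMr//.
apply: (le_trans qs); rewrite le_eqVlt; apply/orP; left; apply/eqP.
by field; rewrite gt_eqF.
Qed.

Let small_eq0 (a M l0 : R) : 0 < l0 ->
  (forall l : R, 0 < l -> l <= l0 -> `|a| <= l * M) -> a = 0.
Proof.
move=> l00 aM; apply/eqP; rewrite -normr_le0; apply/ler_addgt0Pr => e e0.
rewrite add0r; have M1 : 0 < `|M| + 1 by rewrite ltr_wpDl.
pose l := Num.min l0 (e / (`|M| + 1)).
have lp : 0 < l by rewrite lt_min l00 divr_gt0.
apply: (le_trans (aM l lp _)); first by rewrite ge_min lexx.
apply: (@le_trans _ _ (l * (`|M| + 1))).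
  by rewrite (ler_wpM2l (ltW lp))// (le_trans (ler_norm M))// lerDl.
by rewrite -ler_pdivlMr// ge_min lexx orbT.
Qed.

(* The quotients q x (l h) / l converge as l -> 0+; subtracting C l |h|^2 makes them
   monotone, so that the limit is a supremum. *)
Let p_set x h := [set q x (l *: h) / l - C * l * `|h| ^+ 2 | l in
  [set l : R | 0 < l <= 1]].
Let p x h := sup (p_set x h).

(** By [q_quot], the quotient at scale l raised by l C |h|^2 bounds [p_set x h] from above; lowered
    by the same amount it belongs to [p_set x h]. The case l = 1 is the second-order expansion
    [p_taylor]. *)
Let pP x h (l : R) : 0 < l -> l <= 1 -> `|q x (l *: h) / l - p x h| <= l * (C * `|h| ^+ 2).
Proof.
move=> l0 l1; have pub : ubound (p_set x h) (q x (l *: h) / l + l * (C * `|h| ^+ 2)).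
  move=> _ [m /andP[m0 m1] <-].
  have n0 : 0 <= C * `|h| ^+ 2 by rewrite mulr_ge0// sqr_ge0.
  have [ml|/ltW lm] := leP m l.
    have := q_quot x h m0 ml; rewrite ler_norml => /andP[_].
    have := mulr_ge0 (ltW m0) n0; nra.
  have := q_quot x h l0 lm; rewrite distrC ler_norml => /andP[_].
  have := mulr_ge0 (ltW l0) n0; nra.
have p0 : p_set x h (q x (l *: h) / l - C * l * `|h| ^+ 2).
  by exists l => //=; rewrite l0 l1.
rewrite ler_distlC; apply/andP; split; last first.
  by apply: ge_sup pub; exists (q x (l *: h) / l - C * l * `|h| ^+ 2).
rewrite (_ : _ - _ = q x (l *: h) / l - C * l * `|h| ^+ 2); last by ring.
apply: ub_le_sup p0; by exists (q x (l *: h) / l + l * (C * `|h| ^+ 2)).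
Qed.

(** The midpoint of x + 2 l h and x + 2 l k is x + l (h + k). The two-sided midpoint inequality
    bounds the second difference by a multiple of l^2, which still vanishes after division by l. *)
Let pD x h k : p x (h + k) = p x h + p x k.
Proof.
apply/eqP; rewrite -subr_eq0; apply/eqP.
(* The summands are the errors of the three quotients, taken at the scales l, 2 l and 2 l, and of
   the midpoint inequality. The range l <= 1/2 keeps the scale 2 l admissible in [pP]. *)
apply: (@small_eq0 _ (C * `|h + k| ^+ 2 + 2 * (C * `|h| ^+ 2) +
  2 * (C * `|k| ^+ 2) + C * `|h - k| ^+ 2) 2^-1); first by rewrite invr_gt0.
move=> l l0 l12.
have l21 : 2 * l <= 1 by lra.
have l20 : 0 < 2 * l by lra.
have l1 : l <= 1 by lra.
have h1 := pP x (h + k) l0 l1.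
have h2 := pP x h l20 l21.
have h3 := pP x k l20 l21.
have h4 : `|q x ((2 * l) *: h) / (2 * l) + q x ((2 * l) *: k) / (2 * l)
   - q x (l *: (h + k)) / l| <= l * (C * `|h - k| ^+ 2).
  have half : 0 <= (2^-1 : R) <= 1 by rewrite invr_ge0 ler0n/= invf_le1 ?ler1n.
  have := f_semi (x + (2 * l) *: h) (x + (2 * l) *: k) half.
  have -> : 1 - 2^-1 = 2^-1 :> R by lra.
  have -> : 2^-1 *: (x + (2 * l) *: h) + 2^-1 *: (x + (2 * l) *: k) =
      x + l *: (h + k).
    rewrite -scalerDr addrACA scalerDr; congr (_ + _).
      by rewrite -[x + x]mulr2n -[x *+ 2]scaler_nat scalerA mulVf// scale1r.
    by rewrite -scalerDr scalerA mulrA mulVf// mul1r.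
  rewrite opprD addrACA subrr add0r -scalerBr normrZ exprMn (gtr0_norm l20) => fs.
  rewrite (_ : q _ _ / _ + _ - _ = (2^-1 * f (x + (2 * l) *: h) +
    2^-1 * f (x + (2 * l) *: k) - f (x + l *: (h + k))) / l); last first.
    by rewrite /q; field; rewrite gt_eqF.
  rewrite normrM normfV (gtr0_norm l0) ler_pdivrMr//.
  apply: (le_trans fs); rewrite le_eqVlt; apply/orP; left; apply/eqP.
  by field.
move: h1 h2 h3 h4; rewrite !ler_norml => /andP[? ?] /andP[? ?] /andP[? ?] /andP[? ?].
by apply/andP; split; lra.
Qed.

Let p_bound x h : `|p x h| <= L * `|h|.
Proof.
apply/ler_addgt0Pr => e e0.
pose l := Num.min 1 (e / (C * `|h| ^+ 2 + 1)).
have n1 : 0 < C * `|h| ^+ 2 + 1 by rewrite ltr_wpDl// mulr_ge0// sqr_ge0.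
have l0 : 0 < l by rewrite lt_min ltr01 divr_gt0.
have l1 : l <= 1 by rewrite ge_min lexx.
have le : l * (C * `|h| ^+ 2) <= e.
  apply: (@le_trans _ _ (l * (C * `|h| ^+ 2 + 1))).
    by rewrite ler_wpM2l ?ltW// ltrDl.
  by rewrite -ler_pdivlMr// ge_min lexx orbT.
have := pP x h l0 l1; rewrite distrC => ple.
have ql : `|q x (l *: h) / l| <= L * `|h|.
  rewrite normrM normfV (gtr0_norm l0) ler_pdivrMr//.
  apply: (le_trans (f_lip _ _)).
  by rewrite [x + _]addrC addrK normrZ (gtr0_norm l0) -mulrA (mulrC l).
rewrite -(subrK (q x (l *: h) / l) (p x h)) addrC.
by rewrite (le_trans (ler_normD _ _))// lerD// (le_trans ple).
Qed.

Let p0 x : p x 0 = 0.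
Proof. by apply: (addrI (p x 0)); rewrite -pD !addr0. Qed.

Let pN x h : p x (- h) = - p x h.
Proof. by apply: (addrI (p x h)); rewrite -pD !subrr p0. Qed.

(** The quotient of c h at scale l is c times the quotient of h at scale l c; the bound min(1, 1/c)
    on l makes both scales admissible in [pP]. *)
Let pZpos x (c : R) h : 0 < c -> p x (c *: h) = c * p x h.
Proof.
move=> c0; apply/eqP; rewrite -subr_eq0; apply/eqP.
apply: (@small_eq0 _ (2 * c ^+ 2 * (C * `|h| ^+ 2)) (Num.min 1 c^-1)).
  by rewrite lt_min ltr01 invr_gt0.
move=> l l0; rewrite le_min => /andP[l1 lc].
have lc0 : 0 < l * c by rewrite mulr_gt0.
have lc1 : l * c <= 1 by rewrite -ler_pdivlMr// mul1r.
have h1 := pP x (c *: h) l0 l1.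
have h2 := pP x h lc0 lc1.
move: h1; rewrite scalerA normrZ exprMn (gtr0_norm c0) distrC => h1.
have h3 : `|c * (q x ((l * c) *: h) / (l * c) - p x h)| <=
    c * (l * c * (C * `|h| ^+ 2)).
  by rewrite normrM (gtr0_norm c0) ler_wpM2l// ltW.
have e : c * (q x ((l * c) *: h) / (l * c) - p x h) =
   q x ((l * c) *: h) / l - c * p x h.
  by field; rewrite !gt_eqF.
rewrite -(subrKA (q x ((l * c) *: h) / l)) -e (le_trans (ler_normD _ _))//.
apply: (le_trans (lerD h1 h3)); rewrite le_eqVlt; apply/orP; left; apply/eqP; ring.
Qed.

Let p_linear x : linear (p x).
Proof.
move=> c h k; rewrite pD; congr (_ + _).
have [c0|c0|->] := ltgtP c 0; last by rewrite !scale0r p0.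
  rewrite -[c *: h]opprK -scaleNr pN pZpos ?oppr_gt0//.
  by rewrite mulNr opprK.
exact: pZpos.
Qed.

Let p_taylor x h : `|f (x + h) - f x - p x h| <= C * `|h| ^+ 2.
Proof. by have := pP x h ltr01 (lexx 1); rewrite scale1r divr1 mul1r. Qed.

Let p_diff x : differentiable f x /\ 'd f x = p x :> (K -> R).
Proof.
pose F := GRing.isLinear.Build R K R *:%R (p x) (@p_linear x).
pose g : {linear K -> R} := HB.pack (p x) F.
have cg : continuous (g : K -> R).
  apply: bounded_linear_continuous; apply/linear_boundedP; exists L.
  split; first exact: num_real.
  move=> M LM h; apply: (le_trans (p_bound x h)).
  by rewrite ler_wpM2r// ltW.
have fo : f \o shift x = cst (f x) + g +o_ 0 id.
  apply/eqaddoP => _/posnumP[e]; near=> h.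
  have -> : (f \o shift x - (cst (f x) + g)) h = f (x + h) - f x - p x h.
    by rewrite !fctE /= opprD addrA (addrC h x).
  apply: (le_trans (p_taylor x h)).
  rewrite expr2 mulrA ler_wpM2r//.
  apply: (@le_trans _ _ ((C + 1) * `|h|)); first by rewrite ler_wpM2r// lerDl.
  rewrite -ler_pdivlMl ?ltr_wpDl//; near: h.
  apply/nbhs_normP; exists ((C + 1)^-1 * e%:num) => /=.
    by rewrite mulr_gt0// invr_gt0 ltr_wpDl.
  by move=> h /=; rewrite sub0r normrN => /ltW.
have dE := diff_unique cg fo.
by split=> //; apply/diff_locallyP; rewrite dE.
Unshelve. all: by end_near. Qed.

(** The constant collects three remainders. With d = |x - y|, the increment y - x + k has squared
    length at most 4 d^2, while y - x and k contribute d^2 each. *)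
Let p_lip x y h : `|p x h - p y h| <= 6 * C * `|x - y| * `|h|.
Proof.
have [->|xy] := eqVneq x y; first by rewrite !subrr !normr0 mulr0 mul0r.
have [->|h0] := eqVneq h 0; first by rewrite !p0 subr0 !normr0 mulr0.
have d0 : 0 < `|x - y| by rewrite normr_gt0 subr_eq0.
have nh0 : 0 < `|h| by rewrite normr_gt0.
(* Compare both first-order expansions at y + k, where |k| = |x - y|. *)
have key (k : K) : `|k| = `|x - y| -> p x k - p y k <= 6 * C * `|x - y| ^+ 2.
  move=> kE.
  have := p_taylor x (y - x + k); have := p_taylor x (y - x).
  rewrite (pD x (y - x) k) (addrA x (y - x) k) subrKC !ler_norml => /andP[_ t1] /andP[t2 _].
  have := p_taylor y k; rewrite ler_norml => /andP[_ t3].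
  have := ler_wpM2l C0 (sqr_normD_le (y - x) k).
  by move: t1 t2 t3; rewrite kE (distrC y x); lra.
(* Homogeneity reduces an arbitrary h to length |x - y|, where [key] applies; dividing by c turns
   the bound 6 C |x - y|^2 into a bilinear one. *)
pose c := `|x - y| / `|h|.
have c0 : 0 < c by rewrite divr_gt0.
have nk (k : K) : `|k| = `|h| -> `|c *: k| = `|x - y|.
  by move=> kh; rewrite normrZ (gtr0_norm c0) kh divfK// gt_eqF.
have cE a : c * a <= 6 * C * `|x - y| ^+ 2 -> a <= 6 * C * `|x - y| * `|h|.
  move=> ca; rewrite -(ler_pM2l c0) (le_trans ca)//.
  by rewrite /c le_eqVlt; apply/orP; left; apply/eqP; field; rewrite gt_eqF.
rewrite ler_norml lerNl opprB; apply/andP; split; apply: cE.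
  have := key _ (nk (- h) (normrN _)); rewrite !pZpos// !pN; lra.
by have := key _ (nk h erefl); rewrite !pZpos// -mulrBr.
Qed.

Lemma C11_semiconvex_semiconcave : C11 f.
Proof.
split=> [x|]; first by have [] := p_diff x.
exists (6 * C) => x y h; rewrite (p_diff x).2 (p_diff y).2.
exact: p_lip.
Qed.

End SemiconvexSemiconcave.

Lemma dense_normP (R : realType) (V : normedModType R) (D : set V) :
  dense D -> forall (x : V) e, 0 < e -> exists2 y, D y & `|x - y| < e.
Proof.
move=> dD x e e0; have [||y [xy Dy]] := dD (ball x e).
- by exists x; exact: ballxx.
- exact: ball_open.
- by exists y => //; move: xy; rewrite -ball_normE.
Qed.

(** * Lipschitz extension to the completion *)

Section McShaneExtension.
Variables (R : realType) (H K : hilbertType R) (iota : H -> K) (v : H -> R).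
Variables (L C : R).
Hypothesis lin_iota : linear iota.
Hypothesis dense_iota : dense (range iota).
Hypothesis L0 : 0 <= L.
Hypothesis C0 : 0 <= C.
Hypothesis v_lip : forall x y, `|v x - v y| <= L * `|iota x - iota y|.
Hypothesis v_semi : forall (lam : R) x x', 0 <= lam <= 1 ->
  `|lam * v x + (1 - lam) * v x' - v (lam *: x + (1 - lam) *: x')|
    <= C * lam * (1 - lam) * `|iota x - iota x'| ^+ 2.

Definition mcshane_set (y : K) : set R :=
  [set v x + L * `|y - iota x| | x in [set: H]].
Definition mcshane (y : K) : R := inf (mcshane_set y).

Let has_inf_mcshane y : has_inf (mcshane_set y).
Proof.
split; first by exists (v 0 + L * `|y - iota 0|), 0.
exists (v 0 - L * `|y - iota 0|) => _ [x _ <-].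
have := v_lip 0 x; rewrite ler_norml => /andP[_].
have := ler_wpM2l L0 (ler_distD y (iota 0) (iota x)).
rewrite (distrC (iota 0) y); lra.
Qed.

Lemma mcshaneE x : mcshane (iota x) = v x.
Proof.
apply/eqP; rewrite eq_le; apply/andP; split.
  apply: ge_inf; first by have [] := has_inf_mcshane (iota x).
  by exists x => //; rewrite subrr normr0 mulr0 addr0.
apply: lb_le_inf; first by have [] := has_inf_mcshane (iota x).
move=> _ [y _ <-]; have := v_lip x y; rewrite ler_norml => /andP[_]; lra.
Qed.

Let mcshane_le y z : mcshane y <= mcshane z + L * `|y - z|.
Proof.
rewrite -lerBlDr; apply: lb_le_inf; first by have [] := has_inf_mcshane z.
move=> _ [x _ <-]; rewrite lerBlDr.
apply: (@le_trans _ _ (v x + L * `|y - iota x|)).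
  by apply: ge_inf; [have [] := has_inf_mcshane y|exists x].
by have := ler_wpM2l L0 (ler_distD z y (iota x)); lra.
Qed.

Let mcshane_lip y z : `|mcshane y - mcshane z| <= L * `|y - z|.
Proof.
rewrite ler_distlC; have := mcshane_le y z; have := mcshane_le z y.
by rewrite (distrC z); move=> *; apply/andP; split; lra.
Qed.

Let mcshane_semi (lam : R) y y' : 0 <= lam <= 1 ->
  `|lam * mcshane y + (1 - lam) * mcshane y' -
    mcshane (lam *: y + (1 - lam) *: y')|
    <= C * lam * (1 - lam) * `|y - y'| ^+ 2.
Proof.
move=> /[dup] lam01 /andP[l0 l1]; apply/ler_addgt0Pr => e e0.
(* Price of replacing y and y' by points of the dense range at distance d <= 1. The three values of
   the extension change by at most 2 L d in total, and |iota x - iota x'|^2 <= (|y - y'| + 2 d)^2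
   exceeds |y - y'|^2 by at most (4 + 4 |y - y'|) d. *)
pose M := 2 * L + C * (4 + 4 * `|y - y'|).
have M0 : 0 <= M by rewrite /M addr_ge0 ?mulr_ge0// addr_ge0// mulr_ge0.
pose d := Num.min 1 (e / (M + 1)).
have M1 : 0 < M + 1 by rewrite ltr_wpDl.
have d0 : 0 < d by rewrite lt_min ltr01 divr_gt0.
have d1 : d <= 1 by rewrite ge_min lexx.
have dM : M * d <= e.
  apply: (@le_trans _ _ ((M + 1) * d)); first by rewrite ler_wpM2r ?ltW// ltrDl.
  by rewrite mulrC -ler_pdivlMr// ge_min lexx orbT.
have [_ [x _ <-] /ltW yx] := dense_normP dense_iota y d0.
have [_ [x' _ <-] /ltW yx'] := dense_normP dense_iota y' d0.
have l1' : 0 <= 1 - lam by rewrite subr_ge0.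
have e3 : `|(lam *: y + (1 - lam) *: y') -
    iota (lam *: x + (1 - lam) *: x')| <= d.
  rewrite (linear_funD lin_iota) !(linear_funZ lin_iota) opprD addrACA -!scalerBr.
  rewrite (le_trans (ler_normD _ _))// !normrZ !ger0_norm//.
  have := ler_wpM2l l0 yx; have := ler_wpM2l l1' yx'; lra.
have nd : `|iota x - iota x'| ^+ 2 <= `|y - y'| ^+ 2 + (4 + 4 * `|y - y'|) * d.
  have : `|iota x - iota x'| <= `|y - y'| + 2 * d.
    have := ler_distD y (iota x) (iota x'); have := ler_distD y' y (iota x').
    rewrite (distrC (iota x) y); lra.
  have : 0 <= `|iota x - iota x'| by [].
  have : 0 <= `|y - y'| by [].
  move=> ? ? h; apply: (@le_trans _ _ ((`|y - y'| + 2 * d) ^+ 2)).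
    by rewrite ler_sqr ?nnegrE// addr_ge0// mulr_ge0// ltW.
  nra.
have L1 := mcshane_lip y (iota x).
have L2 := mcshane_lip y' (iota x').
have L3 := mcshane_lip (lam *: y + (1 - lam) *: y')
  (iota (lam *: x + (1 - lam) *: x')).
have {L1} L1 := le_trans L1 (ler_wpM2l L0 yx).
have {L2} L2 := le_trans L2 (ler_wpM2l L0 yx').
have {L3} L3 := le_trans L3 (ler_wpM2l L0 e3).
have := v_semi x x' lam01.
move: L1 L2 L3; rewrite !mcshaneE.
have Cl0 : 0 <= C * lam * (1 - lam) by rewrite !mulr_ge0.
have Cl1 : C * lam * (1 - lam) <= C.
  by rewrite -mulrA ler_piMr// mulr_ile1// gerBl.
have := ler_wpM2l Cl0 nd.
have n0 : 0 <= (4 + 4 * `|y - y'|) * d.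
  by rewrite mulr_ge0 ?(ltW d0)// addr_ge0// mulr_ge0.
have := ler_wpM2r n0 Cl1.
move=> n1 n2 L1 L2 L3 vs.
set a := mcshane _ in L1 *; set b := mcshane _ in L2 *; set c := mcshane _ in L3 *.
have -> : lam * a + (1 - lam) * b - c = lam * (a - v x) + (1 - lam) * (b - v x') -
  (c - v (lam *: x + (1 - lam) *: x')) + (lam * v x + (1 - lam) * v x' -
  v (lam *: x + (1 - lam) *: x')) by ring.
rewrite (le_trans (ler_normD _ _))// (le_trans (lerD (ler_normB _ _) vs))//.
apply: (@le_trans _ _ (lam * (L * d) + (1 - lam) * (L * d) + L * d + C * lam * (1 - lam) * `|iota x - iota x'| ^+ 2)).
  rewrite lerD2r lerD// (le_trans (ler_normD _ _))// !normrM !(ger0_norm l0) (ger0_norm l1').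
  by rewrite lerD// ler_wpM2l.
move: dM n1 n2; rewrite /M; lra.
Qed.

Lemma C11_mcshane : C11 mcshane.
Proof. exact: C11_semiconvex_semiconcave C0 mcshane_semi mcshane_lip. Qed.

End McShaneExtension.

(** * The negative norm and the semigroup *)

Section NegativeNorm.
Variables (R : realType) (H K : hilbertType R) (B : H -> H) (iota : H -> K).
Hypothesis hiota : completion_m1 B iota.

Lemma norm_m1E x : norm_m1 B x = `|iota x|.
Proof.
have [_ ip _] := hiota.
by rewrite /norm_m1 -ip inner_norm sqrtr_sqr ger0_norm.
Qed.

Lemma completion_m1_bounded : bounded_operator B ->
  exists2 c : R, 0 < c & forall x, `|iota x| <= c * `|x|.
Proof.
have [_ ip _] := hiota; move=> /bounded_operator_le [M M0 BM].
(* Here M bounds the square |iota x|^2 / |x|^2; since M <= (M + 1)^2, the constant M + 1 serves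
   without a square root. *)
exists (M + 1); first by rewrite addr_gt0.
move=> x; have M1 : 0 <= (M + 1) * `|x| by rewrite mulr_ge0// addr_ge0// ltW.
rewrite -ler_sqr ?nnegrE// -inner_norm ip (le_trans (ler_norm _))//.
rewrite (le_trans (cauchy_schwarz _ _))//.
apply: (@le_trans _ _ (M * `|x| * `|x|)); first by rewrite ler_wpM2r.
by have := sqr_ge0 `|x|; have := sqr_ge0 (M * `|x|); nra.
Qed.

End NegativeNorm.

Section SemigroupNegativeNorm.
Variables (R : realType) (H K : hilbertType R).
Variables (D : set H) (A B : H -> H) (S : R -> H -> H) (iota : H -> K).
Hypothesis densA : dense D.
Hypothesis semS : contraction_semigroup S.
Hypothesis genS : generator D A S.
Hypothesis hiota : completion_m1 B iota.

Lemma contraction_semigroupB s x y : 0 <= s ->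
  S s (x - y) = S s x - S s y.
Proof. by case: semS => linS _ _ _ _ s0; rewrite (linear_funB (linS s s0)). Qed.

Lemma contraction_semigroup_le s x y : 0 <= s -> `|S s x - S s y| <= `|x - y|.
Proof.
by move=> s0; rewrite -contraction_semigroupB//; case: semS => _ _ _ + _; apply.
Qed.

(** [S s] commutes with the difference quotients of the semigroup and is a contraction, so the
    quotients at [S s x] converge to [S s (A x)]. *)
Lemma generator_semigroup s x : 0 <= s -> D x ->
  D (S s x) /\ A (S s x) = S s (A x).
Proof.
move=> s0 Dx; have [linS _ SD Sle _] := semS.
have lim := (genS x (A x)).1 (conj Dx erefl).
apply: ((genS _ _).2).
apply/cvgrPdist_lt => e e0.
move/cvgrPdist_lt: lim => /(_ e e0).
rewrite !near_withinE; apply: filterS => k + k0 => /(_ k0).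
have k0' : 0 <= k by rewrite ltW.
rewrite -SD// (addrC k s) SD// -(contraction_semigroupB _ _ s0).
rewrite -(linear_funZ (linS s s0)).
by apply: le_lt_trans; exact: contraction_semigroup_le.
Qed.

(** With d the difference quotient at x, S (s + k) x is S s x + k (A (S s x) + S s (d - A x)). The
    weak B-condition bounds the pairing with A (S s x). Every other term carries S s, a contraction
    in H, and is thus bounded independently of s. *)
Let step (c c0 : R) (x : H) (s k : R) :
  (forall x, `|iota x| <= c * `|x|) -> 0 <= c ->
  (forall y, D y -> inner (B y) (A y) <= c0 * `|iota y| ^+ 2) ->
  D x -> 0 <= s -> 0 < k ->
  `|iota (S (s + k) x)| ^+ 2 <= (1 + 2 * c0 * k) * `|iota (S s x)| ^+ 2 +
    k * (2 * c ^+ 2 * `|x| * `|k^-1 *: (S k x - x) - A x| +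
         k * c ^+ 2 * `|k^-1 *: (S k x - x)| ^+ 2).
Proof.
move=> ic c00 BA Dx s0 k0; set d := k^-1 *: _.
have [linS _ SD Sle _] := semS.
have [linI ip _] := hiota.
have k0' := ltW k0.
have -> : S (s + k) x = S s x + k *: (S s (A x) + S s (d - A x)).
  rewrite -(linear_funD (linS s s0)) subrKC -(linear_funZ (linS s s0)).
  by rewrite scalerA divff ?gt_eqF// scale1r -(linear_funD (linS s s0)) subrKC -(SD _ _ _ s0 k0').
have [DSx ASx] := generator_semigroup s0 Dx.
rewrite (linear_funD linI) normrD_inner (linear_funZ linI).
rewrite innerZr (linear_funD linI) innerDr ip -ASx.
have h1 := BA _ DSx.
have h2 : inner (iota (S s x)) (iota (S s (d - A x))) <= c ^+ 2 * `|x| * `|d - A x|.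
  rewrite (le_trans (ler_norm _))// (le_trans (cauchy_schwarz _ _))//.
  rewrite (_ : c ^+ 2 * _ * _ = c * `|x| * (c * `|d - A x|)); last by ring.
  by rewrite ler_pM// (le_trans (ic _))// ler_wpM2l// Sle.
have h3 : `|k *: (iota (A (S s x)) + iota (S s (d - A x)))| ^+ 2 <=
    k ^+ 2 * (c ^+ 2 * `|d| ^+ 2).
  rewrite normrZ exprMn (gtr0_norm k0) -(linear_funD linI) ASx.
  rewrite -(linear_funD (linS s s0)) subrKC ler_wpM2l ?sqr_ge0// -exprMn.
  by rewrite ler_sqr ?nnegrE ?mulr_ge0// (le_trans (ic _))// ler_wpM2l// Sle.
have := ler_wpM2l k0' h1; have := ler_wpM2l k0' h2; lra.
Qed.

(** Discrete Gronwall inequality. The growth factor is at least 1, so each newly added error k w may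
    be multiplied by its full power. *)
Let iter (u : R -> R) (c0 k w : R) n : 0 <= c0 -> 0 <= k -> 0 <= w ->
  (forall s, 0 <= s -> u (s + k) <= (1 + 2 * c0 * k) * u s + k * w) ->
  u (n%:R * k) <= (1 + 2 * c0 * k) ^+ n * (u 0 + n%:R * k * w).
Proof.
move=> c00 k0 w0 us; elim: n => [|n ih]; first by rewrite mul0r expr0 mul1r mul0r addr0.
have q1 : 1 <= 1 + 2 * c0 * k by rewrite lerDl !mulr_ge0.
rewrite -natr1 mulrDl mul1r (le_trans (us _ _)) ?mulr_ge0//.
have h1 := ler_wpM2l (le_trans ler01 q1) ih.
have q2 : 1 * 1 <= (1 + 2 * c0 * k) * (1 + 2 * c0 * k) ^+ n.
  by rewrite ler_pM// exprn_ege1.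
have kw : 0 <= k * w by rewrite mulr_ge0.
have := ler_wpM2r kw q2; rewrite exprS; lra.
Qed.

(* Euler iteration: a time step k multiplies the squared negative norm by at most
   1 + 2 c0 k, up to an error o(k) uniform in the starting time. On D(A) first, then
   by density. *)
Lemma semigroup_negative_norm : weak_B_condition D A B ->
  exists2 c0 : R, 0 <= c0 & forall s x, 0 <= s ->
    `|iota (S s x)| ^+ 2 <= expR (2 * c0 * s) * `|iota x| ^+ 2.
Proof.
move=> [bB _ [AB [bAB adj [c0 c00 ABc0]]]]; exists c0 => //.
have [linS S0 SD Sle _] := semS.
have [linI ip _] := hiota.
have [c c_gt0 ic] := completion_m1_bounded hiota bB.
have c_ge0 := ltW c_gt0.
(* The weak B-condition in quadratic form: <B y, A y> is <y, AB y>, where AB represents the adjoint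
   of A composed with B. *)
have BA y : D y -> inner (B y) (A y) <= c0 * `|iota y| ^+ 2.
  move=> Dy; rewrite innerC (adj y y Dy) innerC -inner_norm ip.
  by have := ABc0 y; rewrite innerDl innerNl innerZl; lra.
have onD s x : 0 <= s -> D x ->
    `|iota (S s x)| ^+ 2 <= expR (2 * c0 * s) * `|iota x| ^+ 2.
  rewrite le_eqVlt => /predU1P[<- Dx|s0 Dx].
    by rewrite mulr0 expR0 mul1r S0.
  apply/ler_addgt0Pr => e e0.
  (* The iteration accumulates the error expR (2 c0 s) * s * e', which is e. The choices of q and k0
     below give half of e' to each of the two error terms in [step]. *)
  pose e' := e / (expR (2 * c0 * s) * s).
  have e'0 : 0 < e' by rewrite divr_gt0// mulr_gt0// expR_gt0.
  pose a := 2 * c ^+ 2 * `|x|.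
  have a0 : 0 <= a by rewrite !mulr_ge0// sqr_ge0.
  pose b := c ^+ 2 * (`|A x| + 1) ^+ 2.
  have b0 : 0 <= b by rewrite mulr_ge0 ?sqr_ge0.
  have lim := (genS x (A x)).1 (conj Dx erefl).
  pose q := Num.min 1 (e' / (2 * (a + 1))).
  have q0 : 0 < q by rewrite lt_min ltr01 divr_gt0// mulr_gt0// ltr_wpDl.
  move/cvgrPdist_lt : lim => /(_ q q0).
  rewrite near_withinE => /nbhs_normP[dl /= dl0 dlP].
  pose k0 := Num.min (dl / 2) (e' / (2 * (b + 1))).
  have k00 : 0 < k0.
    by rewrite lt_min divr_gt0//= divr_gt0// mulr_gt0// ltr_wpDl.
  have kP (k : R) : 0 < k -> k <= k0 -> forall t, 0 <= t ->
    `|iota (S (t + k) x)| ^+ 2 <= (1 + 2 * c0 * k) * `|iota (S t x)| ^+ 2 + k * e'.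
    move=> kp kk0 t t0.
    apply: (le_trans (step ic c_ge0 BA Dx t0 kp)).
    rewrite lerD2l ler_wpM2l ?(ltW kp)//.
    set d := k^-1 *: _.
    have dA : `|A x - d| < q.
      apply: dlP => //=; rewrite sub0r normrN gtr0_norm//.
      apply: (le_lt_trans kk0); rewrite gt_min; apply/orP; left.
      by rewrite ltr_pdivrMr// ltr_pMr// ltr1n.
    have h1 : a * `|d - A x| <= e' / 2.
      apply: (@le_trans _ _ ((a + 1) * (e' / (2 * (a + 1))))).
        apply: ler_pM => //; first by rewrite lerDl.
        by rewrite distrC (le_trans (ltW dA))// ge_min lexx orbT.
      rewrite le_eqVlt; apply/orP; left; apply/eqP; field.
      by rewrite gt_eqF// ltr_wpDl.
    have nd : `|d| <= `|A x| + 1.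
      rewrite -lerBlDl (le_trans (lerB_dist _ _))// distrC (le_trans (ltW dA))//.
      by rewrite ge_min lexx.
    have h2 : k * c ^+ 2 * `|d| ^+ 2 <= e' / 2.
      apply: (@le_trans _ _ (e' / (2 * (b + 1)) * (b + 1))).
        rewrite -mulrA; apply: ler_pM => //.
        - exact: ltW.
        - by rewrite mulr_ge0 ?sqr_ge0.
        - by rewrite (le_trans kk0)// ge_min lexx orbT.
        - rewrite (@le_trans _ _ b)// ?lerDl//.
          by rewrite ler_wpM2l ?sqr_ge0// ler_sqr ?nnegrE// addr_ge0.
      rewrite le_eqVlt; apply/orP; left; apply/eqP; field.
      by rewrite gt_eqF// ltr_wpDl.
    by rewrite -/a; lra.
  pose n := (Num.truncn (s / k0)).+1.
  have n0 : 0 < n%:R :> R by rewrite ltr0n.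
  have nk : s / n%:R <= k0.
    by rewrite ler_pdivrMr// mulrC -ler_pdivrMr// ltW// truncnS_gt.
  have sn0 : 0 < s / n%:R by rewrite divr_gt0.
  have := @iter (fun t => `|iota (S t x)| ^+ 2) c0 (s / n%:R) e' n c00 (ltW sn0)
    (ltW e'0) (kP _ sn0 nk).
  have -> : n%:R * (s / n%:R) = s by field; rewrite gt_eqF.
  move/le_trans; apply; rewrite S0.
  have le1 : (1 + 2 * c0 * (s / n%:R)) ^+ n <= expR (2 * c0 * s).
    have -> : 2 * c0 * s = (2 * c0 * (s / n%:R)) * n%:R by field; rewrite gt_eqF.
    rewrite expRM_natr; apply: lerXn2r.
    - by rewrite nnegrE addr_ge0// !mulr_ge0// ltW.
    - by rewrite nnegrE expR_ge0.
    - exact: expR_ge1Dx.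
  apply: (@le_trans _ _ (expR (2 * c0 * s) * (`|iota x| ^+ 2 + s * e'))).
    rewrite ler_wpM2r// addr_ge0 ?sqr_ge0// mulr_ge0 ?ltW//.
  rewrite mulrDr lerD2l mulrA /e' mulrCA divff ?mulr1// gt_eqF//.
  by rewrite mulr_gt0// expR_gt0.
move=> s x s0.
have onD' y : D y -> `|iota (S s y)| <= expR (c0 * s) * `|iota y|.
  move=> Dy; have := onD s y s0 Dy.
  have -> : 2 * c0 * s = (c0 * s) * 2%:R by ring.
  rewrite expRM_natr -exprMn ler_sqr// nnegrE// mulr_ge0// expR_ge0.
have -> : 2 * c0 * s = (c0 * s) * 2%:R by ring.
have E0 : 0 <= expR (c0 * s) by exact: expR_ge0.
rewrite expRM_natr -exprMn ler_sqr ?nnegrE ?mulr_ge0//.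
apply/ler_addgt0Pr => e e0.
(* Replacing x by y costs c q on the left and c q expR (c0 s) on the right, e in all. *)
pose q := e / (c * (1 + expR (c0 * s))).
have q0 : 0 < q by rewrite divr_gt0// mulr_gt0// ltr_wpDr// expR_ge0.
have [y Dy xy] := dense_normP densA x q0.
have h1 : `|iota (S s x)| <= `|iota (S s y)| + c * q.
  rewrite -lerBlDl (le_trans (lerB_dist _ _))// -(linear_funB linI).
  rewrite (le_trans (ic _))// ler_wpM2l// (le_trans (contraction_semigroup_le _ _ s0))//.
  exact: ltW.
have h2 : `|iota y| <= `|iota x| + c * q.
  rewrite -lerBlDl (le_trans (lerB_dist _ _))// -(linear_funB linI).
  by rewrite (le_trans (ic _))// ler_wpM2l// distrC ltW.
have h3 := onD' y Dy.
have h4 := ler_wpM2l E0 h2.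
have : c * q + expR (c0 * s) * (c * q) = e.
  rewrite /q; field.
  by rewrite !gt_eqF// ltr_wpDr// expR_ge0.
lra.
Qed.

End SemigroupNegativeNorm.

(** * Hilbert-Schmidt norms *)

Section Parseval.
Variables (R : realType) (H : hilbertType R) (E : set H).
Hypothesis onbE : orthonormal_basis E.
Implicit Types (s : seq H) (x y e : H).

Let ons s := uniq s /\ forall e, e \in s -> E e.

Let proj s x := \sum_(e <- s) inner x e *: e.
Let nsum s x := \sum_(e <- s) inner x e ^+ 2.

Let inner_proj s x e : ons s -> E e ->
  inner (proj s x) e = if e \in s then inner x e else 0.
Proof.
move=> [us sE] Ee; rewrite inner_suml.
have -> : \sum_(i <- s) inner (inner x i *: i) e =
    \sum_(i <- s) if i == e then inner x i else 0.
  rewrite !big_seq; apply: eq_bigr => i is_.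
  rewrite innerZl (onbE.1 _ _ (sE _ is_) Ee).
  by case: eqP => _; rewrite ?mulr1 ?mulr0.
rewrite -big_mkcond /= -big_filter; case: ifPn => es.
  by rewrite filter_pred1_uniq// big_seq1.
rewrite big_seq big1// => i; rewrite mem_filter => /andP[/eqP -> /(negP es)[]].
Qed.

Let inner_projr s x y : inner (proj s x) y = \sum_(e <- s) inner x e * inner y e.
Proof.
by rewrite inner_suml; apply: eq_bigr => e _; rewrite innerZl (innerC e).
Qed.

Let proj_orth s x e : ons s -> e \in s -> inner (x - proj s x) e = 0.
Proof.
by move=> os es; rewrite innerBl inner_proj// ?es ?subrr//; exact: os.2.
Qed.

Let norm_proj s x : ons s -> `|proj s x| ^+ 2 = nsum s x.
Proof.
move=> os; rewrite -inner_norm inner_projr /nsum !big_seq.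
apply: eq_bigr => e es; rewrite inner_proj ?es ?expr2//; exact: os.2.
Qed.

Let norm_sub_proj s x : ons s -> `|x - proj s x| ^+ 2 = `|x| ^+ 2 - nsum s x.
Proof.
move=> os; rewrite normrD_inner normrN innerNr norm_proj// innerC inner_projr.
rewrite (_ : \sum_(e <- s) _ = nsum s x); last by apply: eq_bigr => e _; rewrite expr2.
by ring.
Qed.

Let proj_sub s s' x : ons s -> ons s' -> {subset s <= s'} ->
  `|proj s' x - proj s x| ^+ 2 = nsum s' x - nsum s x.
Proof.
move=> os os' ss'.
have z t : {subset t <= s'} -> inner (x - proj s' x) (proj t x) = 0.
  move=> ts'; rewrite inner_sumr big1_seq// => e /andP[_ /ts' es'].
  by rewrite innerZr proj_orth ?mulr0.
have o0 : inner (x - proj s' x) (proj s' x - proj s x) = 0.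
  by rewrite innerBr !z// subrr.
have := norm_sub_proj x os.
rewrite -(subrKA (proj s' x)) normrD_inner o0 norm_sub_proj//; lra.
Qed.

Let ons_cat s s' : ons s -> ons s' -> ons (undup (s ++ s')).
Proof.
move=> [_ sE] [_ sE']; split; first exact: undup_uniq.
by move=> e; rewrite mem_undup mem_cat => /orP[/sE|/sE'].
Qed.

(** A basis is defined here by maximality, and E is not assumed countable. Finite subsets of E with
    nearly maximal Fourier sum have Cauchy projections; by completeness these converge, and
    maximality of E identifies the limit with x. The bound is claimed for all larger finite sets so
    that several vectors can share one set. *)
Lemma orthonormal_basis_approx x (eps : R) : 0 < eps ->
  exists s, [/\ uniq s, forall e, e \in s -> E e &
    forall s', uniq s' -> (forall e, e \in s' -> E e) -> {subset s <= s'} ->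
    `|x - \sum_(e <- s') inner x e *: e| <= eps].
Proof.
move=> eps0.
pose A := [set nsum s x | s in ons].
have A_ub : ubound A (`|x| ^+ 2).
  by move=> _ [s os <-]; rewrite -subr_ge0 -norm_sub_proj// sqr_ge0.
have A_sup : has_sup A.
  by split; [exists (nsum [::] x), [::]|exists (`|x| ^+ 2)].
have A_le s : ons s -> nsum s x <= sup A.
  by move=> os; apply: ub_le_sup; [exact: A_sup.2|exists s].
(* A finite subset whose Fourier sum misses the supremum by less than 1 / (n + 1); enlarging it
   moves the projection by at most that much in squared norm. *)
have ex_s n : {s | ons s & sup A - nsum s x < n.+1%:R^-1}.
  apply: cid2; have : (0 : R) < n.+1%:R^-1 by [].
  move=> /(sup_adherent)/(_ A_sup) [_ [s os <-]] h.
  by exists s => //; rewrite ltrBlDr -ltrBlDl.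
pose S n := s2val (ex_s n).
have oS n : ons (S n) by rewrite /S; case: (ex_s n).
have Slt n : sup A - nsum (S n) x < n.+1%:R^-1 by rewrite /S; case: (ex_s n).
pose u n := proj (S n) x.
have near_big n s : ons s -> {subset S n <= s} ->
    `|proj s x - u n| ^+ 2 <= n.+1%:R^-1.
  move=> os Ss; rewrite proj_sub//.
  by rewrite (le_trans _ (ltW (Slt n)))// lerD2r A_le.
have u_close n m : `|u n - u m| ^+ 2 <= 2 * n.+1%:R^-1 + 2 * m.+1%:R^-1.
  pose s := undup (S n ++ S m).
  have h1 := near_big n s (ons_cat (oS n) (oS m)).
  have h2 := near_big m s (ons_cat (oS n) (oS m)).
  rewrite -(subrKA (proj s x)) (le_trans (sqr_normD_le _ _))//.
  rewrite -opprB normrN lerD// ler_wpM2l//.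
    by apply: h1 => e en; rewrite mem_undup mem_cat en.
  by apply: h2 => e en; rewrite mem_undup mem_cat en orbT.
have small (d : R) : 0 < d -> exists N, forall n, (N <= n)%N -> n.+1%:R^-1 < d.
  move=> d0; exists (Num.truncn d^-1) => n Nn.
  rewrite -[d]invrK ltf_pV2 ?posrE ?invr_gt0//.
  by rewrite (lt_le_trans (truncnS_gt _))// ler_nat ltnS.
have [y uy] : exists y, u @ \oo --> y.
  apply/cvg_ex/cauchy_cvgP/cauchy_ballP => d d0.
  have [N NP] := small (d ^+ 2 / 4) (divr_gt0 (exprn_gt0 2 d0) (ltr0Sn _ _)).
  exists (u @` [set n | (N <= n)%N], u @` [set n | (N <= n)%N]).
    by split; exists N => // n Nn; exists n.
  move=> [_ _] [[n Nn <-] [m Nm <-]] /=.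
  rewrite -ball_normE /= -ltr_sqr ?nnegrE// ?ltW// (le_lt_trans (u_close n m))//.
  move: (NP _ Nn) (NP _ Nm); move: (n.+1%:R^-1) (m.+1%:R^-1) => a b; lra.
have xy0 : x - y = 0.
  apply: onbE.2 => e Ee.
  apply/eqP; rewrite -normr_le0; apply/ler_addgt0Pr => d d0; rewrite add0r.
  have e1 : `|e| = 1.
    have := onbE.1 e e Ee Ee; rewrite eqxx inner_norm => /eqP.
    by rewrite sqrf_eq1 => /orP[/eqP//|/eqP h]; have := normr_ge0 e; rewrite h; lra.
  have d2 : 0 < d / 2 by rewrite divr_gt0.
  have [N NP] := small ((d / 2) ^+ 2) (exprn_gt0 _ d2).
  move/cvgrPdist_lt : uy => /(_ _ d2)[M _ MP].
  pose n := maxn N M.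
  have {}NP : n.+1%:R^-1 < (d / 2) ^+ 2 by apply: NP; rewrite leq_maxl.
  have {}MP : `|y - u n| < d / 2 by apply: MP => /=; rewrite leq_maxr.
  have h1 : `|inner (x - u n) e| <= d / 2.
    have [en|en] := boolP (e \in S n); first by rewrite proj_orth// normr0 ltW.
    rewrite -ler_sqr ?nnegrE// ?(ltW d2)// (le_trans _ (ltW NP))//.
    rewrite (le_trans _ (ltW (Slt n)))// lerBrDr.
    (* If e lies outside [S n], adding it raises the Fourier sum by the square of <x, e>, which
       near-maximality forces to be small. *)
    have oe : ons (e :: S n).
      split; first by rewrite /= en (oS n).1.
      by move=> f; rewrite in_cons => /orP[/eqP->//|]; exact: (oS n).2.
    rewrite (le_trans _ (A_le _ oe))// /nsum big_cons lerD2r.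
    by rewrite innerBl inner_proj// (negbTE en) subr0 real_normK// num_real.
  rewrite -(subrKA (u n)) innerDl -(opprB y) innerNl.
  rewrite (le_trans (ler_normB _ _))//.
  have := cauchy_schwarz (y - u n) e; rewrite e1 mulr1; lra.
have eps2 : 0 < eps / 2 by rewrite divr_gt0.
move/cvgrPdist_lt : uy => /(_ _ eps2)[M _ MP].
exists (S M); split; [exact: (oS M).1|exact: (oS M).2|].
move=> s' us' s'E Ss'; have os' : ons s' by [].
rewrite -/(proj s' x).
have : `|x - u M| < eps.
  move/eqP : xy0; rewrite subr_eq0 => /eqP ->.
  by have := MP M (leqnn M); rewrite /=; lra.
move=> /ltW; apply: le_trans.
rewrite -ler_sqr ?nnegrE// !norm_sub_proj// lerD2l lerN2.
by rewrite -subr_ge0 -proj_sub// sqr_ge0.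
Qed.

End Parseval.

Section HilbertSchmidt.
Variables (R : realType) (Xi H : hilbertType R) (E : set Xi).
Implicit Types f g : Xi -> H.

Lemma hs_sq_ge0 f : (0 <= hs_sq E f)%E.
Proof. by apply: esum_ge0 => e _; rewrite lee_fin sqr_ge0. Qed.

Lemma hs_sq_le f g : (forall e, `|f e| <= `|g e|) -> (hs_sq E f <= hs_sq E g)%E.
Proof.
by move=> fg; apply: le_esum => e _; rewrite lee_fin ler_sqr ?nnegrE.
Qed.

Lemma eq_hs_sq f g : f =1 g -> hs_sq E f = hs_sq E g.
Proof. by move=> fg; apply: eq_esum => e _; rewrite fg. Qed.

Lemma mule3E (x : \bar R) : (0 <= x)%E -> (3%:E * x = x + x + x)%E.
Proof.
move=> x0; rewrite (_ : 3 = 1 + 1 + 1 :> R); last by ring.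
by rewrite EFinD ge0_muleDl// EFinD ge0_muleDl// !mul1e.
Qed.

Lemma hs_sq_sub3 f g1 g2 g3 : (forall e, f e = g1 e + g2 e + g3 e) ->
  (hs_sq E f <= 3%:E * (hs_sq E g1 + hs_sq E g2 + hs_sq E g3))%E.
Proof.
move=> fE; rewrite mule3E ?adde_ge0 ?hs_sq_ge0//.
rewrite /hs_sq -!esumD;
  try by move=> e _; rewrite -?EFinD lee_fin ?addr_ge0 ?sqr_ge0.
apply: le_esum => e Ee; rewrite -!EFinD lee_fin fE.
by have := sqr_normD3_le (g1 e) (g2 e) (g3 e); lra.
Qed.

Lemma hs_sq_fin_num f : hilbert_schmidt E f -> hs_sq E f \is a fin_num.
Proof. by move=> [_ hf]; rewrite ge0_fin_numE ?hs_sq_ge0. Qed.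

Lemma hs_sqB_fin_num f g : hilbert_schmidt E f -> hilbert_schmidt E g ->
  hs_sq E (fun x => f x - g x) \is a fin_num.
Proof.
move=> [_ hf] [_ hg]; rewrite ge0_fin_numE ?hs_sq_ge0//.
have := @hs_sq_sub3 (fun x => f x - g x) f (fun x => - g x) (fun=> 0).
move=> /(_ (fun e => esym (addr0 _))) /le_lt_trans; apply.
rewrite lte_mul_pinfty// !lte_add_pinfty//.
  by rewrite (_ : hs_sq _ _ = hs_sq E g)//; apply: eq_esum => e _; rewrite normrN.
by rewrite /hs_sq esum1// => e _; rewrite normr0 expr0n.
Qed.

Lemma hs_sqE f : hs_sq E f \is a fin_num -> hs_sq E f = (hs_norm E f ^+ 2)%:E.
Proof.
by move=> hf; rewrite /hs_norm sqr_sqrtr ?fineK// fine_ge0// hs_sq_ge0.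
Qed.

Lemma hs_norm_ge0 f : 0 <= hs_norm E f.
Proof. exact: sqrtr_ge0. Qed.

End HilbertSchmidt.

Section FiniteRank.
Variables (R : realType) (Xi H : hilbertType R) (E : set Xi).
Hypothesis onbE : orthonormal_basis E.
Variables (n : nat) (c : 'I_n -> R) (xi : 'I_n -> Xi) (h : 'I_n -> H).

(** By Parseval this is the squared Hilbert-Schmidt norm of the finite-rank operator F, written
    without reference to the basis. *)
Let gram := \sum_i \sum_j c i * c j * inner (xi i) (xi j) * inner (h i) (h j).
Let F x := \sum_i (c i * inner (xi i) x) *: h i.

Let gram_approx (eps : R) : 0 < eps -> exists s : seq Xi,
  [/\ uniq s, forall e, e \in s -> E e &
      `|gram - \sum_(e <- s) `|F e| ^+ 2| <= eps].
Proof.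
move=> eps0.
pose M := \sum_i \sum_j `|c i * c j * inner (h i) (h j)| * `|xi j|.
have M0 : 0 <= M by apply: sumr_ge0 => i _; apply: sumr_ge0 => j _; rewrite mulr_ge0.
pose d := eps / (M + 1).
have d0 : 0 < d by rewrite divr_gt0// ltr_wpDl.
pose S i := sval (cid (orthonormal_basis_approx onbE (xi i) d0)).
have SP i := svalP (cid (orthonormal_basis_approx onbE (xi i) d0)).
pose s := undup (flatten [seq S i | i <- enum 'I_n]).
have sE e : e \in s -> E e.
  rewrite mem_undup => /flattenP[_ /mapP[i _ ->]] eS.
  by have [_ + _] := SP i; apply.
have us : uniq s by exact: undup_uniq.
exists s; split=> //.
have sub i : {subset S i <= s}.
  move=> e eS; rewrite mem_undup; apply/flattenP; exists (S i) => //.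
  by apply/mapP; exists i => //; rewrite mem_enum.
have app i : `|xi i - \sum_(e <- s) inner (xi i) e *: e| <= d.
  by have [_ _ +] := SP i; apply => //; exact: sub.
(* A partial sum of |F e|^2 is the Gram sum in which one of the two vectors xi is replaced by its
   partial expansion, so the error is controlled by the expansions alone. *)
have -> : \sum_(e <- s) `|F e| ^+ 2 = \sum_i \sum_j c i * c j *
    inner (\sum_(e <- s) inner (xi i) e *: e) (xi j) * inner (h i) (h j).
  under eq_bigr do rewrite -inner_norm inner_suml.
  rewrite exchange_big; apply: eq_bigr => i _ /=.
  under eq_bigr do rewrite inner_sumr.
  rewrite exchange_big; apply: eq_bigr => j _ /=.
  rewrite inner_suml mulr_sumr mulr_suml; apply: eq_bigr => e _.
  by rewrite !innerZl innerZr (innerC e); ring.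
rewrite /gram -sumrB.
apply: (@le_trans _ _ (d * M)); last first.
  rewrite /d -mulrA ler_piMr ?(ltW eps0)// mulrC ler_pdivrMr ?mul1r ?lerDl//.
  by rewrite ltr_wpDl.
rewrite mulr_sumr (le_trans (ler_norm_sum _ _ _))//; apply: ler_sum => i _.
rewrite -sumrB mulr_sumr (le_trans (ler_norm_sum _ _ _))//; apply: ler_sum => j _.
rewrite -mulrBl -mulrBr -innerBl mulrAC normrM mulrCA ler_wpM2l//.
by rewrite (le_trans (cauchy_schwarz _ _))// ler_wpM2r.
Qed.

Lemma gram_ge0 : 0 <= gram.
Proof.
apply/ler_addgt0Pr => e e0; have [s [_ _ h1]] := gram_approx e0.
have : 0 <= \sum_(e <- s) `|F e| ^+ 2 by apply: sumr_ge0 => *; exact: sqr_ge0.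
by move: h1; rewrite ler_norml => /andP[+ _]; lra.
Qed.

(** Converts the isometry of elementary integrals, whose density is a Gram sum, into a bound by
    Hilbert-Schmidt norms: finite partial sums are below the sum over E and come arbitrarily close
    to [gram]. *)
Lemma gram_le_hs_sq : (gram%:E <= hs_sq E F)%E.
Proof.
apply/lee_addgt0Pr => e e0; have [s [us sE h1]] := gram_approx e0.
apply: (@le_trans _ _ ((\sum_(e <- s) `|F e| ^+ 2)%:E + e%:E)%E).
  rewrite -EFinD lee_fin; move: h1; rewrite ler_norml => /andP[_]; lra.
rewrite leeD2r//; apply: esum_ge; exists [set` s].
  by split=> [|x /=]; [exact: finite_seq|exact: sE].
by rewrite -fsbig_seq// sumEFin.
Qed.

End FiniteRank.

(** * Wiener increments and the Ito isometry *)

Section NormalSecondMoment.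
Variables (R : realType) (s : R).
Hypothesis s0 : 0 < s.
Local Notation mu := (@lebesgue_measure R).
Local Notation N := (normal_prob 0 s).
Local Notation phi := (normal_pdf 0 s).

(** Change of variables with the Radon-Nikodym derivative, which agrees almost everywhere with the
    density [phi] because both have integral [N] over every measurable set. *)
Lemma integral_normal_prob_ge0 (f : R -> \bar R) : (forall x, (0 <= f x)%E) ->
  measurable_fun setT f ->
  (\int[N]_x f x = \int[mu]_x (f x * (phi x)%:E))%E.
Proof.
move=> f0 mf.
rewrite -(Radon_Nikodym_SigmaFinite.change_of_variables (normal_prob_dominates 0 s))//.
set g := Radon_Nikodym_SigmaFinite.f _ _.
have ig : mu.-integrable setT g.
  by apply: Radon_Nikodym_SigmaFinite.f_integrable; exact: normal_prob_dominates.
have mphi : measurable_fun setT (EFin \o phi).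
  by apply/measurable_EFinP; exact: measurable_normal_pdf.
apply: ae_eq_integral => //.
- by apply: emeasurable_funM => //; exact: measurable_int ig.
- exact: emeasurable_funM.
- apply: ae_eqe_mul2l; apply: integral_ae_eq => //= A _ mA.
  rewrite -Radon_Nikodym_SigmaFinite.f_integral//.
  exact: normal_prob_dominates.
Qed.

Let s20 : 0 < s ^+ 2. Proof. exact: exprn_gt0. Qed.

(** An antiderivative of (x^2 - s^2) phi x that vanishes at 0 and at infinity. *)
Let H (x : R) := - s ^+ 2 * x * phi x.

Let phiE x : phi x = normal_peak s * expR (- (2 * s ^+ 2)^-1 * x ^+ 2).
Proof.
rewrite normal_pdfE ?gt_eqF//= /normal_fun subr0 -mulr_natl.
by congr (_ * expR _); ring.
Qed.

Let dH (x : R) : is_derive x (1 : R) (H : R -> R) ((x ^+ 2 - s ^+ 2) * phi x).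
Proof.
pose G y := - s ^+ 2 * y * (normal_peak s * expR (- (2 * s ^+ 2)^-1 * y ^+ 2)).
have -> : H = G by apply/funext => y; rewrite /H phiE.
rewrite /G phiE. apply: is_derive_eq.
rewrite /GRing.scale /= ?mulr1 ?mulr0 ?addr0.
by field; rewrite ?gt_eqF.
Qed.

Let cphi : continuous (phi : R -> R).
Proof. by apply: continuous_normal_pdf; rewrite gt_eqF. Qed.

Let cf : continuous (fun x : R => (x ^+ 2 - s ^+ 2) * phi x).
Proof.
move=> x; apply: cvgM; last exact: cphi.
by apply: cvgB; [exact: exprn_continuous|exact: cvg_cst].
Qed.

Let H_cvg : H x @[x --> +oo%R] --> (0 : R).
Proof.
have p0 := normal_peak_ge0 s.
apply/cvgrPdist_le => e e0.
near=> x.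
have x0 : 0 < x by near: x; exact: nbhs_pinfty_gt.
(* From u <= expR u at u = x^2 / (2 s^2); it makes |H x| at most a constant divided by x. *)
have ed : expR (- (2 * s ^+ 2)^-1 * x ^+ 2) <= 2 * s ^+ 2 / x ^+ 2.
  rewrite mulNr expRN -[leRHS]invrK lef_pV2 ?posrE ?expR_gt0//; last first.
    by rewrite invr_gt0 divr_gt0// ?mulr_gt0// exprn_gt0.
  rewrite invf_div mulrC.
  by rewrite (le_trans _ (expR_ge1Dx _))// lerDr.
rewrite sub0r normrN /H phiE !normrM normrN (gtr0_norm s20) (gtr0_norm x0).
rewrite (ger0_norm p0) (ger0_norm (expR_ge0 _)).
apply: (@le_trans _ _ (s ^+ 2 * x * (normal_peak s * (2 * s ^+ 2 / x ^+ 2)))).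
  apply: ler_wpM2l; first by rewrite ltW// mulr_gt0.
  exact: ler_wpM2l.
have -> : s ^+ 2 * x * (normal_peak s * (2 * s ^+ 2 / x ^+ 2)) =
    (2 * s ^+ 4 * normal_peak s) / x by field; rewrite gt_eqF.
rewrite ler_pdivrMr// -ler_pdivrMl//; near: x; exact: nbhs_pinfty_ge.
Unshelve. all: by end_near. Qed.

Let mphi : measurable_fun setT phi.
Proof. exact: measurable_normal_pdf. Qed.

Let phi0 x : 0 <= phi x. Proof. exact: normal_pdf_ge0. Qed.

Let msq : measurable_fun setT (fun x : R => x ^+ 2).
Proof. by apply: measurable_funX. Qed.

(** The half-line is cut at s, where x^2 - s^2 changes sign, so that the fundamental theorem of
    calculus is applied to nonnegative integrands. This piece and the one over [0, s] both equal - H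
    s and cancel. *)
Let Hs : (\int[mu]_(x in `[s, +oo[) ((x ^+ 2 - s ^+ 2) * phi x)%:E = - (H s)%:E)%E.
Proof.
rewrite (@ge0_continuous_FTC2y _ _ H s 0) ?sub0e//.
- move=> x sx; rewrite mulr_ge0// subr_ge0 ler_sqr ?nnegrE ?(ltW s0)//.
  by rewrite (le_trans (ltW s0)).
- by apply: continuous_subspaceT; exact: cf.
- by move=> x _; have [] := dH x.
- apply: cvg_at_right_filter; apply: differentiable_continuous.
  by apply/derivable1_diffP; have [] := dH s.
- by move=> x _; rewrite derive1E; have [_ ->] := dH x.
Qed.

Let H0s : (\int[mu]_(x in `[0%R, s]) ((s ^+ 2 - x ^+ 2) * phi x)%:E = - (H s)%:E)%E.
Proof.
have dN (x : R) : is_derive x (1 : R) (- H : R -> R) ((s ^+ 2 - x ^+ 2) * phi x).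
  have -> : (s ^+ 2 - x ^+ 2) * phi x = - ((x ^+ 2 - s ^+ 2) * phi x) by ring.
  exact: is_deriveN.
have cN : continuous (- H : R -> R).
  move=> x; apply: differentiable_continuous; apply/derivable1_diffP.
  by have [] := dN x.
rewrite (@continuous_FTC2 _ _ (- H) 0 s)//.
- by rewrite !fctE /= {2}/H mulr0 mul0r oppr0 sube0 EFinN.
- apply: continuous_subspaceT => x; apply: cvgM; last exact: cphi.
  by apply: cvgB; [exact: cvg_cst|exact: exprn_continuous].
- split.
  + by move=> x _; have [] := dN x.
  + by apply: cvg_at_right_filter; exact: cN.
  + by apply: cvg_at_left_filter; exact: cN.
- by move=> x _; rewrite derive1E; have [_ ->] := dN x.
Qed.

(** Since (x^2 - s^2) phi x integrates to zero over the half-line, x^2 phi x and s^2 phi x have the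
    same integral there, and evenness doubles both sides. The two pieces are compared separately, so
    that no difference of possibly infinite integrals occurs. *)
Lemma normal_second_moment : (\int[N]_x (x ^+ 2)%:E = (s ^+ 2)%:E)%E.
Proof.
rewrite integral_normal_prob_ge0//; last 2 first.
- by move=> x; rewrite lee_fin sqr_ge0.
- by apply/measurable_EFinP.
have sy (f : R -> R) : continuous f -> (forall x, 0 <= f x) -> f =1 f \o -%R ->
    (\int[mu]_x (f x)%:E = 2%:E * (\int[mu]_(x in `[0%R, s]) (f x)%:E +
      \int[mu]_(x in `[s, +oo[) (f x)%:E))%E.
  move=> cf' f0 fs; rewrite ge0_symfun_integralT//.
  have mf' : measurable_fun setT f by exact: continuous_measurable_fun.
  congr (_ * _)%E; rewrite -set_itvcy.
  rewrite (_ : `[0, +oo[%classic = `[0, s] `|` `]s, +oo[); last first.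
    by rewrite -itv_bndbnd_setU// bnd_simp// ltW.
  rewrite ge0_integral_setU//=.
  - by rewrite integral_itv_obnd_cbnd//; apply/measurable_EFinP/measurable_funTS.
  - by apply/measurable_EFinP/measurable_funTS.
  - by move=> x _; rewrite lee_fin.
  - by apply/disj_setPS => x [/=]; rewrite !in_itv/= => /andP[_ xs] /andP[]; rewrite ltNge xs.
transitivity (\int[mu]_x ((s ^+ 2)%:E * (phi x)%:E))%E; last first.
  rewrite ge0_integralZl//.
  - by rewrite integral_normal_pdf mule1.
  - by apply/measurable_EFinP.
  - by move=> x _; rewrite lee_fin.
  - by rewrite lee_fin ltW.
under eq_integral do rewrite -EFinM.
under [in RHS]eq_integral do rewrite -EFinM.
have phiN x : phi (- x) = phi x by rewrite !phiE sqrrN.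
rewrite !sy//.
- congr (_ * _)%E.
  have e1 : (\int[mu]_(x in `[s, +oo[) (x ^+ 2 * phi x)%:E = - (H s)%:E +
      \int[mu]_(x in `[s, +oo[) (s ^+ 2 * phi x)%:E)%E.
    rewrite -Hs -ge0_integralD//=.
    + by apply: eq_integral => x _; rewrite -EFinD; congr EFin; ring.
    + move=> x; rewrite in_itv/= andbT => sx.
      rewrite lee_fin mulr_ge0// subr_ge0 ler_sqr ?nnegrE ?(ltW s0)//.
      by rewrite (le_trans (ltW s0)).
    + by apply/measurable_EFinP/measurable_funTS; exact: continuous_measurable_fun.
    + by move=> x _; rewrite lee_fin mulr_ge0// ltW.
    + by apply/measurable_EFinP/measurable_funTS; exact: measurable_funM.
  have e2 : (\int[mu]_(x in `[0%R, s]) (s ^+ 2 * phi x)%:E = - (H s)%:E +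
      \int[mu]_(x in `[0%R, s]) (x ^+ 2 * phi x)%:E)%E.
    rewrite -H0s -ge0_integralD//=.
    + by apply: eq_integral => x _; rewrite -EFinD; congr EFin; ring.
    + move=> x; rewrite in_itv/= => /andP[x0 xs].
      by rewrite lee_fin mulr_ge0// subr_ge0 ler_sqr ?nnegrE ?(ltW s0).
    + apply/measurable_EFinP/measurable_funTS/measurable_funM => //.
      exact: measurable_funB.
    + by move=> x _; rewrite lee_fin mulr_ge0// sqr_ge0.
    + by apply/measurable_EFinP/measurable_funTS; exact: measurable_funM.
  by rewrite e1 e2 addeCA addeA.
- by move=> x; apply: cvgM; [exact: cvg_cst|exact: cphi].
- by move=> x; rewrite mulr_ge0// ltW.
- by move=> x /=; rewrite phiN.
- by move=> x; apply: cvgM; [exact: exprn_continuous|exact: cphi].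
- by move=> x; rewrite mulr_ge0// sqr_ge0.
- by move=> x /=; rewrite phiN sqrrN.
Qed.

End NormalSecondMoment.

Section SquareIntegrable.
Context d (T : measurableType d) (R : realType) (P : probability T R).
Implicit Types f g : T -> R.

Definition sq_integrable f :=
  measurable_fun setT f /\ P.-integrable setT (fun w => (f w ^+ 2)%:E).

Lemma integrable_normM_le f g h : measurable_fun setT f ->
  P.-integrable setT (EFin \o g) -> P.-integrable setT (EFin \o h) ->
  (forall w, `|f w| <= g w + h w) -> P.-integrable setT (EFin \o f).
Proof.
move=> mf ig ih fgh; apply: (le_integrable measurableT _ _ (integrableD measurableT ig ih)).
  exact/measurable_EFinP.
move=> w _; rewrite -[leRHS]/(`|g w + h w|%:E) -[leLHS]/(`|f w|%:E) lee_fin.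
exact: le_trans (fgh w) (ler_norm _).
Qed.

Lemma sq_integrable_mul f g : sq_integrable f -> sq_integrable g ->
  P.-integrable setT (fun w => (f w * g w)%:E).
Proof.
move=> [mf f2] [mg g2].
apply: (@integrable_normM_le _ (fun w => f w ^+ 2) (fun w => g w ^+ 2)) => //.
  exact: measurable_funM.
move=> w /=; rewrite normrM -(real_normK (num_real (f w))) -(real_normK (num_real (g w))).
by have := sqr_ge0 (`|f w| - `|g w|); have := sqr_ge0 (`|f w| + `|g w|); nra.
Qed.

Lemma sq_integrableD f g : sq_integrable f -> sq_integrable g ->
  sq_integrable (fun w => f w + g w).
Proof.
move=> [mf f2] [mg g2].
have mfg : measurable_fun setT (fun w => f w + g w) by exact: measurable_funD.
split=> //.
have i2 h : P.-integrable setT (fun w => (h w ^+ 2)%:E) ->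
    P.-integrable setT (EFin \o (fun w => 2 * h w ^+ 2)).
  by move=> /(integrableZl measurableT 2); under eq_fun do rewrite -EFinM.
apply: (@integrable_normM_le _ (fun w => 2 * f w ^+ 2) (fun w => 2 * g w ^+ 2)).
- exact: measurable_funX.
- exact: i2.
- exact: i2.
- move=> w /=; rewrite ger0_norm ?sqr_ge0//.
  by have := sqr_ge0 (f w - g w); nra.
Qed.

Lemma sq_integrable_indic (F : set T) f : measurable F -> sq_integrable f ->
  sq_integrable (fun w => \1_F w * f w).
Proof.
move=> mF [mf f2]; split; first exact: measurable_funM.
apply: (le_integrable measurableT _ _ f2).
  by apply/measurable_EFinP/measurable_funX; exact: measurable_funM.
by move=> w _ /=; rewrite lee_fin !ger0_norm ?sqr_ge0// exprMn ler_piMl ?sqr_ge0.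
Qed.

End SquareIntegrable.

Section FiltrationTheory.
Variables (R : realType) (Xi : hilbertType R) (Om : ref_space Xi) (t T : R).
Hypothesis refOm : reference_space Om t T.
Local Notation P := (ref_P Om).

Definition filtration_gen (s : R) : set (set Om) :=
  [set F | exists tau xi (C : set (measurableTypeR R)),
         [/\ t <= tau <= s, measurable C & F = ref_W tau xi @^-1` C]]
      `|` P.-negligible.

(** The past up to s as a measurable type on the same points, so that measurability of a random
    variable with respect to the past becomes an instance of [measurable_fun]. *)
Definition filtration_type (s : R) := g_sigma_algebraType (filtration_gen s).

Lemma ref_W_measurable s xi : t <= s <= T ->
  measurable_fun setT (ref_W s xi : Om -> R).
Proof. by have [_ [h _ _ _ _]] := refOm; exact: h. Qed.

(** The negligible sets among the generators are measurable because the probability space is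
    complete. *)
Lemma filtration_measurable s (F : set Om) : s <= T -> filtration t s F -> measurable F.
Proof.
move=> sT; apply: smallest_sub; first exact: sigma_algebra_measurable.
move=> G [[tau [xi [C [/andP[tt ts] mC ->]]]]|].
  rewrite -[X in measurable X]setTI; apply: ref_W_measurable => //.
  by rewrite tt (le_trans ts).
by have [+ _] := refOm; exact.
Qed.

Lemma filtration_mono r s (F : set Om) : r <= s -> filtration t r F -> filtration t s F.
Proof.
move=> rs; have sub : filtration_gen r `<=` filtration t s.
  move=> G [[tau [xi [C [/andP[tt tr] mC ->]]]]|nG]; last first.
    by apply: sub_sigma_algebra; right.
  apply: sub_sigma_algebra; left; exists tau, xi, C; split=> //.
  by rewrite tt (le_trans tr).
exact: (smallest_sub (smallest_sigma_algebra _ _) sub).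
Qed.

Lemma filtration_fun_measurable r (Z : Om -> R) : r <= T ->
  measurable_fun setT (Z : filtration_type r -> R) -> measurable_fun setT Z.
Proof.
move=> rT mZ _ C mC; rewrite setTI.
apply: (@filtration_measurable r) => //.
by have := mZ measurableT C mC; rewrite setTI.
Qed.

Lemma filtration_ref_W r s xi : t <= s <= r ->
  measurable_fun setT (ref_W s xi : filtration_type r -> R).
Proof.
move=> tsr _ C mC; rewrite setTI; apply: sub_sigma_algebra; left.
by exists s, xi, C.
Qed.

End FiltrationTheory.

Section WienerIncrements.
Variables (R : realType) (Xi : hilbertType R) (Om : ref_space Xi) (t T : R).
Hypothesis refOm : reference_space Om t T.
Local Notation P := (ref_P Om).

Definition incr (r s : R) (xi : Xi) (w : Om) : R := ref_W s xi w - ref_W r xi w.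

Lemma incr_measurable r s xi : t <= r <= T -> t <= s <= T ->
  measurable_fun setT (incr r s xi).
Proof.
by move=> tr ts; apply: measurable_funB; exact: (ref_W_measurable refOm).
Qed.

Lemma incr_linear r s c xi eta : t <= r <= T -> t <= s <= T ->
  {ae P, forall w, incr r s (c *: xi + eta) w = c * incr r s xi w + incr r s eta w}.
Proof.
have [_ [_ _ lin _ _]] := refOm => tr ts.
have h1 := lin r c xi eta tr; have h2 := lin s c xi eta ts.
apply: filterS2 h1 h2 => w; rewrite /incr => -> ->; ring.
Qed.

Lemma incr0 r s : t <= r <= T -> t <= s <= T -> {ae P, forall w, incr r s 0 w = 0}.
Proof.
move=> tr ts; apply: filterS (incr_linear 1 0 0 tr ts) => w.
by rewrite scaler0 addr0 mul1r => h; apply/(addrI (incr r s 0 w)); rewrite addr0 -h.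
Qed.

Lemma incrN r s xi : t <= r <= T -> t <= s <= T ->
  {ae P, forall w, incr r s (- xi) w = - incr r s xi w}.
Proof.
move=> tr ts; have h1 := incr_linear (-1) xi 0 tr ts; have h2 := incr0 tr ts.
apply: filterS2 h1 h2 => w.
by rewrite scaleN1r addr0 => -> ->; rewrite addr0 mulN1r.
Qed.

Let sd r s (xi : Xi) := Num.sqrt (s - r) * `|xi|.

Section JointLaw.
Variables (r s : R) (Z : Om -> R).
Hypotheses (tr : t <= r) (rs : r < s) (sT : s <= T).
Hypothesis mZ : measurable_fun setT (Z : filtration_type Om t r -> R).

Let mZ' : measurable_fun setT (Z : Om -> measurableTypeR R).
Proof.
by apply: (filtration_fun_measurable refOm _ mZ); rewrite ltW// (lt_le_trans rs).
Qed.

Let mI xi : measurable_fun setT (incr r s xi : Om -> measurableTypeR R).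
Proof.
apply: incr_measurable; first by rewrite tr ltW// (lt_le_trans rs).
by rewrite sT (le_trans tr)// ltW.
Qed.

Let mJ xi : measurable_fun setT
  (fun w => (Z w, incr r s xi w) : (measurableTypeR R * measurableTypeR R)%type).
Proof. exact: measurable_fun_pair. Qed.

Let J_mixin xi := isMeasurableFun.Build _ _ _ _ _ (mJ xi).
Let J xi : {mfun Om >-> (measurableTypeR R * measurableTypeR R)%type} :=
  HB.pack (fun w : Om =>
    (Z w, incr r s xi w) : (measurableTypeR R * measurableTypeR R)%type) (J_mixin xi).
Let Z_mixin := isMeasurableFun.Build _ _ _ _ _ mZ'.
Let Zm : {mfun Om >-> measurableTypeR R} :=
  HB.pack (Z : Om -> measurableTypeR R) Z_mixin.

Let law xi := distribution P (J xi).

(* Independence of the increment from the past, as a product law. *)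
Let joint_law xi : xi != 0 -> forall X, measurable X ->
  (distribution P Zm \x normal_prob 0 (sd r s xi))%E X = law xi X.
Proof.
move=> xi0; apply: (product_measure_unique (m' := distribution P (J xi))) => A C mA mC.
have [_ [_ _ _ _ ind]] := refOm.
have [nC indC] := ind r s xi tr rs sT xi0 C mC.
have fA : filtration t r (Z @^-1` A).
  by have := mZ measurableT mA; rewrite setTI.
have := indC _ fA; rewrite nC /law /distribution /pushforward /= => <-.
by congr (P _); apply/seteqP; split=> w /=.
Qed.

(** Under the product law the second moment of the increment factors out by Tonelli's theorem; the
    absolute value of Z keeps the integrand nonnegative. *)
Lemma integral_past_incr_sq xi : xi != 0 ->
  (\int[P]_w (`|Z w| * incr r s xi w ^+ 2)%:E =
    ((s - r) * `|xi| ^+ 2)%:E * \int[P]_w `|Z w|%:E)%E.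
Proof.
move=> xi0.
pose f (x : measurableTypeR R * measurableTypeR R) := (`|x.1| * x.2 ^+ 2)%:E.
have mf : measurable_fun setT f.
  apply/measurable_EFinP/measurable_funM.
    exact: measurableT_comp.
  by apply: measurable_funX.
have f0 x : (0 <= f x)%E by rewrite lee_fin mulr_ge0// sqr_ge0.
transitivity (\int[law xi]_x f x)%E.
  by rewrite ge0_integral_distribution.
rewrite (eq_measure_integral (distribution P Zm \x normal_prob 0 (sd r s xi))%E); last first.
  by move=> A mA _; exact/esym/joint_law.
rewrite fubini_tonelli1// /fubini_F /f /=.
have sd0 : 0 < sd r s xi by rewrite mulr_gt0 ?normr_gt0// sqrtr_gt0 subr_gt0.
under eq_integral.
  move=> x _; under eq_integral do rewrite EFinM.
  rewrite ge0_integralZl//; last 2 first.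
  - by apply/measurable_EFinP/measurable_funX.
  - by move=> y _; rewrite lee_fin sqr_ge0.
  rewrite normal_second_moment// /sd exprMn sqr_sqrtr ?subr_ge0 ?(ltW rs)// muleC.
  over.
rewrite ge0_integralZl//; last 2 first.
- by apply/measurable_EFinP; exact: normr_measurable.
- by rewrite lee_fin mulr_ge0 ?sqr_ge0// subr_ge0 ltW.
congr (_ * _)%E; rewrite ge0_integral_distribution//=.
by apply/measurable_EFinP; exact: normr_measurable.
Qed.

(* [incr r s xi] and [incr r s (- xi)] have the same law given the past and are
   opposite almost surely. *)
Lemma integral_past_incr_eq0 xi : xi != 0 ->
  P.-integrable setT (fun w => (Z w * incr r s xi w)%:E) ->
  (\int[P]_w (Z w * incr r s xi w)%:E = 0)%E.
Proof.
move=> xi0 iZ.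
pose f (x : measurableTypeR R * measurableTypeR R) := (x.1 * x.2)%:E.
have mf : measurable_fun setT f by apply/measurable_EFinP/measurable_funM.
have trT : t <= r <= T by rewrite tr ltW// (lt_le_trans rs).
have tsT : t <= s <= T by rewrite sT (le_trans tr)// ltW.
have aeN : ae_eq P setT (fun w => (Z w * incr r s (- xi) w)%:E)
    (fun w => - (Z w * incr r s xi w)%:E)%E.
  by apply: filterS (incrN xi trT tsT) => w -> _; rewrite mulrN EFinN.
have mZI xi' : measurable_fun setT (fun w => (Z w * incr r s xi' w)%:E).
  by apply/measurable_EFinP; exact: (measurable_funM mZ' (mI xi')).
have iN : P.-integrable setT (fun w => (Z w * incr r s (- xi) w)%:E).
  apply/integrableP; split=> //.
  rewrite (ae_eq_integral (fun w => `|(Z w * incr r s xi w)%:E|%E))//.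
  - by move/integrableP : iZ => [].
  - exact: measurableT_comp.
  - exact: measurableT_comp.
  - by apply: filterS aeN => w + _ => /(_ Logic.I) ->; rewrite abseN.
have e1 : (\int[P]_w (Z w * incr r s xi w)%:E = \int[P]_w (Z w * incr r s (- xi)%R w)%:E)%E.
  transitivity (\int[law xi]_x f x)%E; first by rewrite integral_distribution.
  transitivity (\int[law (- xi)%R]_x f x)%E; last by rewrite integral_distribution.
  apply: eq_measure_integral => A mA _.
  transitivity ((distribution P Zm \x normal_prob 0 (sd r s xi))%E A).
    exact/esym/joint_law.
  have -> : sd r s xi = sd r s (- xi) by rewrite /sd normrN.
  by apply: joint_law => //; rewrite oppr_eq0.
have e2 : (\int[P]_w (Z w * incr r s (- xi)%R w)%:E = - \int[P]_w (Z w * incr r s xi w)%:E)%E.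
  rewrite -integralN; last exact: integrable_add_def.
  by apply: ae_eq_integral => //; exact: measurableT_comp.
have fin := integrable_fin_num measurableT iZ.
move: e1; rewrite e2 -(fineK fin) -EFinN => -[] h; congr EFin; lra.
Qed.

End JointLaw.

End WienerIncrements.

Section SquareIntegrableBilinear.
Context d (T : measurableType d) (R : realType) (P : probability T R).
Implicit Types f g h : T -> R.

Lemma Rintegral_mulDl f g h : sq_integrable P f -> sq_integrable P g ->
  sq_integrable P h ->
  \int[P]_w ((f w + g w) * h w) = \int[P]_w (f w * h w) + \int[P]_w (g w * h w).
Proof.
move=> sf sg sh; rewrite -RintegralD//; last 2 first.
- exact: sq_integrable_mul.
- exact: sq_integrable_mul.
by apply: eq_Rintegral => w _; rewrite mulrDl.
Qed.

Lemma Rintegral_mulC f g : \int[P]_w (f w * g w) = \int[P]_w (g w * f w).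
Proof. by apply: eq_Rintegral => w _; rewrite mulrC. Qed.

Lemma Rintegral_mulDr f g h : sq_integrable P f -> sq_integrable P g ->
  sq_integrable P h ->
  \int[P]_w (h w * (f w + g w)) = \int[P]_w (h w * f w) + \int[P]_w (h w * g w).
Proof. by move=> *; rewrite Rintegral_mulC Rintegral_mulDl// !(Rintegral_mulC h). Qed.

End SquareIntegrableBilinear.

Section IncrementMoments.
Variables (R : realType) (Xi : hilbertType R) (Om : ref_space Xi) (t T : R).
Hypothesis refOm : reference_space Om t T.
Local Notation P := (ref_P Om).

Let itvT (r s : R) : t <= r -> r <= s -> s <= T -> (t <= r <= T) /\ (t <= s <= T).
Proof. by move=> tr rs sT; rewrite tr sT (le_trans tr rs) (le_trans rs sT). Qed.

(** The law of an increment is prescribed for r < s and xi different from 0. Otherwise the increment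
    vanishes, identically when r = s and almost surely when xi = 0. *)
Lemma incr_sq r s xi (F : set Om) : t <= r -> r <= s -> s <= T -> filtration t r F ->
  (\int[P]_w (\1_F w * incr r s xi w ^+ 2)%:E = ((s - r) * `|xi| ^+ 2)%:E * P F)%E.
Proof.
move=> tr; rewrite le_eqVlt => /predU1P[<- _ _|rs sT FF].
  rewrite subrr mul0r mul0e integral0_eq// => w _.
  by rewrite /incr subrr expr0n mulr0.
have rs' := ltW rs.
have mF : measurable F by apply: (filtration_measurable refOm _ FF); rewrite (le_trans rs').
have [trT tsT] := itvT tr rs' sT.
have mZ : measurable_fun setT (\1_F : filtration_type Om t r -> R).
  exact: (measurable_indic (FF : measurable (F : set (filtration_type Om t r)))).
have [->|xi0] := eqVneq xi 0.
  rewrite normr0 expr0n mulr0 mul0e.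
  rewrite (ae_eq_integral (cst 0%E)) ?integral0//.
    apply/measurable_EFinP/measurable_funM => //.
    by apply: measurable_funX; exact: (incr_measurable refOm).
  apply: filterS (incr0 refOm trT tsT) => w -> _.
  by rewrite expr0n mulr0.
have := integral_past_incr_sq refOm tr rs sT mZ xi0.
have nF w : `|\1_F w : R| = \1_F w by rewrite ger0_norm.
under eq_integral do rewrite nF.
under [in X in _ = X -> _]eq_integral do rewrite nF.
by move=> ->; rewrite integral_indic// setIT.
Qed.

Lemma incr_sq_integrable r s xi : t <= r -> r <= s -> s <= T ->
  sq_integrable P (incr r s xi).
Proof.
move=> tr rs sT; have [trT tsT] := itvT tr rs sT.
have mI := incr_measurable refOm xi trT tsT.
split=> //; apply/integrableP; split.
  by apply/measurable_EFinP/measurable_funX.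
have fT : filtration t r [set: Om].
  exact: (@measurableT _ (filtration_type Om t r)).
have := incr_sq xi tr rs sT fT.
under eq_integral do rewrite indicT mul1r.
under [in X in _ -> X]eq_integral do rewrite /= ger0_norm ?sqr_ge0//.
by move=> ->; rewrite probability_setT mule1 ltry.
Qed.

(** The indicator of F times the earlier increment is measurable with respect to the past at r, and
    a later increment has zero mean against it. *)
Lemma incr_orth u v r s xi eta (F : set Om) : t <= u -> u <= v -> v <= r -> r <= s -> s <= T ->
  filtration t r F ->
  \int[P]_w ((\1_F w * incr u v xi w) * incr r s eta w) = 0.
Proof.
move=> tu uv vr; have tr : t <= r by rewrite (le_trans tu)// (le_trans uv).
rewrite le_eqVlt => /predU1P[<- _ _|rs sT FF].
  have e w : \1_F w * incr u v xi w * incr r r eta w = 0.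
    by rewrite /incr (subrr (ref_W r eta w)) mulr0.
  rewrite /Rintegral; under eq_integral do rewrite e.
  by rewrite integral0.
have rs' := ltW rs.
have [trT tsT] := itvT tr rs' sT.
have vT : v <= T by rewrite (le_trans vr)// (le_trans rs').
have mF : measurable F by apply: (filtration_measurable refOm _ FF); rewrite (le_trans rs').
have mI := incr_measurable refOm eta trT tsT.
have mIu : measurable_fun [set: Om] (incr u v xi : Om -> R).
  by have [h1 h2] := itvT tu uv vT; exact: (incr_measurable refOm xi h1 h2).
have [->|eta0] := eqVneq eta 0.
  rewrite /Rintegral (ae_eq_integral (cst 0%E)) ?integral0//.
    apply/measurable_EFinP/measurable_funM; first exact: measurable_funM.
    exact: (incr_measurable refOm).
  by apply: filterS (incr0 refOm trT tsT) => w -> _; rewrite mulr0.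
have mZ : measurable_fun setT ((fun w => \1_F w * incr u v xi w) : filtration_type Om t r -> R).
  apply: measurable_funM.
    exact: (measurable_indic (FF : measurable (F : set (filtration_type Om t r)))).
  by apply: measurable_funB; apply: filtration_ref_W;
    rewrite ?tu ?vr ?(le_trans tu)// (le_trans uv).
rewrite /Rintegral (integral_past_incr_eq0 refOm tr rs sT mZ eta0)//.
apply: sq_integrable_mul; last exact: incr_sq_integrable.
by apply: sq_integrable_indic => //; exact: incr_sq_integrable.
Qed.

(* Polarization of the second moment. *)
Lemma incr_cov r s xi eta (F : set Om) : t <= r -> r <= s -> s <= T ->
  filtration t r F ->
  \int[P]_w ((\1_F w * incr r s xi w) * incr r s eta w) =
    fine (P F) * (s - r) * inner xi eta.
Proof.
move=> tr rs sT FF; have [trT tsT] := itvT tr rs sT.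
have mF : measurable F by apply: (filtration_measurable refOm _ FF); rewrite (le_trans rs).
have sI x : sq_integrable P (incr r s x) by exact: incr_sq_integrable.
have sF x : sq_integrable P (fun w => \1_F w * incr r s x w).
  exact: sq_integrable_indic.
have sq x : \int[P]_w ((\1_F w * incr r s x w) * incr r s x w) =
    fine (P F) * (s - r) * `|x| ^+ 2.
  rewrite /Rintegral; under eq_integral do rewrite -mulrA -expr2.
  rewrite incr_sq// fineM//; last exact: fin_num_measure.
  by rewrite mulrC -mulrA.
have ae : \int[P]_w ((\1_F w * incr r s (xi + eta) w) * incr r s (xi + eta) w) =
    \int[P]_w ((\1_F w * incr r s xi w + \1_F w * incr r s eta w) *
      (incr r s xi w + incr r s eta w)).
  congr fine; apply: ae_eq_integral => //.
  - apply/measurable_EFinP/measurable_funM; first exact: (sF (xi + eta)).1.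
    exact: (sI _).1.
  - apply/measurable_EFinP/measurable_funM; apply: measurable_funD.
    + exact: (sF xi).1.
    + exact: (sF eta).1.
    + exact: (sI xi).1.
    + exact: (sI eta).1.
  - apply: filterS (incr_linear refOm 1 xi eta trT tsT) => w.
    by rewrite scale1r mul1r => -> _; congr EFin; ring.
move: ae; rewrite sq (Rintegral_mulDl (sF xi) (sF eta) (sq_integrableD (sI xi) (sI eta))).
rewrite (Rintegral_mulDr (sI xi) (sI eta) (sF xi)).
rewrite (Rintegral_mulDr (sI xi) (sI eta) (sF eta)) !sq normrD_inner.
rewrite [X in _ = _ + (X + _)](_ : _ = \int[P]_w (\1_F w * incr r s xi w * incr r s eta w)).
  lra.
by apply: eq_Rintegral => w _; rewrite mulrAC.
Qed.

(** Length of the intersection of ]a, b] and ]c, d]. The intervals of an elementary process need not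
    be disjoint, so products of overlapping increments do occur. *)
Definition overlap (a b c d : R) := Num.max 0 (Num.min b d - Num.max a c).

(** Both increments are cut at c and at m = min b d. Only the pieces over [c, m] are correlated; the
    other products pair disjoint intervals and vanish by [incr_orth], or contain the degenerate one
    of [m, b] and [m, d]. Since a <= c, both events belong to the past at c. *)
Let incr_pair_le a b c d xi eta (F G : set Om) :
  t <= a -> a <= b -> b <= T -> t <= c -> c <= d -> d <= T -> a <= c ->
  filtration t a F -> filtration t c G ->
  \int[P]_w ((\1_F w * incr a b xi w) * (\1_G w * incr c d eta w)) =
    fine (P (F `&` G)) * inner xi eta * overlap a b c d.
Proof.
move=> ta ab bT tc cd dT ac fF fG.
pose I := F `&` G.
have fI : filtration t c I.
  apply: (@measurableI _ (filtration_type Om t c)); last exact: fG.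
  exact: (filtration_mono ac fF).
have mI : measurable I by apply: (filtration_measurable refOm _ fI); rewrite (le_trans cd).
have -> : \int[P]_w ((\1_F w * incr a b xi w) * (\1_G w * incr c d eta w)) =
    \int[P]_w ((\1_I w * incr a b xi w) * incr c d eta w).
  by apply: eq_Rintegral => w _; rewrite indicI /=; ring.
have [bc|/ltW cb] := leP b c.
  rewrite incr_orth// /overlap (max_idPr ac).
  by rewrite (max_idPl _) ?mulr0// subr_le0 ge_min bc.
pose m := Num.min b d.
have cm : c <= m by rewrite le_min cb.
have mb : m <= b by rewrite ge_min lexx.
have md : m <= d by rewrite ge_min lexx orbT.
have mT : m <= T by rewrite (le_trans mb).
have tm : t <= m by rewrite (le_trans tc).
have cT : c <= T by rewrite (le_trans cd).
have -> : overlap a b c d = m - c.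
  by rewrite /overlap (max_idPr ac) -/m (max_idPr _)// subr_ge0.
have sJ x y z : t <= x -> x <= y -> y <= T -> sq_integrable P (incr x y z).
  exact: incr_sq_integrable.
have sK x y z : t <= x -> x <= y -> y <= T ->
    sq_integrable P (fun w => \1_I w * incr x y z w).
  by move=> *; apply: sq_integrable_indic => //; exact: sJ.
have fm : filtration t m I by exact: (filtration_mono cm fI).
have e1 w : \1_I w * incr a b xi w = \1_I w * incr a c xi w +
    (\1_I w * incr c m xi w + \1_I w * incr m b xi w) by rewrite /incr; ring.
have e2 w : incr c d eta w = incr c m eta w + incr m d eta w by rewrite /incr; ring.
have z : \int[P]_w (\1_I w * incr m b xi w * incr m d eta w) = 0.
  have h w : \1_I w * incr m b xi w * incr m d eta w = 0.
    rewrite /m; have [bd|db] := leP b d; rewrite /incr.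
      by rewrite (subrr (ref_W b xi w)) mulr0 mul0r.
    by rewrite (subrr (ref_W d eta w)) mulr0.
  rewrite /Rintegral; under eq_integral do rewrite h.
  by rewrite integral0.
transitivity (\int[P]_w ((\1_I w * incr a c xi w +
    (\1_I w * incr c m xi w + \1_I w * incr m b xi w)) * incr c d eta w)).
  by apply: eq_Rintegral => w _; rewrite e1.
have s0 : sq_integrable P (fun w => \1_I w * incr a c xi w) by exact: sK.
have s5 : sq_integrable P (incr c d eta) by exact: sJ.
have s1 : sq_integrable P (fun w => \1_I w * incr c m xi w) by exact: sK.
have s2 : sq_integrable P (fun w => \1_I w * incr m b xi w) by exact: sK.
have s3 : sq_integrable P (incr c m eta) by exact: sJ.
have s4 : sq_integrable P (incr m d eta) by exact: sJ.
rewrite (Rintegral_mulDl s0 (sq_integrableD s1 s2) s5).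
rewrite (incr_orth xi eta ta ac (lexx c) cd dT fI) add0r.
transitivity (\int[P]_w ((\1_I w * incr c m xi w + \1_I w * incr m b xi w) *
    (incr c m eta w + incr m d eta w))).
  by apply: eq_Rintegral => w _; rewrite e2.
rewrite (Rintegral_mulDl s1 s2 (sq_integrableD s3 s4)).
rewrite (Rintegral_mulDr s3 s4 s1) (Rintegral_mulDr s3 s4 s2).
rewrite z incr_cov// (incr_orth xi eta tc cm (lexx m) md dT fm).
rewrite [X in _ + (X + _)](_ : _ = \int[P]_w (\1_I w * incr c m eta w * incr m b xi w)).
  by rewrite (incr_orth eta xi tc cm (lexx m) mb bT fm) /I; ring.
by apply: eq_Rintegral => w _; ring.
Qed.

Lemma incr_pair a b c d xi eta (F G : set Om) :
  t <= a -> a <= b -> b <= T -> t <= c -> c <= d -> d <= T ->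
  filtration t a F -> filtration t c G ->
  \int[P]_w ((\1_F w * incr a b xi w) * (\1_G w * incr c d eta w)) =
    fine (P (F `&` G)) * inner xi eta * overlap a b c d.
Proof.
move=> ta ab bT tc cd dT fF fG.
have [ac|/ltW ca] := leP a c; first exact: incr_pair_le.
rewrite Rintegral_mulC incr_pair_le// setIC innerC; congr (_ * _).
by rewrite /overlap minC maxC [Num.max c a]maxC [LHS]maxC.
Qed.

End IncrementMoments.

Section IntegralSums.
Context d (T : measurableType d) (R : realType) (mu : {measure set T -> \bar R}).
Variables (D : set T) (mD : measurable D).

Lemma integrable_EFin_sum (I : Type) (r : seq I) (f : I -> T -> R) :
  (forall i, mu.-integrable D (EFin \o f i)) ->
  mu.-integrable D (fun x => (\sum_(i <- r) f i x)%:E).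
Proof.
move=> fi; have := @integrable_sum _ _ _ mu D mD I r xpredT _ (fun i _ => fi i).
by under eq_fun do rewrite sumEFin.
Qed.

Lemma integral_EFin_sum (I : Type) (r : seq I) (f : I -> T -> R) :
  (forall i, mu.-integrable D (EFin \o f i)) ->
  (\int[mu]_(x in D) (\sum_(i <- r) f i x)%:E =
    (\sum_(i <- r) \int[mu]_(x in D) f i x)%:E)%E.
Proof.
move=> fi; under eq_integral do rewrite -sumEFin.
rewrite (integral_sum mD (fun i => fi i)) -sumEFin; apply: eq_bigr => i _.
by rewrite /Rintegral fineK//; exact: (integrable_fin_num mD (fi i)).
Qed.

End IntegralSums.

(** * The Ito isometry for elementary processes *)

Section ElementaryIsometry.
Variables (R : realType) (Xi H : hilbertType R) (Om : ref_space Xi) (t T s : R).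
Hypothesis refOm : reference_space Om t T.
Hypothesis sT : s <= T.
Variable phi : elem_process H Om.
Hypothesis adphi : ep_adapted t s phi.
Local Notation P := (ref_P Om).
Local Notation mu := (@lebesgue_measure R).
Local Notation I := 'I_(ep_size phi).

Let c (i : I) (r : R) (w : Om) : R :=
  (\1_(`]ep_lo i, ep_hi i]) r : R) * (\1_(ep_event i) w : R).

(** Squared Hilbert-Schmidt norm of the value of [phi] as a finite sum: joint measurability in time
    and chance is then immediate, whatever the cardinality of the basis. *)
Definition ep_gram (r : R) (w : Om) : R :=
  \sum_i \sum_j c i r w * c j r w * inner (ep_xi i) (ep_xi j) * inner (ep_h i) (ep_h j).

Lemma ep_gram_ge0 (E : set Xi) r w : orthonormal_basis E -> 0 <= ep_gram r w.
Proof. by move=> onbE; exact: (gram_ge0 onbE (fun i => c i r w) (@ep_xi _ _ _ _ phi) (@ep_h _ _ _ _ phi)). Qed.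

Lemma ep_gram_le_hs_sq (E : set Xi) r w : orthonormal_basis E ->
  ((ep_gram r w)%:E <= hs_sq E (ep_val phi r w))%E.
Proof. by move=> onbE; exact: (gram_le_hs_sq onbE (fun i => c i r w) (@ep_xi _ _ _ _ phi) (@ep_h _ _ _ _ phi)). Qed.

Let ev_measurable (i : I) : measurable (ep_event i).
Proof.
have [tl lh hs fi] := adphi i.
by apply: (filtration_measurable refOm _ fi); rewrite (le_trans lh)// (le_trans hs).
Qed.

Let g (i : I) (w : Om) := \1_(ep_event i) w * incr (ep_lo i) (ep_hi i) (ep_xi i) w.

Let g_sq (i : I) : sq_integrable P (g i).
Proof.
have [tl lh hs fi] := adphi i.
apply: sq_integrable_indic => //; apply: (incr_sq_integrable refOm) => //.
exact: le_trans hs sT.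
Qed.

Lemma ep_integral_sqE w : `|ep_integral phi w| ^+ 2 =
  \sum_i \sum_j (g i w * g j w) * inner (ep_h i) (ep_h j).
Proof.
rewrite -inner_norm inner_suml; apply: eq_bigr => i _.
rewrite inner_sumr; apply: eq_bigr => j _.
by rewrite innerZl innerZr /g /incr mulrA.
Qed.

Let gg_int i j : P.-integrable setT (EFin \o (fun w => (g i w * g j w) * inner (ep_h i) (ep_h j))).
Proof.
have := integrableZr measurableT (inner (ep_h i) (ep_h j)) (sq_integrable_mul (g_sq i) (g_sq j)).
exact.
Qed.

Lemma ep_integral_sq_measurable :
  measurable_fun setT (fun w : Om => `|ep_integral phi w| ^+ 2).
Proof.
under eq_fun do rewrite ep_integral_sqE.
apply: measurable_sum => i; apply: measurable_sum => j.
by apply: measurable_funM => //; apply: measurable_funM; exact: (g_sq _).1.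
Qed.

Let K := \sum_(i : I) \sum_(j : I) fine (P (ep_event i `&` ep_event j)) * inner (ep_xi i) (ep_xi j) *
  overlap (ep_lo i) (ep_hi i) (ep_lo j) (ep_hi j) * inner (ep_h i) (ep_h j).

Let ep_integral_sq : (\int[P]_w (`|ep_integral phi w| ^+ 2)%:E = K%:E)%E.
Proof.
under eq_integral do rewrite ep_integral_sqE.
rewrite integral_EFin_sum//; last first.
  by move=> i; apply: integrable_EFin_sum => // j; exact: gg_int.
congr EFin; apply: eq_bigr => i _.
rewrite /Rintegral integral_EFin_sum//=; apply: eq_bigr => j _.
have [tl lh hs fi] := adphi i; have [tl' lh' hs' fj] := adphi j.
rewrite RintegralZr//; last exact: sq_integrable_mul.
by rewrite (incr_pair refOm)// ?(le_trans hs)// (le_trans hs').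
Qed.

Let c_measurable i : measurable_fun setT
  (fun z : (measurableTypeR R * Om)%type => c i z.1 z.2).
Proof.
apply: measurable_funM.
  have m1 : measurable_fun setT (\1_(`]ep_lo i, ep_hi i]) : measurableTypeR R -> R).
    exact: measurable_indic.
  exact: (measurableT_comp m1 measurable_fst).
have m2 : measurable_fun setT (\1_(ep_event i) : Om -> R).
  exact: measurable_indic.
exact: (measurableT_comp m2 measurable_snd).
Qed.

Lemma ep_gram_measurable : measurable_fun setT
  (fun z : (measurableTypeR R * Om)%type => ep_gram z.1 z.2).
Proof.
apply: measurable_sum => i; apply: measurable_sum => j.
by do 3! [apply: measurable_funM => //].
Qed.

Let indic_overlap (i j : I) :
  (\int[mu]_(r in `[t, s])
     ((\1_(`]ep_lo i, ep_hi i]) r : R) * (\1_(`]ep_lo j, ep_hi j]) r : R))%:E =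
   (overlap (ep_lo i) (ep_hi i) (ep_lo j) (ep_hi j))%:E)%E.
Proof.
have [tl lh hs _] := adphi i; have [tl' lh' hs' _] := adphi j.
under eq_integral do rewrite -/((\1__ \* \1__)%R _) -indicI.
rewrite integral_indic//; last exact: measurableI.
rewrite (_ : _ `&` _ `&` `[t, s] = `]Num.max (ep_lo i) (ep_lo j), Num.min (ep_hi i) (ep_hi j)]%classic).
  apply: eq_trans; first exact: lebesgue_measure_itv.
  rewrite /= lte_fin /overlap.
  set v := Num.max _ _; set u := Num.min _ _.
  case: ltP => h; first by rewrite [Num.max 0 _]max_r// subr_ge0 ltW.
  by rewrite [Num.max 0 _]max_l// subr_le0.
apply/seteqP; split=> r /=; rewrite !in_itv/= gt_max le_min.
  by move=> [[/andP[-> ->] /andP[-> ->]]].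
move=> /andP[/andP[h1 h2] /andP[h3 h4]]; rewrite h1 h2 h3 h4; split=> //.
by apply/andP; split; [exact: le_trans tl (ltW h1)|exact: le_trans h3 hs].
Qed.

Let cc_int w i j : mu.-integrable `[t, s] (EFin \o (fun r =>
  c i r w * c j r w * inner (ep_xi i) (ep_xi j) * inner (ep_h i) (ep_h j))).
Proof.
apply: (@measurable_bounded_integrable _ _ _ mu) => //.
- by rewrite /= lebesgue_measure_itv/=; case: ifPn => // _; rewrite -EFinB ltry.
- apply: measurable_funM => //; apply: measurable_funM => //.
  apply: measurable_funM; apply: measurable_funM => //;
  by apply: measurable_funTS; exact: measurable_indic.
- exists (`|inner (ep_xi i) (ep_xi j) * inner (ep_h i) (ep_h j)|); split; first exact: num_real.
  move=> x hx r _ /=; rewrite -mulrA normrM (le_trans _ (ltW hx))// ler_piMl//.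
  rewrite /c !normrM.
  have nI (U : Type) (A : set U) y : `|\1_A y : R| <= 1.
    by rewrite indicE; case: (_ \in _); rewrite ?normr1 ?normr0.
  by rewrite !mulr_ile1.
Qed.

Let cc_Rint w i j : \int[mu]_(r in `[t, s])
    (c i r w * c j r w * inner (ep_xi i) (ep_xi j) * inner (ep_h i) (ep_h j)) =
  \1_(ep_event i `&` ep_event j) w *
    (inner (ep_xi i) (ep_xi j) * overlap (ep_lo i) (ep_hi i) (ep_lo j) (ep_hi j) *
     inner (ep_h i) (ep_h j)).
Proof.
pose k := \1_(ep_event i `&` ep_event j) w * inner (ep_xi i) (ep_xi j) * inner (ep_h i) (ep_h j).
transitivity (\int[mu]_(r in `[t, s]) (k *
  ((\1_(`]ep_lo i, ep_hi i]) r : R) * (\1_(`]ep_lo j, ep_hi j]) r : R)))).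
  by apply: eq_Rintegral => r _; rewrite /k /c indicI /=; ring.
rewrite RintegralZl//.
  by rewrite /Rintegral indic_overlap /= /k; ring.
apply/integrableP; split.
  by apply/measurable_EFinP/measurable_funM; apply: measurable_funTS; exact: measurable_indic.
under eq_integral do rewrite /= ger0_norm ?mulr_ge0//.
by rewrite indic_overlap ltry.
Qed.

Let ep_gram_integral :
  (\int[P]_w \int[mu]_(r in `[t, s]) (ep_gram r w)%:E = K%:E)%E.
Proof.
under eq_integral.
  move=> w _; rewrite integral_EFin_sum//; last first.
    by move=> i; apply: integrable_EFin_sum => // j; exact: cc_int.
  under eq_bigr do rewrite /Rintegral integral_EFin_sum//=.
  under eq_bigr do under eq_bigr do rewrite cc_Rint.
  over.
have ii (i j : I) k : P.-integrable setT (EFin \o (fun w : Om =>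
    \1_(ep_event i `&` ep_event j) w * k)).
  have mij : measurable (ep_event i `&` ep_event j) by exact: measurableI.
  exact: (integrableZr measurableT k (integrable_indic P mij)).
rewrite integral_EFin_sum//; last first.
  by move=> i; apply: integrable_EFin_sum => // j; exact: ii.
congr EFin; apply: eq_bigr => i _.
rewrite /Rintegral integral_EFin_sum//=; apply: eq_bigr => j _.
have mij : measurable (ep_event i `&` ep_event j) by exact: measurableI.
rewrite RintegralZr//; last exact: (integrable_indic P mij).
by rewrite /Rintegral integral_indic// setIT !mulrA.
Qed.

(** Both sides expand into the double sum [K]: the left through the covariances [incr_pair], the
    right by integrating products of indicators over time and then over the probability space. *)
Lemma ep_integral_isometry :
  (\int[P]_w (`|ep_integral phi w| ^+ 2)%:E =
   \int[P]_w \int[mu]_(r in `[t, s]) (ep_gram r w)%:E)%E.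
Proof. by rewrite ep_integral_sq ep_gram_integral. Qed.

End ElementaryIsometry.

Section ElementarySubtraction.
Variables (R : realType) (Xi H : hilbertType R) (Om : ref_space Xi) (t s : R).
Variables (phi psi : elem_process H Om).

Let cat (U : Type) (f : 'I_(ep_size phi) -> U) (g : 'I_(ep_size psi) -> U)
    (i : 'I_(ep_size phi + ep_size psi)) : U :=
  match fintype.split i with inl j => f j | inr j => g j end.

(** Concatenation of the summands with the vectors of [psi] negated. It allows the isometry to be
    applied to the difference of two approximations. *)
Definition ep_sub : elem_process H Om := ElemProcess
  (cat (@ep_lo _ _ _ _ phi) (@ep_lo _ _ _ _ psi))
  (cat (@ep_hi _ _ _ _ phi) (@ep_hi _ _ _ _ psi))
  (cat (@ep_event _ _ _ _ phi) (@ep_event _ _ _ _ psi))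
  (cat (@ep_xi _ _ _ _ phi) (@ep_xi _ _ _ _ psi))
  (cat (@ep_h _ _ _ _ phi) (fun j => - ep_h j)).

Let catl U (f : _ -> U) g i : cat f g (lshift _ i) = f i.
Proof. by rewrite /cat; case: splitP => [j|k] /= e; [congr f; exact/val_inj|have := ltn_ord i; rewrite e ltnNge leq_addr]. Qed.

Let catr U (f : _ -> U) g i : cat f g (rshift _ i) = g i.
Proof.
rewrite /cat; case: splitP => [j|k] /= e.
  by have := ltn_ord j; rewrite -e ltnNge leq_addr.
by congr g; apply/val_inj/esym; move/addnI : e.
Qed.

Lemma ep_sub_val r w x : ep_val ep_sub r w x = ep_val phi r w x - ep_val psi r w x.
Proof.
rewrite /ep_val /= big_split_ord /=; congr (_ + _).
  by apply: eq_bigr => i _; rewrite !catl.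
by rewrite -sumrN; apply: eq_bigr => i _; rewrite !catr scalerN.
Qed.

Lemma ep_sub_integral w : ep_integral ep_sub w = ep_integral phi w - ep_integral psi w.
Proof.
rewrite /ep_integral /= big_split_ord /=; congr (_ + _).
  by apply: eq_bigr => i _; rewrite !catl.
by rewrite -sumrN; apply: eq_bigr => i _; rewrite !catr scalerN.
Qed.

Lemma ep_sub_adapted : ep_adapted t s phi -> ep_adapted t s psi ->
  ep_adapted t s ep_sub.
Proof.
by move=> aphi apsi i; rewrite /= /cat; case: splitP => j _; [exact: aphi|exact: apsi].
Qed.

End ElementarySubtraction.

(** * Bochner integrals *)

Lemma cvge0_near_le (R : realType) (u : nat -> \bar R) (e : R) : 0 < e ->
  u n @[n --> \oo] --> 0%E -> \forall n \near \oo, (u n <= e%:E)%E.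
Proof.
move=> e0 /(_ [set y | (y < e%:E)%E]) h.
have : nbhs (0%E : \bar R) [set y | (y < e%:E)%E].
  by apply: open_ereal_lt'; rewrite lte_fin.
move=> /h {}h; apply: (filterS _ (h : \forall n \near \oo, (u n < e%:E)%E)).
by move=> n; exact: ltW.
Qed.

Section BochnerEstimate.
Variables (R : realType) (H : hilbertType R) (t s : R).
Local Notation mu := (@lebesgue_measure R).
Local Notation D := (`[t, s]%classic : set (measurableTypeR R)).

Lemma integrable_indic_segment (A : set (measurableTypeR R)) (k : R) :
  measurable A -> mu.-integrable D (fun r => ((\1_A r : R) * k)%:E).
Proof.
move=> mA; apply: (@measurable_bounded_integrable _ _ _ mu) => //.
- by rewrite /= lebesgue_measure_itv/=; case: ifPn => // _; rewrite -EFinB ltry.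
- by apply: measurable_funM => //; apply: measurable_funTS; exact: measurable_indic.
- exists `|k|; split; first exact: num_real.
  move=> x hx r _ /=; rewrite normrM (le_trans _ (ltW hx))// ler_piMl//.
  by rewrite indicE; case: (_ \in _); rewrite ?normr1 ?normr0.
Qed.

Lemma inner_sm_val_integrable (phi : simple_map H) z :
  mu.-integrable D (fun r => (inner (sm_val phi r) z)%:E).
Proof.
have -> : (fun r => (inner (sm_val phi r) z)%:E) = (fun r => (\sum_(i < sm_size phi)
    (\1_(sm_set (s := phi) i) r : R) * inner (sm_vec i) z)%:E).
  apply/funext => r; rewrite /sm_val inner_suml; congr EFin.
  by apply: eq_bigr => i _; rewrite innerZl.
apply: integrable_EFin_sum => // i.
by apply: integrable_indic_segment; exact: sm_measurable.
Qed.

Lemma inner_sm_integral (phi : simple_map H) z :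
  (\int[mu]_(r in D) (inner (sm_val phi r) z)%:E = (inner (sm_integral D phi) z)%:E)%E.
Proof.
transitivity (\int[mu]_(r in D) (\sum_(i < sm_size phi)
    (\1_(sm_set (s := phi) i) r : R) * inner (sm_vec i) z)%:E)%E.
  apply: eq_integral => r _; rewrite /sm_val inner_suml; congr EFin.
  by apply: eq_bigr => i _; rewrite innerZl.
rewrite integral_EFin_sum//; last first.
  by move=> i; apply: integrable_indic_segment; exact: sm_measurable.
congr EFin; rewrite /sm_integral inner_suml; apply: eq_bigr => i _.
rewrite innerZl.
have mA := sm_measurable i.
rewrite RintegralZr//; first by rewrite /Rintegral integral_indic.
rewrite (_ : EFin \o _ = (fun r => ((\1_(sm_set (s := phi) i) r : R) * 1)%:E)).
  exact: integrable_indic_segment.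
by apply/funext => r /=; rewrite mulr1.
Qed.

(** Both integrals are approximated by integrals of simple maps and tested against z = y1 - y2,
    which reduces the claim to real integrals. [is_bochner] supplies measurability for distances to
    simple maps, so |f1 - f2| enters through the measurable majorant G. *)
Lemma is_bochner_dist_le (f1 f2 : R -> H) (y1 y2 : H) (G : R -> R) :
  is_bochner D f1 y1 -> is_bochner D f2 y2 ->
  measurable_fun D (G : measurableTypeR R -> R) ->
  (forall r, r \in `[t, s] -> `|f1 r - f2 r| <= G r) ->
  (`|y1 - y2|%:E <= \int[mu]_(r in D) (G r)%:E)%E.
Proof.
move=> [p1 [m1 c1 l1]] [p2 [m2 c2 l2]] mG fG.
have G0 r : D r -> (0 <= (G r)%:E)%E.
  by move=> Dr; rewrite lee_fin (le_trans _ (fG r _)).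
have [->|y0] := eqVneq (y1 - y2) 0; first by rewrite normr0; exact: integral_ge0.
have ny0 : 0 < `|y1 - y2| by rewrite normr_gt0.
apply/lee_addgt0Pr => e e0.
(* Four approximation errors are paid: two of integrands in mean and two of integrals in norm. *)
pose q := e / 4; have q0 : 0 < q by rewrite divr_gt0.
have small (p : nat -> simple_map H) f :
    (\int[mu]_(r in D) (`|f r - sm_val (p n) r|)%:E)%E @[n --> \oo] --> 0%E ->
    \forall n \near \oo, (\int[mu]_(r in D) (`|f r - sm_val (p n) r|)%:E <= q%:E)%E.
  exact: cvge0_near_le.
have close (u : nat -> H) y : u @ \oo --> y -> \forall n \near \oo, `|y - u n| < q.
  by move=> /cvgrPdist_lt/(_ _ q0).
have [n [[]]] : exists n, [/\ (\int[mu]_(r in D) (`|f1 r - sm_val (p1 n) r|)%:E <= q%:E)%E,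
    (\int[mu]_(r in D) (`|f2 r - sm_val (p2 n) r|)%:E <= q%:E)%E,
    `|y1 - sm_integral D (p1 n)| < q & `|y2 - sm_integral D (p2 n)| < q].
  have h1 := small _ _ c1; have h2 := small _ _ c2.
  have h3 := close _ _ l1; have h4 := close _ _ l2.
  near \oo => n; exists n; split; near: n.
  - exact: h1.
  - exact: h2.
  - exact: h3.
  - exact: h4.
move=> i1 i2 d1 d2; have m1n := m1 n; have m2n := m2 n.
set z := y1 - y2 in y0 ny0 *.
pose U r := `|f1 r - sm_val (p1 n) r| + `|f2 r - sm_val (p2 n) r| + G r.
have mU : measurable_fun D (EFin \o U).
  by apply/measurable_EFinP/measurable_funD => //; exact: measurable_funD.
have key : ((inner (sm_integral D (p1 n) - sm_integral D (p2 n)) z)%:E <=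
    `|z|%:E * \int[mu]_(r in D) (U r)%:E)%E.
  rewrite innerBl EFinB -!inner_sm_integral -integralB//; last 2 first.
  - exact: inner_sm_val_integrable.
  - exact: inner_sm_val_integrable.
  apply: (le_trans (lee_abs _)).
  have mI (p : simple_map H) : measurable_fun D (fun r => (inner (sm_val p r) z)%:E).
    exact: measurable_int (inner_sm_val_integrable p z).
  have mB : measurable_fun D (fun r => (inner (sm_val (p1 n) r) z)%:E -
      (inner (sm_val (p2 n) r) z)%:E)%E by exact: emeasurable_funB.
  apply: (le_trans (le_abse_integral _ _ mB)) => //.
  rewrite -ge0_integralZl//; last first.
    by move=> r Dr; rewrite lee_fin !addr_ge0// -lee_fin G0.
  apply: ge0_le_integral => //.
  - exact: measurableT_comp.
  - by apply: emeasurable_funM.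
  - move=> r Dr; rewrite -EFinB -innerBl abse_EFin lee_fin.
    apply: (le_trans (cauchy_schwarz _ _)); rewrite mulrC ler_wpM2l// /U.
    rewrite (_ : _ - _ = (f1 r - f2 r) - (f1 r - sm_val (p1 n) r) +
      (f2 r - sm_val (p2 n) r)); last first.
      by rewrite opprB [f1 r - f2 r + _]addrC !subrKA.
    have h1 := ler_normD ((f1 r - f2 r) - (f1 r - sm_val (p1 n) r)) (f2 r - sm_val (p2 n) r).
    have h2 := ler_normB (f1 r - f2 r) (f1 r - sm_val (p1 n) r).
    by have h3 := fG r Dr; lra.
rewrite /U in key.
have IG : (\int[mu]_(r in D) (`|f1 r - sm_val (p1 n) r| + `|f2 r - sm_val (p2 n) r| + G r)%:E
    <= (2 * q)%:E + \int[mu]_(r in D) (G r)%:E)%E.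
  under eq_integral do rewrite !EFinD.
  rewrite !ge0_integralD//; try by [apply/measurable_EFinP|
    apply: emeasurable_funD; apply/measurable_EFinP|
    move=> r _; rewrite adde_ge0].
  rewrite leeD2r// (_ : 2 * q = q + q); last by ring.
  by rewrite EFinD leeD.
have IG0 : (0 <= \int[mu]_(r in D) (G r)%:E)%E by exact: integral_ge0.
case: (\int[mu]_(r in D) (G r)%:E)%E IG IG0 => [g||] // IG _; last first.
  by rewrite /= leey.
rewrite -EFinD lee_fin.
have {}key : inner (sm_integral D (p1 n) - sm_integral D (p2 n)) z <= `|z| * (2 * q + g).
  rewrite -lee_fin; apply: (le_trans key); rewrite EFinM lee_wpmul2l ?lee_fin//.
have zz : `|z| ^+ 2 <= `|z| * (g + e).
  have h1 := cauchy_schwarz (y1 - sm_integral D (p1 n)) z.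
  have h2 := cauchy_schwarz (y2 - sm_integral D (p2 n)) z.
  have h3 : `|z| ^+ 2 = inner (y1 - sm_integral D (p1 n)) z - inner (y2 - sm_integral D (p2 n)) z
      + inner (sm_integral D (p1 n) - sm_integral D (p2 n)) z.
    by rewrite -inner_norm {1}/z !innerBl; ring.
  have h4 := ler_wpM2r (ltW ny0) (ltW d1).
  have h5 := ler_wpM2r (ltW ny0) (ltW d2).
  have h6 := ler_norm (inner (y1 - sm_integral D (p1 n)) z).
  have h7 := ler_norm (- inner (y2 - sm_integral D (p2 n)) z).
  rewrite normrN in h7.
  have -> : e = 4 * q by rewrite /q; field.
  lra.
by move: zz; rewrite expr2 ler_pM2l.
Unshelve. all: by end_near. Qed.

End BochnerEstimate.

(** * Joint measurability of processes *)

Lemma separable_sequence (R : realType) (V : normedModType R) : separable V ->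
  exists e : nat -> V, forall x (eps : R), 0 < eps -> exists k, `|x - e k| < eps.
Proof.
move=> [D /countable_injP[f finj] dD].
exists (fun k => xget 0 [set d | D d /\ f d = k]) => x eps eps0.
have [d Dd xd] := dense_normP dD x eps0.
exists (f d); suff -> : xget 0 [set d' | D d' /\ f d' = f d] = d by [].
have [d'D fd'] : [set d' | D d' /\ f d' = f d] (xget 0 [set d' | D d' /\ f d' = f d]).
  by apply: (@xgetPex _ 0 [set d' | D d' /\ f d' = f d]); exists d.
by apply: finj => //; rewrite inE.
Qed.

Section OpenMeasurable.
Context dp (S : measurableType dp) (R : realType).

(* Borel measurability tested on open sets, as V need not be a measurableType. *)
Definition open_measurable_fun (V : topologicalType) (f : S -> V) :=
  forall O : set V, open O -> measurable (f @^-1` O).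

Lemma open_measurable_realP (f : S -> R) :
  open_measurable_fun f -> measurable_fun setT f.
Proof.
move=> mf; apply: (measurability _ (RGenOpens.measurableE R)).
by move=> _ [_ [a [b ->] <-]]; rewrite setTI; apply/mf/interval_open.
Qed.

Lemma open_measurable_comp (V : topologicalType) (f : S -> V) (g : V -> R) :
  open_measurable_fun f -> continuous g -> measurable_fun setT (g \o f).
Proof.
move=> mf cg; apply: open_measurable_realP => O oO.
by rewrite comp_preimage; apply: mf; move/continuousP : cg; exact.
Qed.

Variables (U V : normedModType R).

(** By separability an open subset of the product is a countable union of products of balls with
    centres in dense sequences and radii 1 / (n + 1), and preimages of such products are
    measurable. *)
Lemma open_measurable_pair (f : S -> U) (g : S -> V) :
  separable U -> separable V ->
  open_measurable_fun f -> open_measurable_fun g ->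
  open_measurable_fun (fun w => (f w, g w)).
Proof.
move=> /separable_sequence[u uP] /separable_sequence[v vP] mf mg O oO.
pose r n : R := n.+1%:R^-1.
pose A k l n := f @^-1` ball (u k) (r n) `&` g @^-1` ball (v l) (r n).
rewrite (_ : _ @^-1` _ = \bigcup_k \bigcup_l \bigcup_(n in
    [set n | ball (u k) (r n) `*` ball (v l) (r n) `<=` O]) A k l n).
  apply: bigcupT_measurable => k; apply: bigcupT_measurable => l.
  apply: bigcup_measurable => n _.
  by apply: measurableI; [apply: mf|apply: mg]; exact: ball_open.
apply/seteqP; split=> [w /= Ow|w [k _ [l _ [n AO [h1 h2]]]]]; last by apply: AO; split.
have [e /= e0 eO] : nbhs_ball (f w, g w) O.
  by rewrite nbhs_ballE; exact: open_nbhs_nbhs.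
pose n := Num.truncn (2 / e).
have rn : r n < e / 2.
  rewrite -[e / 2]invrK invf_div ltf_pV2 ?posrE ?divr_gt0//.
  exact: truncnS_gt.
have rn0 : 0 < r n by rewrite invr_gt0.
have [k uk] := uP (f w) _ rn0; have [l vl] := vP (g w) _ rn0.
exists k => //; exists l => //; exists n => /=; last first.
  by split; rewrite /= -ball_normE /= distrC.
move=> [x y] /= [xk yl]; apply: eO.
split=> /=; rewrite -ball_normE /=.
- move: xk; rewrite -ball_normE /= => xk.
  have := ler_distD (u k) (f w) x; lra.
- move: yl; rewrite -ball_normE /= => yl.
  have := ler_distD (v l) (g w) y; lra.
Qed.

(** An open set is a countable union of balls centred on a dense sequence, and the preimage of a
    ball is a sublevel set of a distance. *)
Lemma open_measurable_dist (f : S -> V) : separable V ->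
  (forall x, measurable_fun setT (fun w => `|f w - x|)) -> open_measurable_fun f.
Proof.
move=> /separable_sequence[v vP] mf O oO.
pose r n : R := n.+1%:R^-1.
rewrite (_ : _ @^-1` _ = \bigcup_k \bigcup_(n in
    [set n | ball (v k) (r n) `<=` O]) [set w | `|f w - v k| < r n]).
  apply: bigcupT_measurable => k; apply: bigcup_measurable => n _.
  rewrite -[X in measurable X]setTI.
  rewrite (_ : [set w | _] = (fun w => `|f w - v k|) @^-1` `]-oo, r n[).
    exact: mf.
  by apply/seteqP; split=> w /=; rewrite in_itv.
apply/seteqP; split=> [w /= Ow|w [k _ [n kO /= h]]]; last first.
  by apply: kO; rewrite -ball_normE /= distrC.
have [e /= e0 eO] : nbhs_ball (f w) O by rewrite nbhs_ballE; exact: open_nbhs_nbhs.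
pose n := Num.truncn (2 / e).
have rn : r n < e / 2.
  rewrite -[e / 2]invrK invf_div ltf_pV2 ?posrE ?divr_gt0//.
  exact: truncnS_gt.
have rn0 : 0 < r n by rewrite invr_gt0.
have [k vk] := vP (f w) _ rn0.
exists k => //; exists n => //= x.
rewrite -ball_normE /= => vx; apply: eO; rewrite -ball_normE /=.
by have := ler_distD (v k) (f w) x; lra.
Qed.

(** Meant for the running cost, whose continuity is only assumed on states paired with controls in
    [Lam0]. *)
Lemma within_open_measurable (f : S -> U) (Q : set U) (h : U -> R) :
  (forall w, Q (f w)) -> open_measurable_fun f -> {within Q, continuous h} ->
  measurable_fun setT (h \o f).
Proof.
move=> fQ mf ch; apply: open_measurable_realP => O oO.
move/continuousP : ch => /(_ O oO) /open_subspaceP[W oW WQ].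
rewrite (_ : _ @^-1` O = f @^-1` W); first exact: mf.
apply/seteqP; split=> w /= h1.
  by have : (h @^-1` O `&` Q) (f w) by []; rewrite -WQ => -[].
by have : (W `&` Q) (f w) by []; rewrite WQ => -[].
Qed.

End OpenMeasurable.

Section Clamp.
Variables (R : realType) (t T : R).
Hypothesis tT : t <= T.

(* Processes only matter on [t, T]; clamping the time makes them jointly measurable
   on the whole line. *)
Definition clamp (s : R) : R := Num.max t (Num.min s T).

Lemma clamp_itv s : t <= clamp s <= T.
Proof. by rewrite /clamp le_max lexx /= ge_max tT ge_min lexx orbT. Qed.

Lemma clamp_id s : t <= s <= T -> clamp s = s.
Proof. by move=> /andP[ts sT]; rewrite /clamp (min_l sT) max_r. Qed.

Lemma measurable_clamp : measurable_fun setT (clamp : measurableTypeR R -> measurableTypeR R).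
Proof. by apply: measurable_maxr => //; exact: measurable_minr. Qed.

Context dp (S : measurableType dp).

(* Approximate a continuous path by its values at the nodes t + k / (n + 1). *)
Lemma caratheodory_measurable (Y : R -> S -> R) :
  (forall s, t <= s <= T -> measurable_fun setT (Y s)) ->
  (forall w, {within `[t, T], continuous (fun s => Y s w)}) ->
  measurable_fun setT (fun z : (measurableTypeR R * S)%type => Y (clamp z.1) z.2).
Proof.
move=> mY cY.
pose u n s : R := (clamp s - t) * n.+1%:R.
pose node n k : R := clamp (t + k%:R / n.+1%:R).
have u0 n s : 0 <= u n s.
  by rewrite mulr_ge0// subr_ge0; have /andP[] := clamp_itv s.
have mu n : measurable_fun setT (u n : measurableTypeR R -> measurableTypeR R).
  by apply: measurable_funM => //; apply: measurable_funB => //; exact: measurable_clamp.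
pose q n s := node n (Num.truncn (u n s)).
have qE n s : `|q n s - clamp s| <= n.+1%:R^-1 /\ t <= q n s <= T.
  split; last exact: clamp_itv.
  have /andP[h1 h2] := truncn_itv (u0 n s).
  have n0 : 0 < n.+1%:R :> R by [].
  have /andP[c1 c2] := clamp_itv s.
  have e1 : (Num.truncn (u n s))%:R / n.+1%:R <= clamp s - t by rewrite ler_pdivrMr.
  have e2 : clamp s - t <= (Num.truncn (u n s))%:R / n.+1%:R + n.+1%:R^-1.
    rewrite -{2}[n.+1%:R^-1]mul1r -mulrDl natr1 ler_pdivlMr//; exact: ltW.
  have e3 : 0 <= (Num.truncn (u n s))%:R / n.+1%:R :> R by rewrite divr_ge0.
  rewrite /q /node; move: e1 e2 e3.
  move: ((Num.truncn (u n s))%:R / n.+1%:R : R) (n.+1%:R^-1 : R) => a v e1 e2 e3.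
  rewrite clamp_id; last by apply/andP; split; lra.
  by rewrite ler_norml; apply/andP; split; lra.
apply: (measurable_fun_cvg (h := fun n (z : (measurableTypeR R * S)%type) =>
    Y (q n z.1) z.2)) => //.
- move=> n; move=> _ C mC; rewrite setTI.
  (* Where the index of the node is k the approximation is a single random variable, so preimages
     are countable unions of rectangles. *)
  rewrite (_ : _ @^-1` _ = \bigcup_k ((u n @^-1` `[k%:R, k.+1%:R[) `*`
      (Y (node n k) @^-1` C))).
    apply: bigcupT_measurable => k; apply: measurableX.
      by rewrite -[X in measurable X]setTI; exact: mu.
    by rewrite -[X in measurable X]setTI; apply: mY => //; exact: clamp_itv.
  apply/seteqP; split=> [[s w] /= h|[s w] [k _ [/= + h]]].
    exists (Num.truncn (u n s)) => //; split=> //=.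
    by rewrite in_itv /=; exact: truncn_itv.
  rewrite in_itv /= => uk; rewrite /q.
  by have -> : Num.truncn (u n s) = k by apply: truncn_def.
- move=> [s w] _ /=; have cs := clamp_itv s.
  have /subspace_continuousP/(_ (clamp s)) := cY w.
  rewrite /= in_itv /= => /(_ cs) cvY.
  apply/cvgrPdist_lt => e e0.
  move/cvgrPdist_lt : cvY => /(_ e e0); rewrite near_withinE => /nbhs_normP[d /= d0 dP].
  exists (Num.truncn d^-1) => // n /= nd.
  have [h1 h2] := qE n s.
  apply: dP; last by rewrite in_itv.
  rewrite /= distrC (le_lt_trans h1)// -[d]invrK ltf_pV2 ?posrE ?invr_gt0//.
  by rewrite (lt_le_trans (truncnS_gt _))// ler_nat ltnS.
Qed.

End Clamp.

(** * Cauchy-Schwarz in time and Gronwall's inequality *)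

Section GronwallLemma.
Variables (R : realType).
Local Notation mu := (@lebesgue_measure R).

Lemma lebesgue_measure_segment (a b : R) : a <= b ->
  (mu (`[a, b]%classic : set (measurableTypeR R)) = (b - a)%:E)%E.
Proof.
move=> ab; apply: eq_trans; first exact: lebesgue_measure_itv.
rewrite /= lte_fin; case: ltP => h; first by rewrite EFinB.
by have -> : a = b; [apply/eqP; rewrite eq_le ab h|rewrite subrr].
Qed.

Lemma integral_exp_segment_le (k a b : R) : 0 < k -> a <= b ->
  (\int[mu]_(r in `[a, b]) (expR (k * (r - a)))%:E <= (expR (k * (b - a)) / k)%:E)%E.
Proof.
move=> k0; rewrite le_eqVlt => /predU1P[<-|ab].
  rewrite set_itv1 integral_set1 lee_fin divr_ge0 ?expR_ge0//; exact: ltW.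
pose F (r : R) : R := k^-1 * expR (k * (r - a)).
have dF (r : R) : is_derive r (1 : R) F (expR (k * (r - a))).
  apply: is_derive_eq; rewrite /GRing.scale /= !(mulr1, subr0, mulr0, add0r).
  by field; rewrite gt_eqF.
have cF : continuous F.
  move=> r; apply: differentiable_continuous; apply/derivable1_diffP.
  by have [] := dF r.
rewrite (@continuous_FTC2 _ _ F a b)//.
- rewrite -EFinB lee_fin /F subrr mulr0 expR0 mulr1.
  by rewrite mulrC gerBl invr_ge0 ltW.
- apply: continuous_subspaceT => r.
  apply: continuous_comp; last exact: continuous_expR.
  by apply: cvgM; [exact: cvg_cst|apply: cvgB; [exact: cvg_id|exact: cvg_cst]].
- split.
  + by move=> x _; have [] := dF x.
  + by apply: cvg_at_right_filter; exact: cF.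
  + by apply: cvg_at_left_filter; exact: cF.
- by move=> x _; rewrite derive1E; have [_ ->] := dF x.
Qed.

(** Integrate 2 G <= lam + G^2 / lam and take lam to be the mean of G over the interval. When the
    integral of G^2 is finite, lam = 1 already excludes an infinite integral of G. *)
Lemma integral_sq_le (t s : R) (G : measurableTypeR R -> R) : t <= s ->
  measurable_fun `[t, s] G -> (forall r, r \in `[t, s] -> 0 <= G r) ->
  ((\int[mu]_(r in `[t, s]) (G r)%:E) * (\int[mu]_(r in `[t, s]) (G r)%:E) <=
    (s - t)%:E * \int[mu]_(r in `[t, s]) (G r ^+ 2)%:E)%E.
Proof.
rewrite le_eqVlt => /predU1P[<- _ _|ts mG G0].
  by rewrite !set_itv1 !integral_set1 mul0e mule0.
have L0 : 0 < s - t by rewrite subr_gt0.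
have mG2 : measurable_fun `[t, s] (fun r => G r ^+ 2) by exact: measurable_funX.
have amgm (lam : R) : 0 < lam -> (2%:E * \int[mu]_(r in `[t, s]) (G r)%:E <=
    (lam * (s - t))%:E + lam^-1%:E * \int[mu]_(r in `[t, s]) (G r ^+ 2)%:E)%E.
  move=> lam0; have li0 : 0 <= lam^-1 by rewrite invr_ge0 ltW.
  rewrite EFinM -(lebesgue_measure_segment (ltW ts)) -integral_cst//.
  rewrite -!ge0_integralZl//; try by [apply/measurable_EFinP|
    move=> r Dr; rewrite lee_fin ?sqr_ge0 ?G0].
  rewrite -ge0_integralD//; try by [
    move=> r _; rewrite ?lee_fin ltW|
    move=> r _; rewrite -EFinM lee_fin mulr_ge0// sqr_ge0|
    apply/measurable_EFinP/measurable_funM].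
  apply: ge0_le_integral => //.
  - by move=> r Dr; rewrite -EFinM lee_fin mulr_ge0// G0.
  - by apply/measurable_EFinP/measurable_funM.
  - by apply/measurable_EFinP/measurable_funD => //; exact: measurable_funM.
  move=> r _; rewrite -!EFinM -EFinD lee_fin.
  have := mulr_ge0 li0 (sqr_ge0 (G r - lam)).
  rewrite (_ : lam^-1 * _ = lam + lam^-1 * G r ^+ 2 - 2 * G r); last first.
    by field; rewrite gt_eqF.
  by rewrite subr_ge0.
have I0 : (0 <= \int[mu]_(r in `[t, s]) (G r ^+ 2)%:E)%E.
  by apply: integral_ge0 => r _; rewrite lee_fin sqr_ge0.
have g0 : (0 <= \int[mu]_(r in `[t, s]) (G r)%:E)%E.
  by apply: integral_ge0 => r Dr; rewrite lee_fin G0.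
case: (\int[mu]_(r in `[t, s]) (G r ^+ 2)%:E)%E amgm I0 => [I amgm| _ _|_];
  last 2 first.
- by rewrite gt0_muley ?lte_fin// leey.
- by rewrite leNgt ltNyr.
rewrite lee_fin => I0.
case: (\int[mu]_(r in `[t, s]) (G r)%:E)%E amgm g0 => [g amgm|amgm _|_];
  last 2 first.
- have := amgm 1 ltr01.
  by rewrite gt0_muley ?lte_fin// -!EFinM -EFinD.
- by rewrite leNgt ltNyr.
rewrite lee_fin le_eqVlt => /predU1P[<-|g0].
  by rewrite -!EFinM lee_fin mul0r mulr_ge0// ltW.
have := amgm (g / (s - t)) (divr_gt0 g0 L0).
rewrite -!EFinM -EFinD lee_fin divfK ?gt_eqF// invf_div => h.
rewrite lee_fin; have : g <= (s - t) / g * I by lra.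
by rewrite mulrAC ler_pdivlMr.
Qed.

(* Uses the supremum of m weighted by exp(- 2 K1 (s - t)). *)
Lemma gronwall (t T K0 K1 : R) (m : measurableTypeR R -> \bar R) : t <= T ->
  0 <= K0 -> 0 < K1 ->
  measurable_fun setT m -> (forall s, (0 <= m s)%E) ->
  (forall s, t <= s <= T ->
    (m s <= K0%:E + K1%:E * \int[mu]_(r in `[t, s]) m r)%E) ->
  (\int[mu]_(r in `[t, T]) m r < +oo)%E ->
  forall s, t <= s <= T -> (m s <= (2 * K0 * expR (2 * K1 * (T - t)))%:E)%E.
Proof.
move=> tT K00 K10 mm m0 mK mfin.
have IT0 : (0 <= \int[mu]_(r in `[t, T]) m r)%E by exact: integral_ge0.
(* A crude uniform bound from the integrability of m; it makes m finite on [t, T] and the weighted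
   supremum below a real number. *)
pose M := K0 + K1 * fine (\int[mu]_(r in `[t, T]) m r)%E.
have mM s : t <= s <= T -> (m s <= M%:E)%E.
  move=> tsT; apply: (le_trans (mK s tsT)).
  rewrite /M EFinD EFinM fineK ?ge0_fin_numE// leeD2l// lee_wpmul2l ?lee_fin ?(ltW K10)//.
  apply: ge0_subset_integral => //; first exact: measurable_funTS.
  move=> r /=; rewrite !in_itv /= => /andP[-> rs]; rewrite (le_trans rs)//.
  by have /andP[] := tsT.
have mfinn s : t <= s <= T -> m s \is a fin_num.
  by move=> tsT; rewrite ge0_fin_numE// (le_lt_trans (mM s tsT))// ltry.
(* At the rate k = 2 K1 the integral term contributes at most half of the supremum and is absorbed;
   this produces the factor 2 in front of K0. *)
pose k := 2 * K1; have k0 : 0 < k by rewrite mulr_gt0.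
pose u s := fine (m s) / expR (k * (s - t)).
pose A := [set u s | s in [set s | t <= s <= T]].
have A_sup : has_sup A.
  split; first by exists (u t), t => //=; rewrite lexx.
  exists M => _ [s /= tsT <-].
  rewrite /u ler_pdivrMr ?expR_gt0//.
  have h1 : fine (m s) <= M by rewrite -lee_fin fineK ?mfinn// mM.
  have h0 : 0 <= fine (m s) by exact: fine_ge0.
  have h2 : 1 <= expR (k * (s - t)).
    by rewrite -expR0 ler_expR mulr_ge0 ?(ltW k0)// subr_ge0; case/andP: tsT.
  by rewrite (le_trans h1)// ler_peMr// (le_trans h0).
have uS s : t <= s <= T -> u s <= sup A.
  by move=> tsT; apply: ub_le_sup; [exact: A_sup.2|exists s].
have S0 : 0 <= sup A.
  apply: (le_trans _ (uS t _)); last by rewrite lexx.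
  by rewrite /u divr_ge0 ?expR_ge0// fine_ge0.
have key s : t <= s <= T -> u s <= K0 + sup A / 2.
  move=> tsT; have /andP[ts sT] := tsT.
  rewrite /u ler_pdivrMr ?expR_gt0//.
  rewrite -lee_fin fineK ?mfinn//; apply: (le_trans (mK s tsT)).
  have le1 : (\int[mu]_(r in `[t, s]) m r <= (sup A * (expR (k * (s - t)) / k))%:E)%E.
    apply: (@le_trans _ _ (\int[mu]_(r in `[t, s]) ((sup A)%:E * (expR (k * (r - t)))%:E))%E).
      apply: ge0_le_integral => //.
      - exact: measurable_funTS.
      - apply/measurable_EFinP/measurable_funM => //.
        apply: measurable_funTS; apply: measurableT_comp => //.
        by apply: measurable_funM => //; exact: measurable_funB.
      - move=> r; rewrite /= in_itv /= => /andP[tr rs].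
        have trT : t <= r <= T by rewrite tr (le_trans rs).
        rewrite -EFinM -[m r]fineK ?mfinn// lee_fin -ler_pdivrMr ?expR_gt0//.
        exact: uS.
    rewrite ge0_integralZl//.
    - rewrite EFinM lee_wpmul2l// ?lee_fin//; exact: integral_exp_segment_le.
    - apply/measurable_EFinP/measurable_funTS; apply: measurableT_comp => //.
      by apply: measurable_funM => //; exact: measurable_funB.
  apply: (@le_trans _ _ (K0%:E + K1%:E * (sup A * (expR (k * (s - t)) / k))%:E)%E).
    by rewrite leeD2l// lee_wpmul2l// lee_fin ltW.
  rewrite -EFinM -EFinD lee_fin.
  have h2 : 1 <= expR (k * (s - t)).
    by rewrite -expR0 ler_expR mulr_ge0 ?(ltW k0)// subr_ge0.
  have -> : K1 * (sup A * (expR (k * (s - t)) / k)) = sup A / 2 * expR (k * (s - t)).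
    by rewrite /k; field; rewrite gt_eqF.
  by rewrite mulrDl lerD2r ler_peMr.
have S2 : sup A <= 2 * K0.
  have : sup A <= K0 + sup A / 2.
    by apply: ge_sup; [exact: A_sup.1|move=> _ [s tsT <-]; exact: key].
  lra.
move=> s tsT; rewrite -[m s]fineK ?mfinn// lee_fin.
have := le_trans (uS s tsT) S2; rewrite /u ler_pdivrMr ?expR_gt0// => h.
apply: (le_trans h); rewrite ler_wpM2l ?mulr_ge0// ler_expR ler_wpM2l ?(ltW k0)//.
by rewrite lerD2r; case/andP: tsT.
Qed.

End GronwallLemma.

(** * Iterated integrals over time and the probability space *)

Section DoubleIntegral.
Variables (R : realType).
Context dp (Om : measurableType dp) (P : probability Om R) (t s : R).
Local Notation mu := (@lebesgue_measure R).
Local Notation D := (`[t, s] `*` [set: Om] : set (measurableTypeR R * Om)%type).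
Implicit Types h : R -> Om -> \bar R.

Let mD : measurable D.
Proof. exact: measurableX. Qed.

Lemma section_measurable h w :
  measurable_fun D (fun z : (measurableTypeR R * Om)%type => h z.1 z.2) ->
  measurable_fun `[t, s] ((fun r => h r w) : measurableTypeR R -> \bar R).
Proof.
move=> mh; rewrite (_ : (fun r => h r w) = (fun z => h z.1 z.2) \o (pair^~ w))//.
apply: (measurable_comp mD) => //.
  by move=> _ [r /= rts <-].
by apply: measurable_funTS; exact: pair2_measurable.
Qed.

(** Integrands are measurable on the strip over [t, s] alone; extending them by zero gives functions
    on the whole product, to which Tonelli's theorem applies. *)
Let h_restr h : (fun z : measurableTypeR R * Om => h z.1 z.2) \_ D =
  (fun z : measurableTypeR R * Om => ((fun r => h r z.2) \_ `[t, s]) z.1).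
Proof.
apply/funext => -[r' w'] /=; rewrite !patchE /=; case: ifPn => [|].
  by rewrite inE => -[/= h1 _]; rewrite ifT// inE.
rewrite notin_setE => h1; rewrite ifF//; apply/negP; rewrite inE => h2.
by apply: h1; split.
Qed.

Let restr_measurable h :
  measurable_fun D (fun z : (measurableTypeR R * Om)%type => h z.1 z.2) ->
  measurable_fun setT (fun z : (measurableTypeR R * Om)%type =>
    ((fun r => h r z.2) \_ `[t, s]) z.1).
Proof.
by move=> /(measurable_restrictT _ mD); rewrite h_restr.
Qed.

Let restr_ge0 h : (forall r w, (0 <= h r w)%E) -> forall z : (measurableTypeR R * Om)%type,
  (0 <= ((fun r => h r z.2) \_ `[t, s]) z.1)%E.
Proof. by move=> h0 z; rewrite patchE; case: ifP. Qed.

Lemma segment_integral_measurable h : (forall r w, (0 <= h r w)%E) ->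
  measurable_fun D (fun z : (measurableTypeR R * Om)%type => h z.1 z.2) ->
  measurable_fun setT (fun w => \int[mu]_(r in `[t, s]) h r w)%E.
Proof.
move=> h0 mh.
under eq_fun do rewrite integral_mkcond.
exact: (measurable_fun_fubini_tonelli_G _ (restr_measurable mh) (restr_ge0 h0)).
Qed.

Lemma double_integral_swap h : (forall r w, (0 <= h r w)%E) ->
  measurable_fun D (fun z : (measurableTypeR R * Om)%type => h z.1 z.2) ->
  (\int[P]_w \int[mu]_(r in `[t, s]) h r w = \int[mu]_(r in `[t, s]) \int[P]_w h r w)%E.
Proof.
move=> h0 mh.
under eq_integral do rewrite integral_mkcond.
rewrite -(fubini_tonelli (m1 := mu) (m2 := P) _ (restr_measurable mh) (restr_ge0 h0)).
rewrite [RHS]integral_mkcond; apply: eq_integral => r _ /=.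
rewrite /fubini_F /= [RHS]patchE; case: ifPn => rts.
  by apply: eq_integral => w _; rewrite patchE rts.
by rewrite integral0_eq// => w _; rewrite patchE (negbTE rts).
Qed.

Lemma double_integral_le h1 h2 : (forall r w, (0 <= h1 r w)%E) ->
  (forall r w, (0 <= h2 r w)%E) ->
  measurable_fun D (fun z : (measurableTypeR R * Om)%type => h1 z.1 z.2) ->
  measurable_fun D (fun z : (measurableTypeR R * Om)%type => h2 z.1 z.2) ->
  (forall r w, r \in `[t, s] -> (h1 r w <= h2 r w)%E) ->
  (\int[P]_w \int[mu]_(r in `[t, s]) h1 r w <= \int[P]_w \int[mu]_(r in `[t, s]) h2 r w)%E.
Proof.
move=> h10 h20 m1 m2 h12; apply: ge0_le_integral => //.
- by move=> w _; exact: integral_ge0.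
- exact: segment_integral_measurable.
- exact: segment_integral_measurable.
- move=> w _; apply: ge0_le_integral => //.
  + exact: section_measurable.
  + exact: section_measurable.
  + by move=> r /= rts; apply: h12.
Qed.

Lemma double_integralD h1 h2 : (forall r w, (0 <= h1 r w)%E) ->
  (forall r w, (0 <= h2 r w)%E) ->
  measurable_fun D (fun z : (measurableTypeR R * Om)%type => h1 z.1 z.2) ->
  measurable_fun D (fun z : (measurableTypeR R * Om)%type => h2 z.1 z.2) ->
  (\int[P]_w \int[mu]_(r in `[t, s]) (h1 r w + h2 r w) =
   \int[P]_w \int[mu]_(r in `[t, s]) h1 r w + \int[P]_w \int[mu]_(r in `[t, s]) h2 r w)%E.
Proof.
move=> h10 h20 m1 m2.
transitivity (\int[P]_w (\int[mu]_(r in `[t, s]) h1 r w + \int[mu]_(r in `[t, s]) h2 r w))%E.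
  apply: eq_integral => w _; apply: ge0_integralD => //.
  - exact: section_measurable.
  - exact: section_measurable.
rewrite ge0_integralD//.
- by move=> w _; exact: integral_ge0.
- exact: segment_integral_measurable.
- by move=> w _; exact: integral_ge0.
- exact: segment_integral_measurable.
Qed.

Lemma double_integralZl h (k : R) : 0 <= k -> (forall r w, (0 <= h r w)%E) ->
  measurable_fun D (fun z : (measurableTypeR R * Om)%type => h z.1 z.2) ->
  (\int[P]_w \int[mu]_(r in `[t, s]) (k%:E * h r w) =
   k%:E * \int[P]_w \int[mu]_(r in `[t, s]) h r w)%E.
Proof.
move=> k0 h0 mh.
transitivity (\int[P]_w (k%:E * \int[mu]_(r in `[t, s]) h r w))%E.
  apply: eq_integral => w _; apply: ge0_integralZl => //.
  exact: section_measurable.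
rewrite ge0_integralZl//.
- exact: segment_integral_measurable.
- by move=> w _; exact: integral_ge0.
Qed.

Lemma double_integral_cst (k : R) : t <= s -> 0 <= k ->
  (\int[P]_w \int[mu]_(r in `[t, s]) k%:E = (k * (s - t))%:E)%E.
Proof.
move=> ts k0; under eq_integral do rewrite integral_cst// [X in (_ * X)%E]lebesgue_measure_segment//.
by rewrite -EFinM integral_cst// [X in (_ * X)%E]probability_setT mule1.
Qed.

End DoubleIntegral.

Section ProcessMeasurability.
Variables (R : realType) (Xi : hilbertType R) (Om : ref_space Xi) (t T : R).
Hypothesis refOm : reference_space Om t T.
Hypothesis tT : t <= T.

Lemma adapted_open_measurable (V : normedModType R) (X : R -> Om -> V) s :
  adapted t T X -> t <= s <= T -> open_measurable_fun (X s).
Proof.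
move=> aX tsT O oO; apply: (filtration_measurable refOm _ (aX s tsT O oO)).
by case/andP: tsT.
Qed.

(** For each fixed x the distance of the process to x is continuous in time and measurable in
    chance, hence jointly measurable; distances determine measurability in a separable space. *)
Lemma adapted_joint_open_measurable (V : normedModType R) (X : R -> Om -> V) :
  separable V -> adapted t T X ->
  (forall w, {within `[t, T], continuous (fun s : R => X s w)}) ->
  open_measurable_fun (fun z : (measurableTypeR R * Om)%type => X (clamp t T z.1) z.2).
Proof.
move=> sepV aX cX; apply: open_measurable_dist => // x.
apply: (caratheodory_measurable tT (Y := fun s w => `|X s w - x|)).
- move=> s tsT.
  apply: (open_measurable_comp (g := fun y : V => `|y - x|) (adapted_open_measurable aX tsT)).
  by move=> y; apply: cvg_norm; apply: cvgB; [exact: cvg_id|exact: cvg_cst].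
- move=> w; move/subspace_continuousP : (cX w) => cXw.
  apply/subspace_continuousP => s ts.
  by apply: cvg_norm; apply: cvgB; [exact: cXw|exact: cvg_cst].
Qed.

(** Progressive measurability is used at the final time T and pulled back along the clamping of
    time. *)
Lemma progressive_joint_open_measurable (V : normedModType R) (a : R -> Om -> V) :
  progressively_measurable t T a ->
  open_measurable_fun (fun z : (measurableTypeR R * Om)%type => a (clamp t T z.1) z.2).
Proof.
move=> pa O oO.
pose D : set (measurableTypeR R * Om)%type := `[t, T] `*` [set: Om].
have mD : measurable D by exact: measurableX.
have TT : t <= T <= T by rewrite tT lexx.
have mQ : measurable (D `&` [set z : (measurableTypeR R * Om)%type | O (a z.1 z.2)]).
  have := pa T TT O oO; apply: smallest_sub.
    split=> //.
    - by move=> A mA; exact: measurableD.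
    - by move=> F mF; exact: bigcupT_measurable.
  move=> Q [C [F [mC _ fF ->]]]; apply: measurableX => //.
  exact: (filtration_measurable refOm (lexx T) fF).
pose cl (z : (measurableTypeR R * Om)%type) : (measurableTypeR R * Om)%type :=
  (clamp t T z.1, z.2).
have mcl : measurable_fun setT cl.
  apply: measurable_fun_pair => //.
  apply: (measurableT_comp (f := clamp t T : measurableTypeR R -> measurableTypeR R)) => //.
  exact: measurable_clamp.
have := mcl measurableT _ mQ; rewrite setTI.
congr measurable; apply/seteqP; split=> z /=; first by case.
by move=> Oz; split=> //; split=> //=; rewrite in_itv /=; exact: clamp_itv.
Qed.

End ProcessMeasurability.

(** * Mild solutions *)

Section VolterraStep.
Variables (R : realType) (H Xi K : hilbertType R) (E : set Xi).
Hypothesis onbE : orthonormal_basis E.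
Variables (Om : ref_space Xi) (t T : R).
Hypothesis refOm : reference_space Om t T.
Variables (iota : H -> K) (c : R).
Hypothesis lin_iota : linear iota.
Hypothesis c0 : 0 <= c.
Hypothesis iota_le : forall x, `|iota x| <= c * `|x|.
Variables (s : R) (ts : t <= s) (sT : s <= T).
Local Notation P := (ref_P Om).
Local Notation mu := (@lebesgue_measure R).
Variables (Y d1 d2 n1 n2 : Om -> H) (z : H) (f1 f2 : Om -> R -> H).
Variables (Phi1 Phi2 : R -> Om -> Xi -> H) (G : R -> Om -> R).
Hypothesis YE : {ae P, forall w, Y w = z + (d1 w - d2 w) + (n1 w - n2 w)}.
Hypothesis b1 : {ae P, forall w, is_bochner `[t, s] (f1 w) (d1 w)}.
Hypothesis b2 : {ae P, forall w, is_bochner `[t, s] (f2 w) (d2 w)}.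
Hypothesis i1 : is_ito E t s Phi1 n1.
Hypothesis i2 : is_ito E t s Phi2 n2.
Hypothesis mG : measurable_fun (`[t, s] `*` [set: Om])
  (fun x : (measurableTypeR R * Om)%type => G x.1 x.2).
Hypothesis G0 : forall r w, 0 <= G r w.
Hypothesis fG : forall r w, r \in `[t, s] -> `|f1 w r - f2 w r| <= G r w.
Hypothesis PG : forall r w, r \in `[t, s] ->
  (hs_sq E (fun xi => (Phi1 r w xi - Phi2 r w xi)%R) <= (G r w ^+ 2)%:E)%E.
Hypothesis mY : measurable_fun setT (fun w => `|iota (Y w)| ^+ 2).

Let G2 := (\int[P]_w \int[mu]_(r in `[t, s]) (G r w ^+ 2)%:E)%E.

Let mG2 : measurable_fun (`[t, s] `*` [set: Om])
  (fun x : (measurableTypeR R * Om)%type => (G x.1 x.2 ^+ 2)%:E).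
Proof. by apply/measurable_EFinP/measurable_funX. Qed.

Let G20 r w : (0 <= (G r w ^+ 2)%:E)%E.
Proof. by rewrite lee_fin sqr_ge0. Qed.

Let kappa_le (k x y : R) : 0 <= k -> x <= y ->
  3 * k * x + 3 * k * 9 <= k * (3 * y + 27).
Proof. by move=> k0 xy; have := ler_wpM2l k0 xy; lra. Qed.

(** The Bochner estimate, pathwise, followed by Cauchy-Schwarz in time. *)
Let drift_le : {ae P, forall w, ((`|d1 w - d2 w| ^+ 2)%:E <=
  (s - t)%:E * \int[mu]_(r in `[t, s]) (G r w ^+ 2)%:E)%E}.
Proof.
apply: filterS2 b1 b2 => w h1 h2.
have mGw : measurable_fun `[t, s] ((fun r => G r w) : measurableTypeR R -> R).
  apply/measurable_EFinP; apply: (section_measurable (h := fun r w => (G r w)%:E)).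
  exact/measurable_EFinP.
have := is_bochner_dist_le h1 h2 mGw (fun r rts => fG w rts).
move=> le1; rewrite expr2 EFinM.
apply: le_trans (integral_sq_le ts mGw (fun r _ => G0 r w)).
by apply: lee_pmul => //; rewrite lee_fin.
Qed.

(* [is_ito] gives no measurability of the noises themselves, only of their distances
   to elementary integrals; hence the measurable majorant F. *)
Let noise_le (q : R) : 0 < q -> exists F : Om -> R,
  [/\ measurable_fun setT F,
      forall w, 0 <= F w,
      forall w, `|n1 w - n2 w| ^+ 2 <= F w &
      (\int[P]_w (F w)%:E <= q%:E + 9%:E * G2)%E].
Proof.
move=> q0.
have [phi1 [ad1 mh1 lh1 mn1 ln1]] := i1.
have [phi2 [ad2 mh2 lh2 mn2 ln2]] := i2.
(* The bookkeeping 3 e + 3 e + 3 (6 e) = 24 e: two distances of noises to elementary integrals, and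
   the elementary integral of the difference, whose isometry costs 3 (e + e). *)
pose e := q / 24.
have e0 : 0 < e by rewrite divr_gt0.
have [n [h1 h2 k1 k2]] : exists n, [/\
    (\int[P]_w \int[mu]_(r in `[t, s])
      hs_sq E (fun xi => (Phi1 r w xi - ep_val (phi1 n) r w xi)%R) <= e%:E)%E,
    (\int[P]_w \int[mu]_(r in `[t, s])
      hs_sq E (fun xi => (Phi2 r w xi - ep_val (phi2 n) r w xi)%R) <= e%:E)%E,
    (\int[P]_w (`|n1 w - ep_integral (phi1 n) w| ^+ 2)%:E <= e%:E)%E &
    (\int[P]_w (`|n2 w - ep_integral (phi2 n) w| ^+ 2)%:E <= e%:E)%E].
  have l1 := cvge0_near_le e0 lh1; have l2 := cvge0_near_le e0 lh2.
  have l3 := cvge0_near_le e0 ln1; have l4 := cvge0_near_le e0 ln2.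
  have [n [[h1 h2] [h3 h4]]] := filter_ex (filterI (filterI l1 l2) (filterI l3 l4)).
  exists n; split; [exact: h1|exact: h2|exact: h3|exact: h4].
pose phi := ep_sub (phi1 n) (phi2 n).
have adphi : ep_adapted t s phi by exact: ep_sub_adapted.
pose u1 w := `|n1 w - ep_integral (phi1 n) w|.
pose u2 w := `|n2 w - ep_integral (phi2 n) w|.
pose v w := `|ep_integral phi w|.
have m1 : measurable_fun setT (fun w => 3 * u1 w ^+ 2).
  by apply: measurable_funM => //; apply: measurable_funX; exact: mn1.
have m2 : measurable_fun setT (fun w => 3 * u2 w ^+ 2).
  by apply: measurable_funM => //; apply: measurable_funX; exact: mn2.
have m3 : measurable_fun setT (fun w => 3 * v w ^+ 2).
  by apply: measurable_funM => //; exact: (ep_integral_sq_measurable refOm sT adphi).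
exists (fun w => 3 * u1 w ^+ 2 + 3 * u2 w ^+ 2 + 3 * v w ^+ 2); split.
- by apply: measurable_funD => //; exact: measurable_funD.
- by move=> w; rewrite !addr_ge0// mulr_ge0// sqr_ge0.
- move=> w.
  rewrite (_ : n1 w - n2 w = (n1 w - ep_integral (phi1 n) w) -
      (n2 w - ep_integral (phi2 n) w) + ep_integral phi w); last first.
    by rewrite /phi ep_sub_integral opprB addrAC !subrKA.
  by rewrite (le_trans (sqr_normD3_le _ _ _))// normrN.
(* The elementary difference is - (Phi1 - phi1) + (Phi2 - phi2) + (Phi1 - Phi2): two small terms and
   one dominated by G. *)
- have vle : (\int[P]_w (v w ^+ 2)%:E <= (6 * e)%:E + 3%:E * G2)%E.
    rewrite (ep_integral_isometry refOm sT adphi).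
    pose a1 r w := hs_sq E (fun xi => Phi1 r w xi - ep_val (phi1 n) r w xi).
    pose a2 r w := hs_sq E (fun xi => Phi2 r w xi - ep_val (phi2 n) r w xi).
    have a10 r w : (0 <= a1 r w)%E by exact: hs_sq_ge0.
    have a20 r w : (0 <= a2 r w)%E by exact: hs_sq_ge0.
    have ma1 := mh1 n; have ma2 := mh2 n.
    have ma12 : measurable_fun (`[t, s] `*` [set: Om])
        (fun x : (measurableTypeR R * Om)%type => a1 x.1 x.2 + a2 x.1 x.2)%E.
      exact: emeasurable_funD.
    have mS : measurable_fun (`[t, s] `*` [set: Om])
        (fun x : (measurableTypeR R * Om)%type => a1 x.1 x.2 + a2 x.1 x.2 + (G x.1 x.2 ^+ 2)%:E)%E.
      exact: emeasurable_funD.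
    apply: (@le_trans _ _ (\int[P]_w \int[mu]_(r in `[t, s])
        (3%:E * (a1 r w + a2 r w + (G r w ^+ 2)%:E)))%E).
      apply: double_integral_le.
      - by move=> r w; rewrite lee_fin; exact: (ep_gram_ge0 _ _ _ onbE).
      - by move=> r w; rewrite mule_ge0// !adde_ge0.
      - apply/measurable_EFinP/measurable_funTS; exact: (ep_gram_measurable refOm sT adphi).
      - by apply: emeasurable_funM.
      - move=> r w rts; apply: (le_trans (ep_gram_le_hs_sq _ _ _ onbE)).
        have hs3 := @hs_sq_sub3 _ _ _ E (ep_val phi r w)
          (fun xi => - (Phi1 r w xi - ep_val (phi1 n) r w xi))
          (fun xi => Phi2 r w xi - ep_val (phi2 n) r w xi)
          (fun xi => Phi1 r w xi - Phi2 r w xi).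
        apply: (le_trans (hs3 _)).
          by move=> xi; rewrite ep_sub_val opprB addrAC !subrKA.
        rewrite lee_wpmul2l ?lee_fin// leeD//; last exact: PG.
        rewrite leeD//.
        rewrite (_ : hs_sq _ _ = a1 r w)//.
        by apply: eq_esum => xi _; rewrite normrN.
    rewrite (@double_integralZl _ _ _ P t s
      (fun r w => a1 r w + a2 r w + (G r w ^+ 2)%:E)%E)//;
      last by move=> r w; rewrite !adde_ge0.
    rewrite (@double_integralD _ _ _ P t s (fun r w => a1 r w + a2 r w)%E
      (fun r w => (G r w ^+ 2)%:E))//; last by move=> r w; rewrite adde_ge0.
    rewrite (@double_integralD _ _ _ P t s a1 a2)//.
    have G2_0 : (0 <= G2)%E.
      by apply: integral_ge0 => w _; apply: integral_ge0.
    have di0 (a : R -> Om -> \bar R) : (forall r w, (0 <= a r w)%E) ->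
        (0 <= \int[P]_w \int[mu]_(r in `[t, s]) a r w)%E.
      by move=> a0; apply: integral_ge0 => w _; apply: integral_ge0.
    rewrite -/G2 (ge0_muleDr _ (adde_ge0 (di0 a1 a10) (di0 a2 a20)) G2_0).
    rewrite leeD2r// (_ : 6 * e = 3 * (e + e)); last by ring.
    rewrite EFinM; apply: lee_wpmul2l; first by rewrite lee_fin.
    by rewrite EFinD; apply: leeD; [exact: h1|exact: h2].
  have sq0 (f : Om -> R) w : (0 <= (3 * f w ^+ 2)%:E :> \bar R)%E.
    by rewrite lee_fin mulr_ge0// sqr_ge0.
  under eq_integral do rewrite !EFinD.
  have mm1 : measurable_fun setT (fun w => (3 * u1 w ^+ 2)%:E) by exact/measurable_EFinP.
  have mm2 : measurable_fun setT (fun w => (3 * u2 w ^+ 2)%:E) by exact/measurable_EFinP.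
  have mm3 : measurable_fun setT (fun w => (3 * v w ^+ 2)%:E) by exact/measurable_EFinP.
  rewrite (ge0_integralD P measurableT (fun w _ => adde_ge0 (sq0 u1 w) (sq0 u2 w))
    (emeasurable_funD mm1 mm2) (fun w _ => sq0 v w) mm3).
  rewrite (ge0_integralD P measurableT (fun w _ => sq0 u1 w) mm1 (fun w _ => sq0 u2 w) mm2).
  have mZ (f : Om -> R) : measurable_fun setT (fun w => f w ^+ 2) ->
      (\int[P]_w (3 * f w ^+ 2)%:E = 3%:E * \int[P]_w (f w ^+ 2)%:E)%E.
    move=> mf; under eq_integral do rewrite EFinM.
    rewrite ge0_integralZl//; first exact/measurable_EFinP.
    by move=> w _; rewrite lee_fin sqr_ge0.
  rewrite (mZ u1 (measurable_funX 2 (mn1 n))) (mZ u2 (measurable_funX 2 (mn2 n))).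
  rewrite (mZ v (ep_integral_sq_measurable refOm sT adphi)).
  apply: (@le_trans _ _ (3%:E * e%:E + 3%:E * e%:E + 3%:E * ((6 * e)%:E + 3%:E * G2))%E).
    have l3 : (0 <= 3%:E :> \bar R)%E by rewrite lee_fin.
    apply: leeD; first apply: leeD; apply: (lee_wpmul2l l3).
    + exact: k1.
    + exact: k2.
    + exact: vle.
  rewrite ge0_muleDr//; last 2 first.
  - by rewrite lee_fin mulr_ge0// ltW.
  - rewrite mule_ge0//; apply: integral_ge0 => w _; exact: integral_ge0.
  rewrite muleA -!EFinM addeA -!EFinD (_ : 3 * 3 = 9 :> R); last by ring.
  by rewrite leeD2r// lee_fin /e; lra.
Qed.

(** Formulated for an abstract bounded linear [iota] and for integrands compared through G, so that
    it serves twice: for the difference of two solutions in the negative norm, and for a single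
    solution in the norm of H. The terms 3 (T - t) and 27 belong to the drift and to the noise. *)
Lemma volterra_step : (\int[P]_w (`|iota (Y w)| ^+ 2)%:E <=
  (3 * `|iota z| ^+ 2)%:E + (c ^+ 2 * (3 * (T - t) + 27))%:E * G2)%E.
Proof.
have G2_0 : (0 <= G2)%E.
  by apply: integral_ge0 => w _; apply: integral_ge0.
apply/lee_addgt0Pr => q q0.
have c3 : 0 < 3 * c ^+ 2 + 1 by rewrite ltr_wpDl// mulr_ge0// sqr_ge0.
(* The noise is later multiplied by 3 c^2; the denominator 3 c^2 + 1 keeps that error below q and is
   positive even when c = 0. *)
have [F [mF F0 nF IF]] := noise_le (divr_gt0 q0 c3).
pose I w := (\int[mu]_(r in `[t, s]) (G r w ^+ 2)%:E)%E.
have I0 w : (0 <= I w)%E by exact: integral_ge0.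
have mI : measurable_fun setT I by exact: (segment_integral_measurable _ mG2).
have k1 : 0 <= 3 * c ^+ 2 * (s - t) by rewrite !mulr_ge0 ?sqr_ge0// subr_ge0.
have k2 : 0 <= 3 * c ^+ 2 by rewrite mulr_ge0 ?sqr_ge0.
have k3 : 0 <= 3 * `|iota z| ^+ 2 by rewrite mulr_ge0 ?sqr_ge0.
pose B w := ((3 * `|iota z| ^+ 2)%:E + (3 * c ^+ 2 * (s - t))%:E * I w +
  (3 * c ^+ 2)%:E * (F w)%:E)%E.
have mB : measurable_fun setT B.
  apply: emeasurable_funD; last exact/emeasurable_funM/measurable_EFinP.
  by apply: emeasurable_funD => //; exact: emeasurable_funM.
have B0 w : (0 <= B w)%E by rewrite !adde_ge0// mule_ge0// lee_fin.
have mYE : measurable_fun setT (fun w => (`|iota (Y w)| ^+ 2)%:E) by exact/measurable_EFinP.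
have Y0 w : (0 <= (`|iota (Y w)| ^+ 2)%:E)%E by rewrite lee_fin sqr_ge0.
apply: (@le_trans _ _ (\int[P]_w B w)%E).
  apply: (ae_ge0_le_integral measurableT (fun w _ => Y0 w) mYE (fun w _ => B0 w) mB).
  apply: filterS2 YE drift_le => w -> dl _.
  have linD := linear_funD lin_iota.
  have h3 := sqr_normD3_le (iota z) (iota (d1 w - d2 w)) (iota (n1 w - n2 w)).
  have hn : 3 * `|iota (n1 w - n2 w)| ^+ 2 <= 3 * c ^+ 2 * F w.
    rewrite -mulrA ler_wpM2l//; apply: (@le_trans _ _ ((c * `|n1 w - n2 w|) ^+ 2)).
      by rewrite ler_sqr ?nnegrE ?mulr_ge0.
    by rewrite exprMn ler_wpM2l ?sqr_ge0.
  have hd : 3 * `|iota (d1 w - d2 w)| ^+ 2 <= 3 * c ^+ 2 * `|d1 w - d2 w| ^+ 2.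
    by rewrite -mulrA ler_wpM2l// -exprMn ler_sqr ?nnegrE ?mulr_ge0.
  apply: (@le_trans _ _ ((3 * `|iota z| ^+ 2)%:E + (3 * c ^+ 2 * `|d1 w - d2 w| ^+ 2)%:E +
      (3 * c ^+ 2 * F w)%:E)%E).
    by rewrite -!EFinD lee_fin (linD (z + _)) (linD z); lra.
  rewrite /B -EFinM leeD2r// leeD2l// EFinM [X in (_ <= X * _)%E]EFinM -muleA.
  by rewrite lee_wpmul2l ?lee_fin.
have n1w w : (0 <= (3 * c ^+ 2 * (s - t))%:E * I w)%E by rewrite mule_ge0// lee_fin.
have n2w w : (0 <= (3 * c ^+ 2)%:E * (F w)%:E)%E by rewrite mule_ge0// lee_fin.
have n0w (w : Om) : (0 <= (3 * `|iota z| ^+ 2)%:E :> \bar R)%E by rewrite lee_fin.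
have m1w : measurable_fun setT (fun w => (3 * c ^+ 2 * (s - t))%:E * I w)%E.
  exact: emeasurable_funM.
have m0w : measurable_fun setT (fun w : Om => (3 * `|iota z| ^+ 2)%:E).
  exact: measurable_cst.
have m2w : measurable_fun setT (fun w => (3 * c ^+ 2)%:E * (F w)%:E)%E.
  by apply: emeasurable_funM => //; exact/measurable_EFinP.
rewrite /B (ge0_integralD P measurableT (fun w _ => adde_ge0 (n0w w) (n1w w))
  (emeasurable_funD m0w m1w) (fun w _ => n2w w) m2w).
rewrite (ge0_integralD P measurableT (fun w _ => n0w w) m0w (fun w _ => n1w w) m1w).
rewrite integral_cst// [X in (_ * X + _ + _)%E]probability_setT mule1.
rewrite ge0_integralZl// ge0_integralZl//; last 2 first.
- exact/measurable_EFinP.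
- by move=> w _; rewrite lee_fin.
rewrite -!addeA leeD2l//.
apply: (@le_trans _ _ ((3 * c ^+ 2 * (s - t))%:E * G2 + (3 * c ^+ 2)%:E * ((q / (3 * c ^+ 2 + 1))%:E + 9%:E * G2))%E).
  by rewrite leeD2l// lee_wpmul2l// lee_fin.
have q1 : (0 <= (q / (3 * c ^+ 2 + 1))%:E)%E by rewrite lee_fin divr_ge0 ?(ltW q0)// ltW.
have g9 : (0 <= 9%:E * G2)%E by rewrite mule_ge0// lee_fin.
rewrite (ge0_muleDr _ q1 g9) muleA -!EFinM addeCA [leRHS]addeC.
have k4 : 0 <= 3 * c ^+ 2 * 9 by rewrite mulr_ge0.
have k10 : (0 <= (3 * c ^+ 2 * (s - t))%:E)%E by rewrite lee_fin.
have k40 : (0 <= (3 * c ^+ 2 * 9)%:E)%E by rewrite lee_fin.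
rewrite -(ge0_muleDl _ k10 k40); apply: leeD.
  by rewrite lee_fin mulrCA ler_piMr ?(ltW q0)// ler_pdivrMr// mul1r lerDl.
rewrite -EFinD; apply: lee_wpmul2r => //; rewrite lee_fin.
by apply: kappa_le; [exact: sqr_ge0|rewrite lerD2r].
Qed.

End VolterraStep.

Section BoundedLinear.
Variables (R : realType) (H K : hilbertType R) (iota : H -> K) (c : R).
Hypothesis lin_iota : linear iota.
Hypothesis c0 : 0 < c.
Hypothesis iota_le : forall x, `|iota x| <= c * `|x|.

Lemma bounded_linear_fun_continuous : continuous iota.
Proof.
move=> x; apply/cvgrPdist_le => e e0; near=> y.
rewrite -(linear_funB lin_iota) (le_trans (iota_le _))// -ler_pdivlMl//.
near: y; apply: cvgr_dist_le; first exact: cvg_id.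
by rewrite mulr_gt0// invr_gt0.
Unshelve. all: by end_near. Qed.

Lemma continuous_norm_iotaB : continuous (fun p : H * H => `|iota (p.1 - p.2)|).
Proof.
move=> p; apply: cvg_norm.
have cB : (fun q : H * H => q.1 - q.2) q @[q --> p] --> p.1 - p.2.
  by apply: cvgB; [exact: cvg_fst|exact: cvg_snd].
exact: (continuous_cvg _ (bounded_linear_fun_continuous (x := p.1 - p.2)) cB).
Qed.

End BoundedLinear.

Section SemigroupHS.
Variables (R : realType) (H Xi : hilbertType R) (E : set Xi) (S : R -> H -> H).
Hypothesis semS : contraction_semigroup S.

Lemma hs_sq_semigroupB_le u (f g : Xi -> H) : 0 <= u ->
  (hs_sq E (fun xi => (S u (f xi) - S u (g xi))%R) <= hs_sq E (fun xi => (f xi - g xi)%R))%E.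
Proof. by move=> u0; apply: hs_sq_le => e; exact: contraction_semigroup_le. Qed.

Lemma hs_sq_semigroup_le u (f : Xi -> H) : 0 <= u ->
  (hs_sq E (fun xi => S u (f xi)) <= hs_sq E f)%E.
Proof.
by move=> u0; apply: hs_sq_le => e; have [_ _ _ + _] := semS; apply.
Qed.

End SemigroupHS.

Section TrivialIntegrals.
Variables (R : realType) (H Xi : hilbertType R) (E : set Xi) (Om : ref_space Xi).

(** The zero drift, like the zero noise below, provides the second system when [volterra_step], an
    estimate on differences, is applied to one solution. *)
Lemma is_bochner0 (D : set (measurableTypeR R)) :
  is_bochner D (fun=> 0) (0 : H).
Proof.
pose phi : simple_map H := @SimpleMap R H 0 (fun=> set0) (fun=> 0) (fun=> measurable0).
have phi0 r : sm_val phi r = 0 by rewrite /sm_val big_ord0.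
exists (fun=> phi); split.
- move=> _; rewrite (_ : (fun r => _) = cst 0)//.
  by apply/funext => r; rewrite phi0 subr0 normr0.
- rewrite (_ : (fun n => _) = cst 0%E); first exact: cvg_cst.
  apply/funext => n; apply: integral0_eq => r _.
  by rewrite phi0 subr0 normr0.
- rewrite (_ : (fun n => _) = cst 0); first exact: cvg_cst.
  by apply/funext => n; rewrite /sm_integral big_ord0.
Qed.

Lemma is_ito0 (t s : R) : is_ito (Om := Om) E t s (fun _ _ _ => 0 : H) (fun=> 0).
Proof.
pose phi : elem_process H Om :=
  @ElemProcess R Xi H Om 0 (fun=> 0) (fun=> 0) (fun=> set0) (fun=> 0) (fun=> 0).
have phi0 r w xi : ep_val phi r w xi = 0 by rewrite /ep_val big_ord0.
have hs0 r w : hs_sq E (fun xi => 0 - ep_val phi r w xi) = 0%E.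
  by rewrite /hs_sq esum1// => e _; rewrite phi0 subr0 normr0 expr0n.
have int0 w : ep_integral phi w = 0 by rewrite /ep_integral big_ord0.
exists (fun=> phi); split.
- by move=> n [].
- move=> _; rewrite (_ : (fun z => _) = cst 0%E)//.
  by apply/funext => z; rewrite hs0.
- rewrite (_ : (fun n => _) = cst 0%E); first exact: cvg_cst.
  apply/funext => n; apply: integral0_eq => w _; apply: integral0_eq => r _.
  exact: hs0.
- move=> _; rewrite (_ : (fun w => _) = cst 0)//.
  by apply/funext => w; rewrite int0 subr0 normr0.
- rewrite (_ : (fun n => _) = cst 0%E); first exact: cvg_cst.
  apply/funext => n; apply: integral0_eq => w _.
  by rewrite int0 subr0 normr0 expr0n.
Qed.

End TrivialIntegrals.

(** * Stability and growth of mild solutions *)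

Section MildEstimates.
Variables (R : realType) (H Xi Hm : hilbertType R) (Lam : normedModType R).
Variables (E : set Xi) (Lam0 : set Lam) (B : H -> H) (S : R -> H -> H) (iota : H -> Hm).
Variables (b : H -> Lam -> H) (sigma : H -> Lam -> Xi -> H) (c C c0 p t T : R).
Variable Om : ref_space Xi.
Hypothesis onbE : orthonormal_basis E.
Hypothesis sepH : separable H.
Hypothesis sepLam : separable Lam.
Hypothesis semS : contraction_semigroup S.
Hypothesis hiota : completion_m1 B iota.
Hypothesis c_gt0 : 0 < c.
Hypothesis iota_le : forall x, `|iota x| <= c * `|x|.
Hypothesis c00 : 0 <= c0.
Hypothesis S_iota : forall s x, 0 <= s ->
  `|iota (S s x)| ^+ 2 <= expR (2 * c0 * s) * `|iota x| ^+ 2.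
Hypothesis C0 : 0 < C.
Hypothesis bs_lip : forall x x' a, Lam0 a ->
  [/\ `|b x a - b x' a| <= C * norm_m1 B (x - x'),
      hs_norm E (fun xi => sigma x a xi - sigma x' a xi) <= C * norm_m1 B (x - x'),
      `|b x a| <= C * (1 + `|x| + `|a|) &
      hs_norm E (sigma x a) <= C * (1 + `|x| + `|a|)].
Hypothesis sigma_HS : forall x a, hilbert_schmidt E (sigma x a).
Hypothesis tT : t <= T.
Hypothesis refOm : reference_space Om t T.
Local Notation P := (ref_P Om).
Local Notation mu := (@lebesgue_measure R).
Local Notation cl := (clamp t T).

Let lin_iota : linear iota. Proof. by case: hiota. Qed.

Let cl_id s r : s <= T -> r \in `[t, s] -> cl r = r.
Proof.
by move=> sT; rewrite in_itv /= => /andP[tr rs]; rewrite clamp_id// tr (le_trans rs).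
Qed.

Lemma mild_joint_measurable x a X : mild_solution E S b sigma t T x a X ->
  open_measurable_fun (fun z : (measurableTypeR R * Om)%type => X (cl z.1) z.2).
Proof. by move=> [aX cX _ _]; exact: adapted_joint_open_measurable. Qed.

Section Difference.
Variables (x1 x2 : H) (a : R -> Om -> Lam) (X1 X2 : R -> Om -> H).
Hypothesis adm : admissible Lam0 p t T a.
Hypothesis mild1 : mild_solution E S b sigma t T x1 a X1.
Hypothesis mild2 : mild_solution E S b sigma t T x2 a X2.

Let Y (s : R) (w : Om) := X1 (cl s) w - X2 (cl s) w.

Lemma difference_measurable : measurable_fun setT
  (fun z : (measurableTypeR R * Om)%type => `|iota (X1 (cl z.1) z.2 - X2 (cl z.1) z.2)|).
Proof.
apply: (open_measurable_comp (f := fun z : (measurableTypeR R * Om)%type =>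
  (X1 (cl z.1) z.2, X2 (cl z.1) z.2)) (g := fun p : H * H => `|iota (p.1 - p.2)|)).
- apply: open_measurable_pair => //.
  + exact: mild_joint_measurable mild1.
  + exact: mild_joint_measurable mild2.
- exact: (continuous_norm_iotaB lin_iota c_gt0 iota_le).
Qed.

Let m (s : measurableTypeR R) := (\int[P]_w (`|iota (Y s w)| ^+ 2)%:E)%E.

Let q2_measurable : measurable_fun setT
  (fun z : (measurableTypeR R * Om)%type => (`|iota (Y z.1 z.2)| ^+ 2)%:E).
Proof. by apply/measurable_EFinP/measurable_funX; exact: difference_measurable. Qed.

Let q20 r w : (0 <= (`|iota (Y r w)| ^+ 2)%:E)%E.
Proof. by rewrite lee_fin sqr_ge0. Qed.

Let m_measurable : measurable_fun setT m.
Proof. exact: (measurable_fun_fubini_tonelli_F _ q2_measurable (fun z => q20 z.1 z.2)). Qed.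

Let kappa := c ^+ 2 * (3 * (T - t) + 27) * C ^+ 2.

Let kappa0 : 0 < kappa.
Proof.
rewrite /kappa !mulr_gt0 ?exprn_gt0//.
by rewrite ltr_wpDl// mulr_ge0// subr_ge0.
Qed.

Let A := expR (2 * c0 * (T - t)) * `|iota (x1 - x2)| ^+ 2.

(** C times the negative-norm distance of the two states majorizes both the drift and the noise
    differences, since the two solutions share the control. Tonelli then turns the double integral
    into the time integral of m. *)
Let m_step s : t <= s <= T ->
  (m s <= (3 * A)%:E + kappa%:E * \int[mu]_(r in `[t, s]) m r)%E.
Proof.
move=> tsT; have /andP[ts sT] := tsT.
have [a0 _ _] := adm.
have [_ _ _ /(_ s tsT)[d1 [n1 [b1 i1 e1]]]] := mild1.
have [_ _ _ /(_ s tsT)[d2 [n2 [b2 i2 e2]]]] := mild2.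
pose G r w := C * `|iota (Y r w)|.
have mG : measurable_fun (`[t, s] `*` [set: Om])
    (fun x : (measurableTypeR R * Om)%type => G x.1 x.2).
  by apply: measurable_funTS; apply: measurable_funM => //; exact: difference_measurable.
have G0 r w : 0 <= G r w by rewrite mulr_ge0// ltW.
have sr (r : R) : r \in `[t, s] -> 0 <= s - r.
  by rewrite in_itv /= subr_ge0 => /andP[].
have ar r w : r \in `[t, s] -> Lam0 (a r w).
  by rewrite in_itv /= => /andP[tr rs]; apply: a0; rewrite tr (le_trans rs).
have YE : {ae P, forall w, Y s w = S (s - t) (x1 - x2) + (d1 w - d2 w) + (n1 w - n2 w)}.
  apply: filterS2 e1 e2 => w; rewrite /Y clamp_id// => -> ->.
  rewrite contraction_semigroupB ?subr_ge0//.
  by rewrite !opprD addrACA; congr (_ + _); rewrite addrACA.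
have fG r w : r \in `[t, s] ->
    `|S (s - r) (b (X1 r w) (a r w)) - S (s - r) (b (X2 r w) (a r w))| <= G r w.
  move=> rs; rewrite (le_trans (contraction_semigroup_le semS _ _ (sr r rs)))//.
  have [+ _ _ _] := bs_lip (X1 r w) (X2 r w) (ar r w rs).
  by rewrite (norm_m1E hiota) /G /Y (cl_id sT rs).
have PG r w : r \in `[t, s] ->
    (hs_sq E (fun xi => (S (s - r) (sigma (X1 r w) (a r w) xi) -
      S (s - r) (sigma (X2 r w) (a r w) xi))%R) <= (G r w ^+ 2)%:E)%E.
  move=> rs; apply: (le_trans (hs_sq_semigroupB_le _ semS _ _ (sr r rs))).
  rewrite hs_sqE; last exact: hs_sqB_fin_num.
  rewrite lee_fin ler_sqr ?nnegrE ?hs_norm_ge0//.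
  have [_ + _ _] := bs_lip (X1 r w) (X2 r w) (ar r w rs).
  by rewrite (norm_m1E hiota) /G /Y (cl_id sT rs).
have mY : measurable_fun setT (fun w => `|iota (Y s w)| ^+ 2).
  apply: measurable_funX.
  exact: (measurableT_comp difference_measurable (pair1_measurable (s : measurableTypeR R))).
have := volterra_step onbE refOm lin_iota (ltW c_gt0) iota_le ts sT YE b1 b2 i1 i2 mG G0
  (fun r w => @fG r w) PG mY.
move=> /le_trans; apply; apply: leeD.
  rewrite lee_fin ler_wpM2l// (le_trans (S_iota _ _))// ?subr_ge0//.
  by rewrite ler_wpM2r ?sqr_ge0// ler_expR ler_wpM2l ?mulr_ge0// lerD2r.
rewrite /kappa [in leRHS]EFinM -[leRHS]muleA; apply: lee_wpmul2l.
  by rewrite lee_fin mulr_ge0 ?sqr_ge0// addr_ge0// mulr_ge0// subr_ge0.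
have mq : measurable_fun (`[t, s] `*` [set: Om])
    (fun z : (measurableTypeR R * Om)%type => (`|iota (Y z.1 z.2)| ^+ 2)%:E).
  exact: measurable_funTS.
rewrite -(@double_integral_swap _ _ _ P _ _ (fun r w => (`|iota (Y r w)| ^+ 2)%:E) q20 mq).
rewrite -(@double_integralZl _ _ _ P t s (fun r w => (`|iota (Y r w)| ^+ 2)%:E)
  (C ^+ 2) (sqr_ge0 C) q20 mq).
rewrite le_eqVlt; apply/orP; left; apply/eqP.
by apply: eq_integral => w _; apply: eq_integral => r _; rewrite /G exprMn EFinM.
Qed.

(** The a priori finiteness that Gronwall's inequality requires; it comes from the
    square-integrability clause in [mild_solution]. *)
Let m_fin : (\int[mu]_(r in `[t, T]) m r < +oo)%E.
Proof.
have mq : measurable_fun (`[t, T] `*` [set: Om])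
    (fun z : (measurableTypeR R * Om)%type => (`|iota (Y z.1 z.2)| ^+ 2)%:E).
  exact: measurable_funTS.
rewrite -(@double_integral_swap _ _ _ P _ _ (fun r w => (`|iota (Y r w)| ^+ 2)%:E) q20 mq).
have [_ _ fin1 _] := mild1; have [_ _ fin2 _] := mild2.
pose h (X : R -> Om -> H) (r : R) (w : Om) : \bar R := (`|X (cl r) w| ^+ 2)%:E.
have h0 X r w : (0 <= h X r w)%E by rewrite lee_fin sqr_ge0.
have mh x X : mild_solution E S b sigma t T x a X ->
    measurable_fun (`[t, T] `*` [set: Om])
      (fun z : (measurableTypeR R * Om)%type => h X z.1 z.2).
  move=> mX; apply: measurable_funTS; apply/measurable_EFinP/measurable_funX.
  apply: (open_measurable_comp (mild_joint_measurable mX)).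
  by move=> y; apply: cvg_norm; exact: cvg_id.
have fin X : (\int[P]_w \int[mu]_(s in `[t, T]) (`|X s w| ^+ 2)%:E < +oo)%E ->
    (\int[P]_w \int[mu]_(s in `[t, T]) h X s w < +oo)%E.
  have -> : (\int[P]_w \int[mu]_(s in `[t, T]) h X s w)%E =
    (\int[P]_w \int[mu]_(s in `[t, T]) (`|X s w| ^+ 2)%:E)%E; last exact: id.
  apply: eq_integral => w _; apply: eq_integral => r; rewrite inE /= => rT.
  by rewrite /h (cl_id (lexx T) rT).
have m1 := mh _ _ mild1; have m2 := mh _ _ mild2.
have k0 : 0 <= 2 * c ^+ 2 by rewrite mulr_ge0// sqr_ge0.
apply: (@le_lt_trans _ _ (\int[P]_w \int[mu]_(r in `[t, T])
    ((2 * c ^+ 2)%:E * (h X1 r w + h X2 r w)))%E).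
  apply: (double_integral_le P q20) => //.
  - by move=> r w; rewrite mule_ge0 ?lee_fin ?adde_ge0.
  - by apply: emeasurable_funM => //; exact: emeasurable_funD.
  - move=> r w _; rewrite /h -EFinD -EFinM lee_fin /Y.
    apply: (@le_trans _ _ ((c * `|X1 (cl r) w - X2 (cl r) w|) ^+ 2)).
      by rewrite ler_sqr ?nnegrE ?mulr_ge0// ltW.
    rewrite exprMn; have := sqr_normD_le (X1 (cl r) w) (- X2 (cl r) w).
    move=> /(ler_wpM2l (sqr_ge0 c)); rewrite normrN => /le_trans; apply.
    by rewrite le_eqVlt; apply/orP; left; apply/eqP; ring.
rewrite (@double_integralZl _ _ _ P t T (fun r w => h X1 r w + h X2 r w)%E _ k0
  (fun r w => adde_ge0 (h0 X1 r w) (h0 X2 r w)) (emeasurable_funD m1 m2)).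
rewrite (@double_integralD _ _ _ P t T (h X1) (h X2) (h0 X1) (h0 X2) m1 m2).
apply: lte_mul_pinfty; [by rewrite lee_fin|by []|].
by apply: lte_add_pinfty; [exact: fin fin1|exact: fin fin2].
Qed.

(** Gronwall's constant for K0 = 3 A and K1 = kappa, with 6 = 2 * 3. It involves neither the control
    nor the initial points, so it survives the infimum over controls. *)
Definition difference_const :=
  6 * expR (2 * c0 * (T - t)) * expR (2 * kappa * (T - t)).

Lemma mild_difference_le s : t <= s <= T ->
  (\int[P]_w (`|iota (X1 s w - X2 s w)| ^+ 2)%:E <=
    (difference_const * `|iota (x1 - x2)| ^+ 2)%:E)%E.
Proof.
move=> tsT.
have m0 (r : R) : (0 <= m r)%E by exact: integral_ge0.
have A0 : 0 <= 3 * A by rewrite !mulr_ge0 ?expR_ge0// sqr_ge0.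
have := gronwall tT A0 kappa0 m_measurable m0 m_step m_fin tsT.
rewrite (_ : m s = (\int[P]_w (`|iota (X1 s w - X2 s w)| ^+ 2)%:E)%E); last first.
  by rewrite /m /Y clamp_id.
move=> /le_trans; apply; rewrite lee_fin le_eqVlt; apply/orP; left; apply/eqP.
by rewrite /A /difference_const; ring.
Qed.

End Difference.

Section Growth.
Hypothesis p2 : 2 < p.
Variables (x : H) (a : R -> Om -> Lam) (X : R -> Om -> H).
Hypothesis adm : admissible Lam0 p t T a.
Hypothesis mild : mild_solution E S b sigma t T x a X.

Let hX (r : R) (w : Om) : \bar R := (`|X (cl r) w| ^+ 2)%:E.
Let ha (r : R) (w : Om) : \bar R := (`|a (cl r) w| ^+ 2)%:E.

Lemma state_norm_measurable :
  measurable_fun setT (fun z : (measurableTypeR R * Om)%type => `|X (cl z.1) z.2|).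
Proof.
apply: (open_measurable_comp (mild_joint_measurable mild)).
by move=> y; apply: cvg_norm; exact: cvg_id.
Qed.

Lemma control_joint_measurable :
  open_measurable_fun (fun z : (measurableTypeR R * Om)%type => a (cl z.1) z.2).
Proof. by have [_ pa _] := adm; exact: progressive_joint_open_measurable. Qed.

Lemma control_norm_measurable :
  measurable_fun setT (fun z : (measurableTypeR R * Om)%type => `|a (cl z.1) z.2|).
Proof.
apply: (open_measurable_comp control_joint_measurable).
by move=> y; apply: cvg_norm; exact: cvg_id.
Qed.

Let mX s : measurable_fun (`[t, s] `*` [set: Om])
  (fun z : (measurableTypeR R * Om)%type => hX z.1 z.2).
Proof.
by apply: measurable_funTS; apply/measurable_EFinP/measurable_funX; exact: state_norm_measurable.
Qed.

Let ma s : measurable_fun (`[t, s] `*` [set: Om])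
  (fun z : (measurableTypeR R * Om)%type => ha z.1 z.2).
Proof.
by apply: measurable_funTS; apply/measurable_EFinP/measurable_funX; exact: control_norm_measurable.
Qed.

Let hX0 r w : (0 <= hX r w)%E. Proof. by rewrite lee_fin sqr_ge0. Qed.
Let ha0 r w : (0 <= ha r w)%E. Proof. by rewrite lee_fin sqr_ge0. Qed.

Lemma state_sq_lty : (\int[P]_w \int[mu]_(r in `[t, T]) (`|X (cl r) w| ^+ 2)%:E < +oo)%E.
Proof.
have [_ _ fin _] := mild; apply: le_lt_trans fin.
rewrite le_eqVlt; apply/orP; left; apply/eqP.
apply: eq_integral => w _; apply: eq_integral => r; rewrite inE /= => rT.
by rewrite (cl_id (lexx T) rT).
Qed.

Let sqr_le_powR (y : R) : 0 <= y -> y ^+ 2 <= 1 + y `^ p.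
Proof.
move=> y0; have [y1|/ltW y1] := leP y 1.
  rewrite (@le_trans _ _ 1)//; first by rewrite expr_le1.
  by rewrite lerDl powR_ge0.
rewrite -powR_mulrn// (@le_trans _ _ (y `^ p))//.
  by rewrite ler_powR// ltW.
by rewrite lerDr.
Qed.

(** Admissibility controls the moment of order p > 2, and y^2 <= 1 + y^p for y >= 0. *)
Lemma control_sq_lty : (\int[P]_w \int[mu]_(r in `[t, T]) (`|a (cl r) w| ^+ 2)%:E < +oo)%E.
Proof.
pose h (r : R) (w : Om) : \bar R := (`|a (cl r) w| `^ p)%:E.
have h0 r w : (0 <= h r w)%E by rewrite lee_fin powR_ge0.
have mh : measurable_fun (`[t, T] `*` [set: Om])
    (fun z : (measurableTypeR R * Om)%type => h z.1 z.2).
  apply: measurable_funTS; apply/measurable_EFinP.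
  apply: (measurableT_comp (f := fun y : R => y `^ p)); first exact: measurable_powR.
  exact: control_norm_measurable.
have one0 (r : R) (w : Om) : (0 <= 1%:E :> \bar R)%E by rewrite lee_fin.
have m1 : measurable_fun (`[t, T] `*` [set: Om])
    (fun z : (measurableTypeR R * Om)%type => 1%:E : \bar R) by exact: measurable_cst.
apply: (@le_lt_trans _ _ (\int[P]_w \int[mu]_(r in `[t, T]) (1%:E + h r w))%E).
  apply: (@double_integral_le _ _ _ P t T ha (fun r w => 1%:E + h r w)%E ha0
    (fun r w => adde_ge0 (one0 r w) (h0 r w)) (@ma T) (emeasurable_funD m1 mh)).
  by move=> r w _; rewrite -EFinD lee_fin sqr_le_powR.
rewrite (@double_integralD _ _ _ P t T (fun r w => 1%:E) h one0 h0 m1 mh).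
apply: lte_add_pinfty; first by rewrite double_integral_cst// ltry.
have [_ _ fin] := adm; apply: le_lt_trans fin.
rewrite le_eqVlt; apply/orP; left; apply/eqP.
apply: eq_integral => w _; apply: eq_integral => r; rewrite inE /= => rT.
by rewrite /h (cl_id (lexx T) rT).
Qed.

Let kap := 3 * (T - t) + 27.

Let kap0 : 0 < kap.
Proof. by rewrite /kap ltr_wpDl// mulr_ge0// subr_ge0. Qed.

Lemma state_moment_step s : t <= s <= T ->
  (\int[P]_w (`|X s w| ^+ 2)%:E <= (3 * `|x| ^+ 2)%:E + kap%:E *
    \int[P]_w \int[mu]_(r in `[t, s]) ((C * (1 + `|X (cl r) w| + `|a (cl r) w|)) ^+ 2)%:E)%E.
Proof.
move=> tsT; have /andP[ts sT] := tsT.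
have [a0 _ _] := adm.
have [_ _ _ /(_ s tsT)[d1 [n1 [b1 i1 e1]]]] := mild.
pose G r w := C * (1 + `|X (cl r) w| + `|a (cl r) w|).
have mG : measurable_fun (`[t, s] `*` [set: Om])
    (fun x : (measurableTypeR R * Om)%type => G x.1 x.2).
  apply: measurable_funTS; apply: measurable_funM => //.
  apply: measurable_funD; last exact: control_norm_measurable.
  by apply: measurable_funD => //; exact: state_norm_measurable.
have G0 r w : 0 <= G r w by rewrite mulr_ge0 ?(ltW C0)// !addr_ge0.
have sr (r : R) : r \in `[t, s] -> 0 <= s - r.
  by rewrite in_itv /= subr_ge0 => /andP[].
have ar r w : r \in `[t, s] -> Lam0 (a r w).
  by rewrite in_itv /= => /andP[tr rs]; apply: a0; rewrite tr (le_trans rs).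
have YE : {ae P, forall w, X s w = S (s - t) x + (d1 w - 0) + (n1 w - 0)}.
  by apply: filterS e1 => w ->; rewrite !subr0.
have fG r w : r \in `[t, s] -> `|S (s - r) (b (X r w) (a r w)) - 0| <= G r w.
  move=> rs; have [_ _ _ + _] := semS; rewrite subr0 => Sle.
  rewrite (le_trans (Sle _ _ (sr r rs)))//.
  have [_ _ + _] := bs_lip (X r w) (X r w) (ar r w rs).
  by rewrite /G (cl_id sT rs).
have PG r w : r \in `[t, s] ->
    (hs_sq E (fun xi => (S (s - r) (sigma (X r w) (a r w) xi) - 0)%R) <= (G r w ^+ 2)%:E)%E.
  move=> rs; have -> : hs_sq E (fun xi => S (s - r) (sigma (X r w) (a r w) xi) - 0) =
      hs_sq E (fun xi => S (s - r) (sigma (X r w) (a r w) xi)).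
    by apply: eq_hs_sq => xi; rewrite subr0.
  apply: (le_trans (hs_sq_semigroup_le _ semS _ (sr r rs))).
  rewrite hs_sqE; last exact: hs_sq_fin_num.
  rewrite lee_fin ler_sqr ?nnegrE ?hs_norm_ge0//.
  have [_ _ _] := bs_lip (X r w) (X r w) (ar r w rs).
  by rewrite /G (cl_id sT rs).
have mY : measurable_fun setT (fun w => `|idfun (X s w)| ^+ 2).
  apply: measurable_funX.
  have := measurableT_comp state_norm_measurable (pair1_measurable (s : measurableTypeR R)).
  by rewrite /comp /= clamp_id.
have lin_id : linear (idfun : H -> H) by [].
have id_le (y : H) : `|idfun y| <= 1 * `|y| by rewrite mul1r.
have b2 : {ae P, forall w, is_bochner `[t, s] (fun=> 0) (0 : H)}.
  by apply: aeW => w; exact: is_bochner0.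
(* The difference with the zero system, with the identity in place of iota. *)
have := volterra_step onbE refOm lin_id ler01 id_le ts sT YE b1 b2 i1 (is_ito0 H E Om t s) mG G0
  (fun r w => @fG r w) PG mY.
rewrite expr1n mul1r => /le_trans; apply; apply: leeD; last exact: lexx.
rewrite lee_fin ler_wpM2l// ler_sqr ?nnegrE//.
by have [_ _ _ + _] := semS; apply; rewrite subr_ge0.
Qed.

Let mXT : measurable_fun setT (fun z : (measurableTypeR R * Om)%type => hX z.1 z.2).
Proof. by apply/measurable_EFinP/measurable_funX; exact: state_norm_measurable. Qed.

Let maT : measurable_fun setT (fun z : (measurableTypeR R * Om)%type => ha z.1 z.2).
Proof. by apply/measurable_EFinP/measurable_funX; exact: control_norm_measurable. Qed.

Let sqr_add3_le (u v : R) : (1 + u + v) ^+ 2 <= 3 * (1 + u ^+ 2 + v ^+ 2).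
Proof.
clear; rewrite -subr_ge0.
have -> : 3 * (1 + u ^+ 2 + v ^+ 2) - (1 + u + v) ^+ 2 =
  (1 - u) ^+ 2 + (1 - v) ^+ 2 + (u - v) ^+ 2 by ring.
by rewrite !addr_ge0 ?sqr_ge0.
Qed.

Let G2_le s : t <= s <= T ->
  (\int[P]_w \int[mu]_(r in `[t, s]) ((C * (1 + `|X (cl r) w| + `|a (cl r) w|)) ^+ 2)%:E <=
   (3 * C ^+ 2)%:E * ((s - t)%:E + \int[P]_w \int[mu]_(r in `[t, s]) hX r w +
     \int[P]_w \int[mu]_(r in `[t, s]) ha r w))%E.
Proof.
move=> /andP[ts sT].
have k0 : 0 <= 3 * C ^+ 2 by rewrite mulr_ge0 ?sqr_ge0.
have one0 (r : R) (w : Om) : (0 <= 1%:E :> \bar R)%E by rewrite lee_fin.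
have m1 : measurable_fun (`[t, s] `*` [set: Om])
    (fun z : (measurableTypeR R * Om)%type => 1%:E : \bar R) by exact: measurable_cst.
have mXs := measurable_funS measurableT (@subsetT _ (`[t, s] `*` [set: Om])) mXT.
have mas := measurable_funS measurableT (@subsetT _ (`[t, s] `*` [set: Om])) maT.
have h10 (r : R) (w : Om) : (0 <= 1%:E + hX r w)%E by rewrite adde_ge0.
have h20 (r : R) (w : Om) : (0 <= 1%:E + hX r w + ha r w)%E by rewrite !adde_ge0.
rewrite -(mul1r (s - t)) -(double_integral_cst P ts ler01).
rewrite -(@double_integralD _ _ _ P t s (fun _ _ => 1%:E) hX one0 hX0 m1 mXs).
rewrite -(@double_integralD _ _ _ P t s (fun r w => 1%:E + hX r w)%E ha h10 ha0
  (emeasurable_funD m1 mXs) mas).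
rewrite -(@double_integralZl _ _ _ P t s (fun r w => 1%:E + hX r w + ha r w)%E _ k0 h20
  (emeasurable_funD (emeasurable_funD m1 mXs) mas)).
apply: (@double_integral_le _ _ _ P t s
  (fun r w => ((C * (1 + `|X (cl r) w| + `|a (cl r) w|)) ^+ 2)%:E)
  (fun r w => (3 * C ^+ 2)%:E * (1%:E + hX r w + ha r w))%E).
- by move=> r w; rewrite lee_fin sqr_ge0.
- by move=> r w; rewrite mule_ge0 ?lee_fin.
- apply: measurable_funTS; apply/measurable_EFinP/measurable_funX.
  apply: measurable_funM => //; apply: measurable_funD; last exact: control_norm_measurable.
  by apply: measurable_funD => //; exact: state_norm_measurable.
- apply: emeasurable_funM => //; exact: (emeasurable_funD (emeasurable_funD m1 mXs) mas).
- move=> r w _; rewrite /hX /ha -!EFinD -EFinM lee_fin exprMn.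
  rewrite (mulrC 3) -(mulrA (C ^+ 2) 3); apply: ler_wpM2l; first exact: sqr_ge0.
  exact: sqr_add3_le.
Qed.

Let seg_le (h : R -> Om -> \bar R) s : t <= s <= T -> (forall r w, (0 <= h r w)%E) ->
  measurable_fun setT (fun z : (measurableTypeR R * Om)%type => h z.1 z.2) ->
  (\int[P]_w \int[mu]_(r in `[t, s]) h r w <= \int[P]_w \int[mu]_(r in `[t, T]) h r w)%E.
Proof.
move=> /andP[ts sT] h0 mh.
have mh' u := measurable_funS measurableT (@subsetT _ (`[t, u] `*` [set: Om])) mh.
apply: ge0_le_integral => //.
- by move=> w _; apply: integral_ge0.
- exact: (segment_integral_measurable h0 (mh' s)).
- exact: (segment_integral_measurable h0 (mh' T)).
- move=> w _; apply: ge0_subset_integral => //.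
  + exact: (section_measurable w (mh' T)).
  + by move=> r /=; rewrite !in_itv /= => /andP[-> rs]; rewrite (le_trans rs).
Qed.

(** One mild step suffices, because state and control are already square integrable over [t, T]; the
    bound depends on the control. *)
Lemma state_moment_lty s : t <= s <= T ->
  (\int[P]_w (`|X s w| ^+ 2)%:E < +oo)%E.
Proof.
move=> tsT; apply: (le_lt_trans (state_moment_step tsT)).
have k3 : 0 <= 3 * C ^+ 2 by rewrite mulr_ge0 ?sqr_ge0.
have i0 (h : R -> Om -> \bar R) u : (forall r w, (0 <= h r w)%E) ->
    (0 <= \int[P]_w \int[mu]_(r in `[t, u]) h r w)%E.
  by move=> h0; apply: integral_ge0 => w _; apply: integral_ge0.
apply: lte_add_pinfty; first by rewrite ltry.
apply: lte_mul_pinfty; [by rewrite lee_fin ltW|by []|].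
apply: (le_lt_trans (G2_le tsT)).
apply: lte_mul_pinfty; [by rewrite lee_fin|by []|].
apply: lte_add_pinfty; first (apply: lte_add_pinfty; first by rewrite ltry).
- exact: (le_lt_trans (seg_le tsT hX0 mXT) state_sq_lty).
- exact: (le_lt_trans (seg_le tsT ha0 maT) control_sq_lty).
Qed.

Variable M : R.
Hypothesis M0 : 0 <= M.
Hypothesis aM : forall y, Lam0 y -> `|y| <= M.

Let m (s : measurableTypeR R) := (\int[P]_w (`|X (cl s) w| ^+ 2)%:E)%E.

(** Gronwall's constant when |a| <= M; the factor 3 C^2 stems from the square of C (1 + |X| + |a|).
    The bound is uniform over all admissible controls. *)
Definition growth_const := 2 * (3 * `|x| ^+ 2 + kap * (3 * C ^+ 2) * ((1 + M ^+ 2) * (T - t))) *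
  expR (2 * (kap * (3 * C ^+ 2)) * (T - t)).

Lemma state_moment_bounded s : t <= s <= T ->
  (\int[P]_w (`|X s w| ^+ 2)%:E <= growth_const%:E)%E.
Proof.
move=> tsT.
have m0 (r : R) : (0 <= m r)%E by exact: integral_ge0.
have mm : measurable_fun setT m.
  exact: (measurable_fun_fubini_tonelli_F _ mXT (fun z => hX0 z.1 z.2)).
have mXT' u := measurable_funS measurableT (@subsetT _ (`[t, u] `*` [set: Om])) mXT.
have swap u : (\int[P]_w \int[mu]_(r in `[t, u]) hX r w = \int[mu]_(r in `[t, u]) m r)%E.
  exact: (@double_integral_swap _ _ _ P t u hX hX0 (mXT' u)).
have T_t : 0 <= T - t by rewrite subr_ge0.
have k1 : 0 < kap * (3 * C ^+ 2) by rewrite !mulr_gt0// exprn_gt0.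
have K00 : 0 <= 3 * `|x| ^+ 2 + kap * (3 * C ^+ 2) * ((1 + M ^+ 2) * (T - t)).
  apply: addr_ge0; first by rewrite mulr_ge0 ?sqr_ge0.
  by rewrite mulr_ge0 ?(ltW k1)// mulr_ge0// addr_ge0// sqr_ge0.
have step u : t <= u <= T -> (m u <= (3 * `|x| ^+ 2 + kap * (3 * C ^+ 2) * ((1 + M ^+ 2) * (T - t)))%:E
    + (kap * (3 * C ^+ 2))%:E * \int[mu]_(r in `[t, u]) m r)%E.
  move=> tuT; have /andP[tu uT] := tuT.
  have mu_0 : (0 <= \int[mu]_(r in `[t, u]) m r)%E by exact: integral_ge0.
  rewrite /m clamp_id//; apply: (le_trans (state_moment_step tuT)).
  rewrite (EFinD (3 * `|x| ^+ 2)) -addeA; apply: leeD; first exact: lexx.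
  apply: (@le_trans _ _ (kap%:E * ((3 * C ^+ 2)%:E * (((1 + M ^+ 2) * (T - t))%:E +
      \int[mu]_(r in `[t, u]) m r)))%E).
    apply: lee_wpmul2l; first by rewrite lee_fin ltW.
    apply: (le_trans (G2_le tuT)).
    apply: lee_wpmul2l; first by rewrite lee_fin mulr_ge0 ?sqr_ge0.
    rewrite swap addeAC; apply: leeD; last exact: lexx.
    apply: (@le_trans _ _ ((u - t)%:E + (M ^+ 2 * (u - t))%:E)%E).
      apply: leeD; first exact: lexx.
      rewrite -(double_integral_cst P tu (sqr_ge0 M)).
      have maT' := measurable_funS measurableT (@subsetT _ (`[t, u] `*` [set: Om])) maT.
      apply: (@double_integral_le _ _ _ P t u ha (fun _ _ => (M ^+ 2)%:E) ha0) => //.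
      - by move=> r w; rewrite lee_fin sqr_ge0.
      - move=> r w rts; rewrite lee_fin ler_sqr ?nnegrE//; apply: aM.
        by have [+ _ _] := adm; apply; exact: clamp_itv.
    rewrite -EFinD lee_fin mulrDl mul1r; apply: lerD; first by rewrite lerD2r.
    by apply: ler_wpM2l; [exact: sqr_ge0|rewrite lerD2r].
  rewrite muleA -EFinM ge0_muleDr//.
  by rewrite lee_fin mulr_ge0// addr_ge0// sqr_ge0.
have fin : (\int[mu]_(r in `[t, T]) m r < +oo)%E.
  rewrite -swap; exact: state_sq_lty.
have := gronwall tT K00 k1 mm m0 step fin tsT.
by rewrite /m clamp_id.
Qed.

End Growth.

End MildEstimates.

(** * Cost and value function *)

Section TotalCost.
Variables (R : realType).
Local Notation mu := (@lebesgue_measure R).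

(** The function f may change sign and need not be integrable: its integral is at most that of its
    positive part, which h dominates. *)
Lemma ae_integral_le_ge0 d (U : measurableType d) (nu : {measure set U -> \bar R})
    (D : set U) (f h : U -> \bar R) : measurable D ->
  measurable_fun D f -> measurable_fun D h -> (forall u, (0 <= h u)%E) ->
  {ae nu, forall u, D u -> (f u <= h u)%E} ->
  (\int[nu]_(u in D) f u <= \int[nu]_(u in D) h u)%E.
Proof.
move=> mD mf mh h0 fh; rewrite integralE.
apply: (@le_trans _ _ (\int[nu]_(u in D) f^\+ u)%E).
  rewrite -[leRHS]adde0; apply: leeD; first exact: lexx.
  by rewrite oppe_le0; apply: integral_ge0.
apply: ae_ge0_le_integral => //; first exact: measurable_funepos.
by apply: filterS fh => u fh Du; rewrite funeposE ge_max fh//=.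
Qed.

Context dp (Om : measurableType dp) (P : probability Om R) (t T : R).
Local Notation D := (`[t, T] `*` [set: Om] : set (measurableTypeR R * Om)%type).

(* The real-valued integral is the junk value 0 where L is not integrable, which is
   a null event for integrable data. *)
Definition total (L : R -> Om -> R) (G : Om -> R) (w : Om) : R :=
  (\int[mu]_(s in `[t, T]) L s w) + G w.

Definition integrable_data (L : R -> Om -> R) (G : Om -> R) :=
  [/\ measurable_fun setT (fun z : (measurableTypeR R * Om)%type => L z.1 z.2),
      measurable_fun setT G,
      (\int[P]_w \int[mu]_(s in `[t, T]) `|L s w|%:E < +oo)%E &
      (\int[P]_w `|G w|%:E < +oo)%E].

Let mD (L : R -> Om -> R) :
  measurable_fun setT (fun z : (measurableTypeR R * Om)%type => L z.1 z.2) ->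
  measurable_fun D (fun z : (measurableTypeR R * Om)%type => (L z.1 z.2)%:E).
Proof. by move=> mL; apply: measurable_funTS; exact/measurable_EFinP. Qed.

Let mDn (L : R -> Om -> R) :
  measurable_fun setT (fun z : (measurableTypeR R * Om)%type => L z.1 z.2) ->
  measurable_fun D (fun z : (measurableTypeR R * Om)%type => `|L z.1 z.2|%:E).
Proof.
move=> mL; apply: (mD (L := fun s w => `|L s w|)).
by apply: measurableT_comp mL; exact: normr_measurable.
Qed.

Let abs0 (L : R -> Om -> R) (r : R) w : (0 <= `|L r w|%:E :> \bar R)%E.
Proof. by rewrite lee_fin. Qed.

(** A finite expectation of the integral of |L| forces that integral to be finite almost surely. *)
Lemma ae_integrable_running L G : integrable_data L G ->
  {ae P, forall w, mu.-integrable `[t, T] (fun s => (L s w)%:E)}.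
Proof.
case=> mL _ fL _.
have iL : P.-integrable setT (fun w => \int[mu]_(s in `[t, T]) `|L s w|%:E)%E.
  apply/integrableP; split.
    exact: (segment_integral_measurable (abs0 L) (mDn mL)).
  apply: le_lt_trans fL; rewrite le_eqVlt; apply/orP; left; apply/eqP.
  by apply: eq_integral => w _; rewrite gee0_abs//; apply: integral_ge0.
have := integrable_ae measurableT iL; apply: filterS => w /(_ Logic.I) fw.
apply/integrableP; split; first exact: (@section_measurable _ _ _ t T (fun s w => (L s w)%:E) w (mD mL)).
by move: fw; rewrite ge0_fin_numE//; apply: integral_ge0.
Qed.

Let running_measurable L :
  measurable_fun setT (fun z : (measurableTypeR R * Om)%type => L z.1 z.2) ->
  measurable_fun setT (fun w => \int[mu]_(s in `[t, T]) (L s w)%:E)%E.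
Proof.
move=> mL.
have pos (h : R -> Om -> \bar R) : measurable_fun D (fun z => h z.1 z.2) ->
    measurable_fun setT (fun w => \int[mu]_(s in `[t, T]) maxe (h s w) 0)%E.
  move=> mh; apply: (segment_integral_measurable (h := fun s w => maxe (h s w) 0)%E).
    by move=> r w; rewrite le_max lexx orbT.
  by apply: measurable_maxe => //; exact: measurable_cst.
rewrite (_ : (fun w => _) = (fun w => \int[mu]_(s in `[t, T]) maxe (L s w)%:E 0 -
    \int[mu]_(s in `[t, T]) maxe (- (L s w)%:E) 0)%E); last first.
  apply/funext => w; rewrite integralE.
  by congr (_ - _)%E; apply: eq_integral => s _; rewrite ?funeposE ?funenegE.
apply: emeasurable_funB.
  exact: (pos (fun s w => (L s w)%:E) (mD mL)).
apply: (pos (fun s w => - (L s w)%:E)%E).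
exact: (measurableT_comp (@oppe_measurable _ setT) (mD mL)).
Qed.

Lemma total_integrable L G : integrable_data L G ->
  P.-integrable setT (fun w => (total L G w)%:E).
Proof.
case=> mL mG fL fG; have mR := running_measurable mL.
have mRn := segment_integral_measurable (abs0 L) (mDn mL).
have mGn : measurable_fun setT (fun w => `|G w|%:E : \bar R).
  by apply/measurable_EFinP; apply: measurableT_comp mG; exact: normr_measurable.
apply/integrableP; split.
  apply/measurable_EFinP; apply: measurable_funD => //.
  exact: (measurableT_comp (fine_measurable measurableT) mR).
apply: (@le_lt_trans _ _
    (\int[P]_w (\int[mu]_(s in `[t, T]) `|L s w|%:E + `|G w|%:E))%E).
  apply: ge0_le_integral => //.
  - apply: measurableT_comp => //; apply/measurable_EFinP; apply: measurable_funD => //.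
    exact: (measurableT_comp (fine_measurable measurableT) mR).
  - exact: emeasurable_funD.
  move=> w _; rewrite /total abse_EFin.
  apply: (@le_trans _ _ (`|\int[mu]_(s in `[t, T]) L s w|%:E + `|G w|%:E)%E).
    by rewrite -EFinD lee_fin ler_normD.
  apply: leeD; last exact: lexx.
  apply: (@le_trans _ _ `|\int[mu]_(s in `[t, T]) (L s w)%:E|%E).
    by rewrite /Rintegral; case: (\int[_]_(_ in _) _)%E => [r| |] //=; rewrite ?normr0 leey.
  have := le_abse_integral mu (measurable_itv `[t, T]) (@section_measurable _ _ _ t T (fun s w => (L s w)%:E) w (mD mL)).
  exact.
rewrite ge0_integralD//; first exact: lte_add_pinfty.
by move=> w _; apply: integral_ge0.
Qed.

(** The common form of the cost comparisons: against constant or zero data for lower bounds, and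
    between two initial points for the Lipschitz estimate. The errors DL and DG are nonnegative and
    may have infinite integrals. *)
Lemma total_le L1 G1 L2 G2 (DL : R -> Om -> R) (DG : Om -> R) : integrable_data L1 G1 -> integrable_data L2 G2 ->
  measurable_fun setT (fun z : (measurableTypeR R * Om)%type => DL z.1 z.2) ->
  measurable_fun setT DG -> (forall s w, 0 <= DL s w) -> (forall w, 0 <= DG w) ->
  (forall s w, t <= s <= T -> L1 s w <= L2 s w + DL s w) ->
  (forall w, G1 w <= G2 w + DG w) ->
  (\int[P]_w (total L1 G1 w)%:E <= \int[P]_w (total L2 G2 w)%:E +
     (\int[P]_w \int[mu]_(s in `[t, T]) (DL s w)%:E + \int[P]_w (DG w)%:E))%E.
Proof.
move=> i1 i2 mDL mDG DL0 DG0 L12 G12.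
have t1 := total_integrable i1; have t2 := total_integrable i2.
have f2 := integrable_fin_num measurableT t2.
have DL0' (r : R) w : (0 <= (DL r w)%:E :> \bar R)%E by rewrite lee_fin.
have mI := segment_integral_measurable DL0' (mD mDL).
have I0 w : (0 <= \int[mu]_(s in `[t, T]) (DL s w)%:E :> \bar R)%E by apply: integral_ge0.
rewrite -leeBlDl// -integralB_EFin// -ge0_integralD//; last 2 first.
- by move=> w _; rewrite lee_fin.
- exact/measurable_EFinP.
apply: ae_integral_le_ge0 => //.
- by apply: emeasurable_funB; [case/integrableP: t1|case/integrableP: t2].
- by apply: emeasurable_funD => //; exact/measurable_EFinP.
- by move=> w; rewrite adde_ge0 ?lee_fin.
have := ae_integrable_running i1; apply: filterS2 (ae_integrable_running i2) => w w2 w1 _.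
rewrite -EFinB /total opprD addrACA EFinD; apply: leeD; last first.
  by rewrite lee_fin lerBlDl.
rewrite -RintegralB//= /Rintegral fineK; last first.
  apply: integrable_fin_num => //; rewrite (_ : (fun _ => _) = (fun s => (L1 s w)%:E) \- (fun s => (L2 s w)%:E))%E//; exact: integrableB.
apply: ae_integral_le_ge0 => //.
- by have /integrableP[] : mu.-integrable `[t, T] ((fun s => (L1 s w)%:E) \- (fun s => (L2 s w)%:E))%E
    by exact: integrableB.
- exact: (@section_measurable _ _ _ t T (fun s w => (DL s w)%:E) w (mD mDL)).
- by apply: aeW => s /= /L12; rewrite lee_fin lerBlDl.
Qed.

End TotalCost.

Section AffineIntegrals.
Variables (R : realType).
Context dp (Om : measurableType dp) (P : probability Om R) (t s : R).
Hypothesis ts : t <= s.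
Local Notation mu := (@lebesgue_measure R).
Local Notation D := (`[t, s] `*` [set: Om] : set (measurableTypeR R * Om)%type).

Variables (h : R -> Om -> R) (al be : R).
Hypothesis al0 : 0 <= al.
Hypothesis be0 : 0 <= be.
Hypothesis h0 : forall r w, 0 <= h r w.
Hypothesis mh : measurable_fun setT (fun z : (measurableTypeR R * Om)%type => h z.1 z.2).

Let h0' (r : R) w : (0 <= (h r w)%:E :> \bar R)%E. Proof. by rewrite lee_fin. Qed.

Let mh' : measurable_fun D (fun z : (measurableTypeR R * Om)%type => (h z.1 z.2)%:E).
Proof. by apply: measurable_funTS; exact/measurable_EFinP. Qed.

Lemma double_integral_affine :
  (\int[P]_w \int[mu]_(r in `[t, s]) (al + be * h r w)%:E =
   (al * (s - t))%:E + be%:E * \int[P]_w \int[mu]_(r in `[t, s]) (h r w)%:E)%E.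
Proof.
have mc : measurable_fun D (fun z : (measurableTypeR R * Om)%type => al%:E).
  exact: measurable_cst.
have mz : measurable_fun D (fun z : (measurableTypeR R * Om)%type => be%:E * (h z.1 z.2)%:E)%E.
  by apply: emeasurable_funM => //; exact: measurable_cst.
rewrite -(double_integral_cst P ts al0).
rewrite -(@double_integralZl _ _ _ P t s (fun r w => (h r w)%:E) be be0 h0' mh').
rewrite -(@double_integralD _ _ _ P t s (fun _ _ => al%:E) (fun r w => be%:E * (h r w)%:E)%E)//.
by move=> r w; rewrite -EFinM lee_fin mulr_ge0.
Qed.

Lemma double_integral_bound Ga :
  (forall r, t <= r <= s -> (\int[P]_w (h r w)%:E <= Ga%:E)%E) ->
  (\int[P]_w \int[mu]_(r in `[t, s]) (h r w)%:E <= (Ga * (s - t))%:E)%E.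
Proof.
move=> hG.
have Ga0 : 0 <= Ga.
  rewrite -lee_fin; apply: le_trans (hG t _); last by rewrite lexx.
  by apply: integral_ge0 => w _.
rewrite (@double_integral_swap _ _ _ P t s (fun r w => (h r w)%:E) h0' mh').
apply: (@le_trans _ _ (\int[mu]_(r in `[t, s]) Ga%:E)%E).
  apply: ge0_le_integral => //.
  - by move=> r _; apply: integral_ge0.
  - apply: measurable_funTS.
    have m1 : measurable_fun setT (fun z : (measurableTypeR R * Om)%type => (h z.1 z.2)%:E).
      exact/measurable_EFinP.
    exact: (measurable_fun_fubini_tonelli_F _ m1 (fun z => h0' z.1 z.2)).
by rewrite integral_cst// [X in (_ * X)%E]lebesgue_measure_segment.
Qed.

End AffineIntegrals.

Section AffineExpectation.
Variables (R : realType).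
Context dp (Om : measurableType dp) (P : probability Om R).

Lemma integral_affine (h : Om -> R) (al be : R) : 0 <= al -> 0 <= be -> (forall w, 0 <= h w) ->
  measurable_fun setT h ->
  (\int[P]_w (al + be * h w)%:E = al%:E + be%:E * \int[P]_w (h w)%:E)%E.
Proof.
move=> al0 be0 h0 mh.
under eq_integral do rewrite EFinD EFinM.
rewrite ge0_integralD//; last 2 first.
- by move=> w _; rewrite -EFinM lee_fin mulr_ge0.
- by apply/measurable_EFinP; apply: measurable_funM => //; exact: measurable_cst.
rewrite integral_cst// [X in (_ * X)%E]probability_setT mule1 ge0_integralZl_EFin//.
- by move=> w _; rewrite lee_fin.
- exact/measurable_EFinP.
Qed.

End AffineExpectation.

Lemma le_add1_sqr (R : realType) (y : R) : y <= 1 + y ^+ 2.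
Proof. have h1 := sqr_ge0 (y - 1); have h2 := sqr_ge0 y; nra. Qed.

(** * Bounds and Lipschitz dependence of the cost *)

Section CostEstimates.
Variables (R : realType) (H Xi Hm : hilbertType R) (Lam : normedModType R).
Variables (Lam0 : set Lam) (B : H -> H) (iota : H -> Hm).
Variables (l : H -> Lam -> R) (g : H -> R) (c Cl t T : R) (Om : ref_space Xi).
Hypothesis sepH : separable H.
Hypothesis sepLam : separable Lam.
Hypothesis hiota : completion_m1 B iota.
Hypothesis c_gt0 : 0 < c.
Hypothesis iota_le : forall x, `|iota x| <= c * `|x|.
Hypothesis Cl0 : 0 < Cl.
Hypothesis l_cont :
  {within [set z : H * Lam | Lam0 z.2], continuous (fun z => l z.1 z.2)}.
Hypothesis l_lip : forall x x' a, Lam0 a -> `|l x a - l x' a| <= Cl * norm_m1 B (x - x').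
Hypothesis l_growth : forall x a, Lam0 a -> `|l x a| <= Cl * (1 + `|x| + `|a| ^+ 2).
Hypothesis g_lip : forall x x', `|g x - g x'| <= Cl * norm_m1 B (x - x').
Hypothesis tT : t <= T.
Local Notation P := (ref_P Om).
Local Notation mu := (@lebesgue_measure R).
Local Notation cl := (clamp t T).

(** What the cost estimates use of a state and its control, detached from the state equation. Times
    are clamped so that measurability is a statement on the whole product. *)
Definition square_integrable_pair (X : R -> Om -> H) (a : R -> Om -> Lam) :=
  [/\ open_measurable_fun (fun z : (measurableTypeR R * Om)%type => X (cl z.1) z.2),
      open_measurable_fun (fun z : (measurableTypeR R * Om)%type => a (cl z.1) z.2),
      forall s w, t <= s <= T -> Lam0 (a s w),
      (\int[P]_w \int[mu]_(r in `[t, T]) (`|X (cl r) w| ^+ 2 + `|a (cl r) w| ^+ 2)%:E < +oo)%E &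
      (\int[P]_w (`|X T w| ^+ 2)%:E < +oo)%E].

Let norm_measurable (V : normedModType R) (Z : R -> Om -> V) :
  open_measurable_fun (fun z : (measurableTypeR R * Om)%type => Z (cl z.1) z.2) ->
  measurable_fun setT (fun z : (measurableTypeR R * Om)%type => `|Z (cl z.1) z.2|).
Proof.
move=> mZ; apply: (open_measurable_comp mZ).
by move=> y; apply: cvg_norm; exact: cvg_id.
Qed.

Let cT : cl T = T. Proof. by rewrite clamp_id// tT lexx. Qed.

Let at_T (f : H -> R) (X : R -> Om -> H) : continuous f ->
  open_measurable_fun (fun z : (measurableTypeR R * Om)%type => X (cl z.1) z.2) ->
  measurable_fun setT (fun w => f (X T w)).
Proof.
move=> cf mX.
have := measurableT_comp (open_measurable_comp mX cf) (pair1_measurable (T : measurableTypeR R)).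
by rewrite /comp /= cT.
Qed.

Let g_cont : continuous g.
Proof.
move=> x; apply/cvgrPdist_le => e e0; near=> y.
rewrite (le_trans (g_lip _ _))// (norm_m1E hiota).
rewrite -ler_pdivlMl// (le_trans (iota_le _))// -ler_pdivlMl//.
near: y; apply: cvgr_dist_le; first exact: cvg_id.
by rewrite !mulr_gt0 ?invr_gt0.
Unshelve. all: by end_near. Qed.

Let norm_cont : continuous (fun x : H => `|x|).
Proof. by move=> y; apply: cvg_norm; exact: cvg_id. Qed.

Let g_growth x : `|g x| <= (`|g 0| + Cl * c) + Cl * c * `|x| ^+ 2.
Proof.
have h : `|g x| <= `|g 0| + `|g x - g 0| by rewrite -{1}(subrK (g 0) (g x)) addrC ler_normD.
apply: (le_trans h); rewrite -addrA lerD2l (le_trans (g_lip _ _))// (norm_m1E hiota) subr0.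
rewrite -{1}(mulr1 (Cl * c)) -mulrDr -mulrA ler_wpM2l ?(ltW Cl0)//.
apply: (le_trans (iota_le _)); apply: ler_wpM2l; [exact: ltW|exact: le_add1_sqr].
Qed.

Let l_growth2 x a : Lam0 a -> `|l x a| <= 2 * Cl + Cl * (`|x| ^+ 2 + `|a| ^+ 2).
Proof.
move=> a0; apply: (le_trans (l_growth x a0)).
rewrite (mulrC 2) -mulrDr ler_wpM2l ?(ltW Cl0)// addrA lerD2r.
have := le_add1_sqr `|x|; set y := `|x|; lra.
Qed.

Section OnePair.
Variables (X : R -> Om -> H) (a : R -> Om -> Lam).
Hypothesis hXa : square_integrable_pair X a.

Let L (s : R) (w : Om) := l (X (cl s) w) (a (cl s) w).
Let G (w : Om) := g (X T w).

Let aL s w : Lam0 (a (cl s) w).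
Proof. by have [_ _ + _ _] := hXa; apply; exact: clamp_itv. Qed.

Let mL : measurable_fun setT (fun z : (measurableTypeR R * Om)%type => L z.1 z.2).
Proof.
have [mX ma _ _ _] := hXa.
exact: (within_open_measurable (fun z => aL z.1 z.2) (open_measurable_pair sepH sepLam mX ma) l_cont).
Qed.

Let mX2 : measurable_fun setT (fun z : (measurableTypeR R * Om)%type => `|X (cl z.1) z.2| ^+ 2).
Proof. by have [mX _ _ _ _] := hXa; apply: measurable_funX; exact: norm_measurable. Qed.

Let ma2 : measurable_fun setT (fun z : (measurableTypeR R * Om)%type => `|a (cl z.1) z.2| ^+ 2).
Proof. by have [_ ma _ _ _] := hXa; apply: measurable_funX; exact: norm_measurable. Qed.

Let mXT : measurable_fun setT (fun w => `|X T w| ^+ 2).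
Proof.
have [mX _ _ _ _] := hXa; apply: measurable_funX.
exact: (at_T norm_cont mX).
Qed.

Let gc0 : 0 <= `|g 0| + Cl * c.
Proof. by rewrite addr_ge0// mulr_ge0// ltW. Qed.

Let Clc0 : 0 <= Cl * c. Proof. by rewrite mulr_ge0// ltW. Qed.

Lemma cost_integrable_data : integrable_data P t T L G.
Proof.
have [mX ma _ fL fG] := hXa; split.
- exact: mL.
- exact: (at_T g_cont mX).
- have h0 (r : R) w : 0 <= `|X (cl r) w| ^+ 2 + `|a (cl r) w| ^+ 2 by rewrite addr_ge0 ?sqr_ge0.
  have mh := measurable_funD mX2 ma2.
  have C2 : 0 <= 2 * Cl by rewrite mulr_ge0// ltW.
  apply: (@le_lt_trans _ _ (\int[P]_w \int[mu]_(r in `[t, T])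
      (2 * Cl + Cl * (`|X (cl r) w| ^+ 2 + `|a (cl r) w| ^+ 2))%:E)%E).
    apply: (@double_integral_le _ _ _ P t T (fun r w => `|L r w|%:E)
      (fun r w => (2 * Cl + Cl * (`|X (cl r) w| ^+ 2 + `|a (cl r) w| ^+ 2))%:E)).
    + by move=> r w; rewrite lee_fin.
    + by move=> r w; rewrite lee_fin addr_ge0// mulr_ge0// ltW.
    + apply: measurable_funTS; apply/measurable_EFinP.
      by apply: measurableT_comp mL; exact: normr_measurable.
    + apply: measurable_funTS; apply/measurable_EFinP.
      apply: measurable_funD; first exact: measurable_cst.
      by apply: measurable_funM => //; exact: measurable_cst.
    + by move=> r w _; rewrite lee_fin l_growth2.
  rewrite (double_integral_affine P tT C2 (ltW Cl0) h0 mh).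
  apply: lte_add_pinfty; first by rewrite ltry.
  by apply: lte_mul_pinfty; [rewrite lee_fin ltW|by []|exact: fL].
- apply: (@le_lt_trans _ _ (\int[P]_w ((`|g 0| + Cl * c) + Cl * c * `|X T w| ^+ 2)%:E)%E).
    apply: ge0_le_integral => //.
    + apply/measurable_EFinP; apply: measurableT_comp (at_T g_cont mX); exact: normr_measurable.
    + apply/measurable_EFinP; apply: measurable_funD; first exact: measurable_cst.
      by apply: measurable_funM => //; exact: measurable_cst.
    + by move=> w _; rewrite lee_fin g_growth.
  rewrite (integral_affine P gc0 Clc0 (fun w => sqr_ge0 _) mXT).
  apply: lte_add_pinfty; first by rewrite ltry.
  by apply: lte_mul_pinfty; [rewrite lee_fin|by []|exact: fG].
Qed.

Lemma costE : cost l g t T X a = (\int[P]_w (total t T L G w)%:E)%E.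
Proof.
rewrite /cost unlock; apply: eq_integral => w _; congr (_%:E).
rewrite /total; congr (_ + _); apply: eq_Rintegral => s; rewrite inE /= in_itv /= => tsT.
by rewrite /L clamp_id.
Qed.

Lemma cost_fin_num : cost l g t T X a \is a fin_num.
Proof.
rewrite costE; apply: integrable_fin_num => //.
exact: (total_integrable cost_integrable_data).
Qed.

(** Comparison with the constant data m, whose total cost is m (T - t) + m; it serves for an
    unbounded control set. *)
Lemma cost_lower_bound m : (forall x a, Lam0 a -> m <= l x a) -> (forall x, m <= g x) ->
  ((m * (T - t) + m)%:E <= cost l g t T X a)%E.
Proof.
move=> ml mg; rewrite costE.
have i0 : integrable_data P t T (fun _ _ => m) (fun _ => m).
  split; [exact: measurable_cst|exact: measurable_cst| |].
    by rewrite double_integral_cst// ltry.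
  by rewrite integral_cst// [X in (_ * X)%E]probability_setT mule1 ltry.
have := total_le i0 cost_integrable_data (DL := fun _ _ => 0) (DG := fun=> 0).
rewrite (_ : \int[P]_w (0 : R)%:E = 0)%E; last exact: integral0_eq.
rewrite (_ : \int[P]_w \int[mu]_(s in `[t, T]) (0 : R)%:E = 0)%E; last first.
  by apply: integral0_eq => w _; exact: integral0_eq.
rewrite !adde0.
have -> : (\int[P]_w (total t T (fun _ _ => m) (fun=> m) w)%:E = (m * (T - t) + m)%:E)%E.
  have -> : (fun w : Om => (total t T (fun _ _ => m) (fun=> m) w)%:E) = cst (m * (T - t) + m)%:E.
    apply/funext => w; rewrite /total /Rintegral integral_cst// [X in (_ * X)%E]lebesgue_measure_segment//.
  by rewrite integral_cst// [X in (_ * X)%E]probability_setT mule1.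
apply => //.
- by move=> s w _; rewrite addr0 ml.
- by move=> w; rewrite addr0; exact: mg.
Qed.

(** Comparison of the zero data with the true cost, the errors being the quadratic majorants of |l|
    and |g|. With a moment bound [Ga] uniform over controls, so is the lower bound; it serves for a
    bounded control set. *)
Lemma cost_lower_bound_moment M Ga : 0 <= M -> (forall y, Lam0 y -> `|y| <= M) ->
  (forall s, t <= s <= T -> (\int[P]_w (`|X s w| ^+ 2)%:E <= Ga%:E)%E) ->
  ((- ((Cl * (2 + M ^+ 2) + Cl * Ga) * (T - t) + (`|g 0| + Cl * c + Cl * c * Ga)))%:E
    <= cost l g t T X a)%E.
Proof.
move=> M0 aM hGa; rewrite costE.
have [mX _ _ _ _] := hXa.
have i0 : integrable_data P t T (fun _ _ => 0) (fun _ => 0).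
  split; [exact: measurable_cst|exact: measurable_cst| |].
    by rewrite integral0_eq// => w _; rewrite integral0_eq// => s _; rewrite normr0.
  by rewrite integral0_eq// => w _; rewrite normr0.
pose h (r : R) (w : Om) : R := `|X (cl r) w| ^+ 2.
pose al := Cl * (2 + M ^+ 2).
have al0 : 0 <= al by rewrite mulr_ge0 ?(ltW Cl0)// addr_ge0// sqr_ge0.
have h0 (r : R) (w : Om) : 0 <= h r w by exact: sqr_ge0.
have hGa' r : t <= r <= T -> (\int[P]_w (h r w)%:E <= Ga%:E)%E.
  by move=> tr; rewrite /h clamp_id//; exact: hGa.
have mDL : measurable_fun setT (fun z : (measurableTypeR R * Om)%type => al + Cl * h z.1 z.2).
  apply: measurable_funD; first exact: measurable_cst.
  by apply: measurable_funM; [exact: measurable_cst|exact: mX2].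
have mDG : measurable_fun setT (fun w => (`|g 0| + Cl * c) + Cl * c * `|X T w| ^+ 2).
  apply: measurable_funD; first exact: measurable_cst.
  by apply: measurable_funM; [exact: measurable_cst|exact: mXT].
have DL0 (r : R) (w : Om) : 0 <= al + Cl * h r w by rewrite addr_ge0// mulr_ge0// ltW.
have DG0 (w : Om) : 0 <= (`|g 0| + Cl * c) + Cl * c * `|X T w| ^+ 2.
  by rewrite addr_ge0// mulr_ge0// sqr_ge0.
have le0D (u v : R) : `|u| <= v -> 0 <= u + v.
  by move=> uv; rewrite -lerBlDl sub0r (le_trans (ler_norm _))// normrN.
have hL (s : R) (w : Om) : t <= s <= T -> 0 <= L s w + (al + Cl * h s w).
  move=> _; apply: le0D; apply: (le_trans (l_growth2 _ (aL s w))).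
  have : `|a (cl s) w| ^+ 2 <= M ^+ 2 by rewrite ler_sqr ?nnegrE//; exact: aM.
  move=> /(ler_wpM2l (ltW Cl0)); rewrite /al /h !mulrDr; move: (_ ^+ 2) (_ ^+ 2) => u v; lra.
have hG (w : Om) : 0 <= G w + (`|g 0| + Cl * c + Cl * c * `|X T w| ^+ 2).
  by apply: le0D; exact: g_growth.
have := total_le i0 cost_integrable_data mDL mDG DL0 DG0 hL hG.
have -> : (\int[P]_w (total t T (fun _ _ => 0) (fun=> 0) w)%:E = 0)%E.
  by apply: integral0_eq => w _; rewrite /total /Rintegral integral0_eq ?addr0.
rewrite (double_integral_affine P tT al0 (ltW Cl0) h0 mX2).
rewrite (integral_affine P gc0 Clc0 (fun w => sqr_ge0 _) mXT) => hle.
rewrite EFinN leeNl -[leLHS]add0e leeBlDr; last first.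
  exact: (integrable_fin_num measurableT (total_integrable cost_integrable_data)).
rewrite addeC; apply: (le_trans hle); apply: leeD; first exact: lexx.
rewrite [in leRHS]EFinD; apply: leeD.
  rewrite -/al (mulrDl al) [in leRHS]EFinD -mulrA [in leRHS](EFinM Cl).
  apply: leeD; first exact: lexx.
  apply: lee_wpmul2l; first by rewrite lee_fin ltW.
  exact: (double_integral_bound tT h0 mX2 hGa').
rewrite [in leRHS]EFinD [in leRHS](EFinM (Cl * c)); apply: leeD; first exact: lexx.
apply: lee_wpmul2l; first by rewrite lee_fin.
by apply: hGa; rewrite tT lexx.
Qed.

End OnePair.

Variables (X1 X2 : R -> Om -> H) (a : R -> Om -> Lam).
Hypothesis hX1 : square_integrable_pair X1 a.
Hypothesis hX2 : square_integrable_pair X2 a.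

(** The hypothesis bounds second moments by K de^2, while a first moment of order de is wanted. The
    inequality Cl u <= (Cl / 2) de + (Cl / (2 de)) u^2, with the distance de itself as weight,
    provides it; the factor T - t + 1 counts running and terminal cost. *)
Lemma cost_difference_le (K de : R) : 0 <= K -> 0 < de ->
  (forall s, t <= s <= T ->
    (\int[P]_w (`|iota (X1 s w - X2 s w)| ^+ 2)%:E <= (K * de ^+ 2)%:E)%E) ->
  (cost l g t T X1 a <=
    cost l g t T X2 a + (Cl / 2 * (1 + K) * (T - t + 1) * de)%:E)%E.
Proof.
move=> K0 de0 hK; rewrite (costE X1) (costE X2).
have [mX1 _ aL _ _] := hX1; have [mX2 _ _ _ _] := hX2.
pose h (r : R) (w : Om) : R := `|iota (X1 (cl r) w - X2 (cl r) w)| ^+ 2.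
have h0 (r : R) (w : Om) : 0 <= h r w by exact: sqr_ge0.
have h0T (w : Om) : 0 <= h T w by exact: h0.
have mh : measurable_fun setT (fun z : (measurableTypeR R * Om)%type => h z.1 z.2).
  apply: measurable_funX.
  apply: (open_measurable_comp (f := fun z : (measurableTypeR R * Om)%type =>
    (X1 (cl z.1) z.2, X2 (cl z.1) z.2)) (g := fun p : H * H => `|iota (p.1 - p.2)|)).
    by apply: open_measurable_pair.
  by case: hiota => lin _ _; exact: (continuous_norm_iotaB lin c_gt0 iota_le).
have mhT : measurable_fun setT (fun w => h T w).
  exact: (measurableT_comp mh (pair1_measurable (T : measurableTypeR R))).
have hK' r : t <= r <= T -> (\int[P]_w (h r w)%:E <= (K * de ^+ 2)%:E)%E.
  by move=> tr; rewrite /h clamp_id//; exact: hK.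
pose al := Cl / 2 * de; pose be := Cl / 2 / de.
have al0 : 0 <= al by rewrite /al mulr_ge0 ?divr_ge0 ?ltW.
have be0 : 0 <= be by rewrite /be !divr_ge0 ?ltW.
have bde : be * (K * de ^+ 2) = Cl / 2 * K * de.
  by rewrite /be; field; rewrite gt_eqF.
have amgm (u : R) : Cl * u <= al + be * u ^+ 2.
  have -> : al + be * u ^+ 2 = Cl * u + be * (de - u) ^+ 2.
    by rewrite /al /be; field; rewrite gt_eqF.
  by rewrite lerDl mulr_ge0// sqr_ge0.
have mDL : measurable_fun setT (fun z : (measurableTypeR R * Om)%type => al + be * h z.1 z.2).
  apply: measurable_funD; first exact: measurable_cst.
  by apply: measurable_funM; [exact: measurable_cst|exact: mh].
have mDG : measurable_fun setT (fun w => al + be * h T w).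
  apply: measurable_funD; first exact: measurable_cst.
  by apply: measurable_funM; [exact: measurable_cst|exact: mhT].
have DL0 (r : R) (w : Om) : 0 <= al + be * h r w by rewrite addr_ge0// mulr_ge0.
have leD (u v d : R) (y : H) : `|u - v| <= Cl * norm_m1 B y ->
    Cl * `|iota y| <= d -> u <= v + d.
  rewrite (norm_m1E hiota) => uv yd; rewrite -lerBlDl (le_trans (ler_norm _))//.
  exact: le_trans uv yd.
have hL (s : R) (w : Om) : t <= s <= T ->
    l (X1 (cl s) w) (a (cl s) w) <= l (X2 (cl s) w) (a (cl s) w) + (al + be * h s w).
  by move=> tsT; apply: leD (amgm _); apply: l_lip; apply: aL; exact: clamp_itv.
have hG (w : Om) : g (X1 T w) <= g (X2 T w) + (al + be * h T w).
  by rewrite /h cT; apply: leD (amgm _); exact: g_lip.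
have := total_le (cost_integrable_data hX1) (cost_integrable_data hX2)
  mDL mDG DL0 (DL0 T) hL hG.
rewrite (double_integral_affine P tT al0 be0 h0 mh).
rewrite (integral_affine P al0 be0 h0T mhT).
move=> /le_trans; apply; apply: leeD; first exact: lexx.
apply: (@le_trans _ _ ((al * (T - t))%:E + (be * (K * de ^+ 2 * (T - t)))%:E +
    (al%:E + (be * (K * de ^+ 2))%:E))%E).
  apply: leeD; apply: leeD; try exact: lexx.
    rewrite [in leRHS](EFinM be); apply: lee_wpmul2l; first by rewrite lee_fin.
    exact: (double_integral_bound tT h0 mh hK').
  rewrite [in leRHS](EFinM be); apply: lee_wpmul2l; first by rewrite lee_fin.
  by apply: hK'; rewrite tT lexx.
rewrite -!EFinD lee_fin mulrA bde /al le_eqVlt; apply/orP; left; apply/eqP; ring.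
Qed.

End CostEstimates.

Section ConstantControl.
Variables (R : realType) (Xi : hilbertType R) (Lam : normedModType R).
Variables (Lam0 : set Lam) (p t T : R) (Om : ref_space Xi).

(** A constant control makes the set of costs nonempty, so that the infimum is not +oo. Preimages
    under it are empty or everything. *)
Lemma constant_admissible (a0 : Lam) : t <= T -> Lam0 a0 ->
  admissible (Om := Om) Lam0 p t T (fun _ _ => a0).
Proof.
move=> tT a00; split.
- by [].
- move=> s _ O _; set G := (G in smallest _ G).
  have [sig0 sigC _] := smallest_sigma_algebra (`[t, s] `*` [set: Om]) G.
  have [Oa|Oa] := pselect (O a0).
    have -> : (`[t, s] `*` [set: Om]) `&` [set z | O a0] =
        (`[t, s] `*` [set: Om]) `\` set0.
      by rewrite setD0; apply/seteqP; split => [z []//|z Dz]; split.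
    exact: sigC.
  have -> : (`[t, s] `*` [set: Om]) `&` [set z | O a0] = set0; last exact: sig0.
  by apply/seteqP; split => z // [].
- by rewrite double_integral_cst ?powR_ge0// ltry.
Qed.

End ConstantControl.

(** * Finiteness and Lipschitz continuity of the value function *)

Section ValueFunction.
Variables (R : realType) (H Xi Hm : hilbertType R) (Lam : normedModType R).
Variables (E : set Xi) (Lam0 : set Lam) (B : H -> H) (S : R -> H -> H) (iota : H -> Hm).
Variables (b : H -> Lam -> H) (sigma : H -> Lam -> Xi -> H) (l : H -> Lam -> R) (g : H -> R).
Variables (c c0 p t T : R) (Om : ref_space Xi).
Hypothesis onbE : orthonormal_basis E.
Hypothesis sepH : separable H.
Hypothesis sepLam : separable Lam.
Hypothesis Lam0_neq0 : Lam0 !=set0.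
Hypothesis p2 : 2 < p.
Hypothesis semS : contraction_semigroup S.
Hypothesis hiota : completion_m1 B iota.
Hypothesis c_gt0 : 0 < c.
Hypothesis iota_le : forall x, `|iota x| <= c * `|x|.
Hypothesis iota_inj : forall x, `|iota x| = 0 -> x = 0.
Hypothesis c00 : 0 <= c0.
Hypothesis S_iota : forall s x, 0 <= s ->
  `|iota (S s x)| ^+ 2 <= expR (2 * c0 * s) * `|iota x| ^+ 2.
Hypothesis hbs : dynamics_assumptions E Lam0 B b sigma.
Hypothesis hlg : cost_assumptions Lam0 B l g.
Hypothesis sigma_HS : forall x a, hilbert_schmidt E (sigma x a).
Hypothesis tT : t <= T.
Hypothesis refOm : reference_space Om t T.
Variable X : H -> (R -> Om -> Lam) -> R -> Om -> H.
Hypothesis hX : forall x a, admissible Lam0 p t T a ->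
  mild_solution E S b sigma t T x a (X x a).
Local Notation P := (ref_P Om).
Local Notation mu := (@lebesgue_measure R).

Lemma admissible_square_integrable x a : admissible Lam0 p t T a ->
  square_integrable_pair Lam0 t T (X x a) a.
Proof.
move=> adm; have mild := hX x adm.
have [_ _ [C C0 bs]] := hbs.
have mX := mild_joint_measurable sepH tT refOm mild.
have ma := control_joint_measurable tT refOm adm.
have norm2 (V : normedModType R) (Z : R -> Om -> V) :
    open_measurable_fun (fun z : (measurableTypeR R * Om)%type => Z (clamp t T z.1) z.2) ->
    measurable_fun (`[t, T] `*` [set: Om])
      (fun z : (measurableTypeR R * Om)%type => (`|Z (clamp t T z.1) z.2| ^+ 2)%:E).
  move=> mZ; apply: measurable_funTS; apply/measurable_EFinP/measurable_funX.
  by apply: (open_measurable_comp mZ) => y; apply: cvg_norm; exact: cvg_id.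
split=> //.
- by have [+ _ _] := adm.
- rewrite (@double_integralD _ _ _ P t T (fun r w => (`|X x a (clamp t T r) w| ^+ 2)%:E)
    (fun r w => (`|a (clamp t T r) w| ^+ 2)%:E)).
  + apply: lte_add_pinfty; first exact: (state_sq_lty mild).
    exact: (control_sq_lty tT refOm p2 adm).
  + by move=> r w; rewrite lee_fin sqr_ge0.
  + by move=> r w; rewrite lee_fin sqr_ge0.
  + exact: norm2 mX.
  + exact: norm2 ma.
- apply: (state_moment_lty onbE sepH semS C0 bs sigma_HS tT refOm p2 adm mild).
  by rewrite tT lexx.
Qed.

Local Notation V := (fun x => value Lam0 l g p t T (X x)).

Lemma value_fin_num x : V x \is a fin_num.
Proof.
have [_ _ [C C0 bs]] := hbs.
have [l_cont [Cl Cl0 lg] lb] := hlg.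
have [a0 a00] := Lam0_neq0.
have l_growth y a : Lam0 a -> `|l y a| <= Cl * (1 + `|y| + `|a| ^+ 2).
  by move=> /(lg y y)[].
have g_lip y y' : `|g y - g y'| <= Cl * norm_m1 B (y - y') by have [] := lg y y' _ a00.
have adm0 := constant_admissible p Om tT a00.
have [m hm] : exists m : R, forall a, admissible Lam0 p t T a ->
    (m%:E <= cost l g t T (X x a) a)%E.
  have [bL|/lb[m [ml mg]]] := pselect (bounded_set Lam0); last first.
    exists (m * (T - t) + m) => a adm.
    exact: (cost_lower_bound sepH sepLam hiota c_gt0 iota_le Cl0 l_cont l_growth g_lip tT
      (admissible_square_integrable x adm) ml mg).
  have [M M0 aM] : exists2 M : R, 0 <= M & forall y, Lam0 y -> `|y| <= M.
    have [M [_ hM]] := bL; exists (Num.max 0 M + 1); first by rewrite addr_ge0// le_max lexx.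
    by apply: hM; rewrite ltr_pwDr// le_max lexx orbT.
  eexists => a adm.
  exact: (cost_lower_bound_moment sepH sepLam hiota c_gt0 iota_le Cl0 l_cont l_growth g_lip tT
    (admissible_square_integrable x adm) M0 aM
    (fun s tsT => state_moment_bounded onbE sepH semS C0 bs sigma_HS tT refOm adm (hX x adm)
      M0 aM tsT)).
have hi : (V x <= cost l g t T (X x (fun _ _ => a0)) (fun _ _ => a0))%E.
  by apply: ereal_inf_lbound; exists (fun _ _ => a0).
have lo : (m%:E <= V x)%E by apply: le_ereal_inf_tmp => _ [a adm <-]; exact: hm.
rewrite fin_numElt (lt_le_trans (ltNyr m) lo)/=; apply: (le_lt_trans hi).
have fin := cost_fin_num sepH sepLam hiota c_gt0 iota_le Cl0 l_cont l_growth g_lip tT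
  (admissible_square_integrable x adm0).
by move: fin; rewrite fin_numElt => /andP[].
Qed.

Lemma value_lipschitz : exists2 L : R, 0 <= L &
  forall x y, `|fine (V x) - fine (V y)| <= L * `|iota x - iota y|.
Proof.
have [_ _ [C C0 bs]] := hbs.
have [l_cont [Cl Cl0 lg] lb] := hlg.
have [a0 a00] := Lam0_neq0.
have l_lip y y' a : Lam0 a -> `|l y a - l y' a| <= Cl * norm_m1 B (y - y').
  by move=> /(lg y y')[].
have l_growth y a : Lam0 a -> `|l y a| <= Cl * (1 + `|y| + `|a| ^+ 2).
  by move=> /(lg y y)[].
have g_lip y y' : `|g y - g y'| <= Cl * norm_m1 B (y - y') by have [] := lg y y' _ a00.
pose K := difference_const c C c0 t T.
have K0 : 0 <= K by rewrite /K /difference_const !mulr_ge0 ?expR_ge0.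
have lin : linear iota by case: hiota.
pose L := Cl / 2 * (1 + K) * (T - t + 1).
have L0 : 0 <= L.
  apply: mulr_ge0; last by rewrite addr_ge0// subr_ge0.
  by apply: mulr_ge0; [rewrite divr_ge0// ltW|rewrite addr_ge0].
have one x y : fine (V x) <= fine (V y) + L * `|iota x - iota y|.
  (* Coinciding points are set aside because [cost_difference_le] divides by the distance, which is
     positive otherwise by injectivity of iota. *)
  have [->|xy] := eqVneq x y; first by rewrite subrr normr0 mulr0 addr0.
  have de0 : 0 < `|iota (x - y)|.
    rewrite lt_neqAle normr_ge0 andbT eq_sym; apply/eqP => /iota_inj/eqP.
    by rewrite subr_eq0 (negbTE xy).
  rewrite -(linear_funB lin) -lee_fin EFinD !fineK ?value_fin_num//.
  rewrite -leeBlDr//; apply: le_ereal_inf_tmp => _ [a adm <-]; rewrite leeBlDr//.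
  apply: (@le_trans _ _ (cost l g t T (X x a) a)).
    by apply: ereal_inf_lbound; exists a.
  exact: (cost_difference_le sepH sepLam hiota c_gt0 iota_le Cl0 l_cont l_lip l_growth g_lip tT
    (admissible_square_integrable x adm) (admissible_square_integrable y adm) K0 de0
    (fun s tsT => mild_difference_le onbE sepH semS hiota c_gt0 iota_le c00 S_iota C0 bs
      sigma_HS tT refOm adm (hX x adm) (hX y adm) tsT)).
exists L => // x y; rewrite ler_norml lerNl opprB !lerBlDl one andbT distrC.
exact: one.
Qed.

End ValueFunction.

(** * Extension of the value function to the completion *)

Theorem mainTheorem15
  (R : realType) (H Xi : hilbertType R) (Lam : completeNormedModType R)
  (sepH : separable H) (sepXi : separable Xi) (sepLam : separable Lam)
  (E : set Xi) (onbE : orthonormal_basis E)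
  (Lam0 : set Lam) (Lam0_neq0 : Lam0 !=set0)
  (Lam0_convex : forall (c : R) (a a' : Lam), 0 <= c <= 1 ->
     Lam0 a -> Lam0 a' -> Lam0 (c *: a + (1 - c) *: a'))
  (p T : R) (hp : 2 < p) (hT : 0 < T)
  (* the operator A with domain D and its semigroup S *)
  (D : set H) (A : H -> H) (S : R -> H -> H)
  (linA : linear_operator D A) (densA : dense D)
  (dissA : maximal_dissipative D A)
  (semS : contraction_semigroup S) (genS : generator D A S)
  (* the weak B-condition and the space H_{-1} *)
  (B : H -> H) (hB : weak_B_condition D A B)
  (Hm : hilbertType R) (iota : H -> Hm) (hHm : completion_m1 B iota)
  (* the coefficients *)
  (b : H -> Lam -> H) (sigma : H -> Lam -> Xi -> H)
  (l : H -> Lam -> R) (g : H -> R)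
  (sigma_HS : forall x a, hilbert_schmidt E (sigma x a))
  (hbs : dynamics_assumptions E Lam0 B b sigma)
  (hlg : cost_assumptions Lam0 B l g)
  (* the reference probability spaces and the mild solutions *)
  (Om : R -> ref_space Xi)
  (hOm : forall t, 0 <= t <= T -> reference_space (Om t) t T)
  (X : forall t, H -> (R -> Om t -> Lam) -> R -> Om t -> H)
  (hX : forall t x (a : R -> Om t -> Lam), 0 <= t <= T ->
     admissible Lam0 p t T a ->
     mild_solution E S b sigma t T x a (X t x a))
  (V : R -> H -> \bar R)
  (defV : forall t x, V t x = value Lam0 l g p t T (X t x))
  (hV : forall t, 0 <= t <= T ->
     semiconvex_m1 B (fun x => fine (V t x)) /\
     semiconcave_m1 B (fun x => fine (V t x))) :
  exists Vext : R -> Hm -> R, forall t, 0 <= t <= T ->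
    (forall x, V t x = (Vext t (iota x))%:E) /\ C11 (Vext t).
Proof.
have [bB [_ posB] _] := hB.
have [lin inner_iota dens] := hHm.
have [c c_gt0 iota_le] := completion_m1_bounded hHm bB.
have [c0 c00 S_iota] := semigroup_negative_norm densA semS genS hHm hB.
(* Strict positivity of B makes its form a norm on H. *)
have iota_inj x : `|iota x| = 0 -> x = 0.
  move=> ix; apply/eqP; apply: contraT => /posB.
  by rewrite -inner_iota inner_norm ix expr0n ltxx.
suff /choice[Vext hVext] : forall t, exists f : Hm -> R, 0 <= t <= T ->
    (forall x, V t x = (f (iota x))%:E) /\ C11 f by exists Vext.
(* The choice of extensions ranges over all real t; outside [0, T] nothing is claimed and the zero
   function is the default. *)
move=> t; have [t0T|] := boolP (0 <= t <= T); last by exists (fun=> 0).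
have /andP[_ tT] := t0T.
have hXt x a := hX t x a t0T.
have Vfin x : V t x \is a fin_num.
  rewrite defV; exact: (value_fin_num onbE sepH sepLam Lam0_neq0 hp semS hHm c_gt0 iota_le
    hbs hlg sigma_HS tT (hOm t t0T) hXt).
have [L L0 vL] := value_lipschitz onbE sepH sepLam Lam0_neq0 hp semS hHm c_gt0 iota_le
  iota_inj c00 S_iota hbs hlg sigma_HS tT (hOm t t0T) hXt.
have {}vL x y : `|fine (V t x) - fine (V t y)| <= L * `|iota x - iota y|.
  by rewrite !defV.
have [[C1 C10 cvx] [C2 C20 ccv]] := hV t t0T.
(* Semiconcavity gives the upper bound and semiconvexity the lower one; either constant is enlarged
   to the sum C1 + C2 to obtain one two-sided inequality. *)
have semi (lam : R) x x' : 0 <= lam <= 1 ->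
    `|lam * fine (V t x) + (1 - lam) * fine (V t x') -
      fine (V t (lam *: x + (1 - lam) *: x'))| <=
    (C1 + C2) * lam * (1 - lam) * `|iota x - iota x'| ^+ 2.
  move=> lam01; have /andP[lam0 lam1] := lam01.
  have q0 (C : R) : 0 < C -> 0 <= C * lam * (1 - lam) * `|iota x - iota x'| ^+ 2.
    by move=> C0; rewrite !mulr_ge0 ?sqr_ge0 ?subr_ge0// ltW.
  have := cvx lam x x' lam01; have := ccv lam x x' lam01.
  have := q0 _ C10; have := q0 _ C20.
  rewrite (norm_m1E hHm) (linear_funB lin) !mulrDl ler_norml.
  move: (C1 * _ * _ * _) (C2 * _ * _ * _) (fine _) (fine _) (fine _) => q1 q2 v1 v2 v3.
  by move=> *; apply/andP; split; lra.
exists (mcshane iota (fun x => fine (V t x)) L) => _; split.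
  by move=> x; rewrite (mcshaneE L0 vL) fineK.
exact: (C11_mcshane lin dens L0 (addr_ge0 (ltW C10) (ltW C20)) vL semi).
Qed.
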